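(* Let $\pi=(d_{1},\ldots,d_{n})$ be a non-increasing positive graphic sequence with $n$ even, let $k$ be a positive integer, and suppose $\mathcal{D}_{k}(\pi)=(d_{1}-k,\ldots,d_{n}-k)$ is graphic. If \[d_{\min\{\frac{n}{2},\,m(\pi)-1\}}> \Big\lceil\frac{n+3k-8}{2}\Big\rceil\quad\text{or}\quad \Big\lceil\frac{n+5-k}{2}\Big\rceil>d_{\max\{\frac{n}{2}+1,\;n+2-m(\overline{\mathcal{D}_{k}(\pi)})\}},\] then some realization of $\pi$ has $k$ pairwise edge-disjoint $1$-factors.
   Context: All graphs are finite and simple. A sequence is graphic if it is the degree sequence of some simple graph (a realization). Non-increasing means $d_1\ge\cdots\ge d_n$; positive means all $d_i\ge1$. A $1$-factor is a perfect matching. For a non-increasing sequence $\sigma=(s_1,\ldots,s_n)$, the modified Durfee number is $m(\sigma)=\max\{i: s_i\ge i-1\}$. For a sequence $\sigma=(s_1,\ldots,s_n)$, its complement is $\overline{\sigma}=(n-1-s_n,\ldots,n-1-s_1)$ (again non-increasing when $\sigma$ is). Thus $\overline{\mathcal{D}_k(\pi)}=(n-1-d_n+k,\ldots,n-1-d_1+k)$. *)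

(* Defs.v *)
From mathcomp Require Import all_boot all_order all_algebra.
Set Implicit Arguments.
Unset Strict Implicit.
Unset Printing Implicit Defensive.
Import Order.TTheory GRing.Theory Num.Theory.
Local Open Scope ring_scope.

Definition simple_graph (T : finType) (e : rel T) : Prop :=
  symmetric e /\ irreflexive e.

Definition degree (T : finType) (e : rel T) (v : T) : nat :=
  #|[set w | e v w]|.

(* A perfect matching of e, given as a spanning 1-regular subgraph. *)
Definition one_factor (T : finType) (e f : rel T) : Prop :=
  [/\ simple_graph f, subrel f e & forall v, degree f v = 1%N].

Definition edge_disjoint (T : finType) (f g : rel T) : Prop :=
  forall x y, ~~ (f x y && g x y).

(* Sequences are integer-valued so that d_i - k and n - 1 - d_i are true
   differences; a graphic sequence is then automatically nonnegative. *)
Definition realization (n : nat) (s : n.-tuple int) (e : rel 'I_n) : Prop :=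
  simple_graph e /\ forall i, (degree e i)%:Z = tnth s i.

Definition graphic (n : nat) (s : n.-tuple int) : Prop :=
  exists e : rel 'I_n, realization s e.

Definition nonincreasing (n : nat) (s : n.-tuple int) : bool :=
  sorted (fun x y => y <= x) s.

Definition positive (n : nat) (s : n.-tuple int) : bool :=
  all (fun x => 1 <= x) s.

(* 1-based access: term s i is s_i, meaningful for 1 <= i <= n. *)
Definition term (n : nat) (s : n.-tuple int) (i : nat) : int := s`_(i.-1).

Definition durfee (n : nat) (s : n.-tuple int) : nat :=
  (\max_(1 <= i < n.+1 | (i%:Z - 1 <= term s i)%R) i)%N.

Definition complement (n : nat) (s : n.-tuple int) : n.-tuple int :=
  [tuple of rev [seq n%:Z - 1 - x | x <- s]].

Definition Dk (n k : nat) (s : n.-tuple int) : n.-tuple int :=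
  [tuple of [seq x - k%:Z | x <- s]].

(* Main.v *)
(** Fix graphs G and H with deg G = deg H + k, and let n = 2 nu.  By an
    exchange argument H may be taken inside G; for k = 1 the difference G \ H is a
    matching, and for k = 2 its odd cycles can be merged in pairs.
    For k >= 3 the first condition gives a bound B with at least nu vertices of
    degree >= B, or else a bound m <= nu with m - 1 vertices of degree >= B and at
    most m vertices of degree >= m.

    In the first case let the poor vertices be those of degree <= B - k + 1.
    Switching 4- and 6-cycles in a realization, guided by a minimum cut, leads to
    a realization in which every poor vertex can be assigned k distinct non-poor
    neighbours, each used at most k times: at a minimal positive deficiency, the
    degrees in H contradict tightness of the cut.  Splitting this assignment into
    k colours (Birkhoff) gives k disjoint matchings covering the poor vertices.
    They are completed colour by colour by augmentation, Ore's condition and one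
    Kempe-type exchange between two colours.

    In the second case the same argument is applied to the complements of H and G:
    from a packing there, delete the matchings and complement again.  The second
    condition of the theorem is the first one for these complements. *)

From Stdlib Require Import Classical.
Require Import Defs.
From mathcomp Require Import all_boot all_order all_algebra zify.
Set Implicit Arguments.
Unset Strict Implicit.
Unset Printing Implicit Defensive.
Import Order.TTheory GRing.Theory Num.Theory.
Local Open Scope nat_scope.

(** For k >= 3 nothing controls the odd components of G \ H, so the matchings are not sought there:
    they are built anew in G, and H only certifies that the degrees minus k are graphic. The
    constants come from two counts. Let B = nu + c with c the ceiling of (3k - 6)/2. This is the
    extreme value at which augmenting paths of at most three edges can still fail; the rigidity of
    that extreme case is what makes an exchange of two colours succeed. Vertices of degree at most B
    - k + 1 escape this count and must be covered beforehand. The same threshold keeps switches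
    available: a big vertex whose flow uses a non-edge has at least B - k + 1 neighbours outside the
    flow, too many to be all adjacent to a given poor vertex. In the complementary case at most one
    vertex is intermediate; it is covered along with the poor ones, and Ore's condition alone
    finishes. *)

Lemma sum_setUI (T : finType) (f : T -> nat) (U W : {set T}) :
  \sum_(v in U :|: W) f v + \sum_(v in U :&: W) f v =
  \sum_(v in U) f v + \sum_(v in W) f v.
Proof.
rewrite 4!(big_mkcond (fun v => v \in _)) -!big_split; apply: eq_bigr => v _ /=.
by rewrite !inE; case: (v \in U); case: (v \in W); rewrite /= ?addn0 ?add0n.
Qed.

Lemma sum_le_set (T : finType) (f : T -> nat) (U W : {set T}) :
  U \subset W -> \sum_(v in U) f v <= \sum_(v in W) f v.
Proof.
move=> sUW; rewrite big_mkcond [X in _ <= X]big_mkcond; apply: leq_sum => v _.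
by case: ifP => // /(subsetP sUW) ->.
Qed.

Lemma sum_pred1_le (T : finType) (P : pred T) (f : T -> nat) (x : T) :
  P x -> f x <= \sum_(v | P v) f v.
Proof. by move=> Px; rewrite (bigD1 x) //= leq_addr. Qed.

Lemma sum_setT (T : finType) (f : T -> nat) : \sum_(v in setT) f v = \sum_v f v.
Proof. by apply: eq_bigl => v; rewrite inE. Qed.

Lemma sum_in_eq (T : finType) (U : {set T}) (x : T) :
  \sum_(v in U) (v == x) = (x \in U).
Proof.
have [xU|xU] := boolP (x \in U); last first.
  by apply: big1 => v vU; case: eqP vU xU => // -> ->.
rewrite (bigD1 x) //= eqxx big1 // => v /andP[_ /negPf ->] //.
Qed.

(** * Flows and the decomposition of regular matrices *)

Section Flow.

Variables (A R : finType).
Implicit Types (a : A -> nat) (b : R -> nat) (w : A -> R -> nat) (U : {set R}).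

Definition wsum w p U := \sum_(v in U) w p v.
Definition cut a w U := \sum_p minn (a p) (wsum w p U).

Lemma wsumUI w p U U' :
  wsum w p (U :|: U') + wsum w p (U :&: U') = wsum w p U + wsum w p U'.
Proof. exact: sum_setUI. Qed.

Lemma wsum_sub w p U U' : U \subset U' -> wsum w p U <= wsum w p U'.
Proof. exact: sum_le_set. Qed.

Lemma wsum0 w p : wsum w p set0 = 0.
Proof. by rewrite /wsum big_set0. Qed.

Lemma wsumU1 w p v U : v \notin U -> wsum w p (v |: U) = w p v + wsum w p U.
Proof. by move=> vU; rewrite /wsum big_setU1. Qed.

Lemma cut_submod a w U U' :
  cut a w (U :|: U') + cut a w (U :&: U') <= cut a w U + cut a w U'.
Proof.
rewrite /cut -!big_split; apply: leq_sum => p _ /=.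
have := wsumUI w p U U'.
have := wsum_sub w p (subsetIl U U'); have := wsum_sub w p (subsetIr U U').
have := wsum_sub w p (subsetUl U U'); have := wsum_sub w p (subsetUr U U').
lia.
Qed.

(** Induction on the total demand, routing one unit at a time to a fixed [v0]. Submodularity of
    [cut] makes the tight sets avoiding [v0] closed under union, so the largest of them, [Us],
    decides which unit is safe. *)
Lemma feasible_flow a b w :
  (forall U, \sum_(v in U) b v <= cut a w U) ->
  exists J : A -> R -> nat,
    [/\ forall p v, J p v <= w p v,
        forall p, \sum_v J p v <= a p &
        forall v, \sum_p J p v = b v].
Proof.
have [N] := ubnP (\sum_v b v); elim: N => // N IH in a b w * => ltN cutP.
have [v0 b0 | b0] := pickP (fun v => 0 < b v); last first.
  exists (fun _ _ => 0); split => // [p|v]; rewrite big1 //.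
  by have := b0 v; rewrite lt0n => /negbFE/eqP ->.
pose tight U := (v0 \notin U) && (cut a w U == \sum_(v in U) b v).
have tight0 : tight set0.
  rewrite /tight inE big_set0 /cut big1 // => p _; rewrite wsum0; lia.
have [Us /andP[vUs /eqP cUs] Umax] := arg_maxnP (fun U : {set R} => #|U|) tight0.
have maxU U : tight U -> U \subset Us.
  move=> /andP[vU /eqP cU].
  have tU : tight (U :|: Us).
    rewrite /tight inE negb_or vU vUs /=.
    have := cut_submod a w U Us; have := sum_setUI b U Us.
    have := cutP (U :|: Us); have := cutP (U :&: Us).
    rewrite cU cUs; lia.
  have := Umax _ tU; rewrite /= leqNgt; apply: contraR => nsub.
  by apply: proper_card; rewrite properE subsetUr subUset subxx andbT.
(* A unit from [p] is safe if [Us] does not saturate [p]. Were there no such [p], adding [v0] to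
   [Us] would not raise the cut, although it raises the demand. *)
have [p /and3P[ap wp good]|bad] :=
    pickP (fun p => [&& 0 < a p, 0 < w p v0 & wsum w p Us < a p]); last first.
  have := cutP (v0 |: Us); rewrite big_setU1 //= -cUs.
  have : cut a w (v0 |: Us) <= cut a w Us.
    apply: leq_sum => p _; have := bad p; rewrite wsumU1 //.
    lia.
  lia.
pose d (c : bool) := if c then 1 else 0.
pose a' q := a q - (q == p); pose b' v := b v - (v == v0).
pose w' q v := w q v - ((q == p) && (v == v0)).
have sb U : \sum_(v in U) b v = \sum_(v in U) b' v + (v0 \in U).
  rewrite -sum_in_eq -big_split; apply: eq_bigr => v _.
  by rewrite /b' /=; case: eqP => [->|]; lia.
have switch q U : wsum w q U = wsum w' q U + ((q == p) && (v0 \in U)).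
  rewrite -mulnb -sum_in_eq big_distrr -big_split; apply: eq_bigr => v _.
  by rewrite /w' /=; case: eqP => [->|]; case: eqP => [->|]; lia.
have [||J [J1 J2 J3]] := IH a' b' w'.
- by have := sb setT; rewrite inE !sum_setT; lia.
- move=> U.
  (* The cut loses at most one, and only if [U] contains [v0] or saturates [p]. In the first case
     the demand drops as well; in the second [U] is not tight, since a tight set avoiding [v0] lies
     in [Us]. *)
  have cE : cut a w U <= cut a' w' U +
      ((v0 \in U) || (a p <= wsum w p U)).
    rewrite /cut (bigD1 p) //= [X in _ <= X + _](bigD1 p) //=.
    rewrite -addnA [X in _ <= _ + X]addnC addnA; apply: leq_add; last first.
      by apply: leq_sum => q /negPf qp; rewrite (switch q) /a' qp subn0 addn0.
    have := switch p U; rewrite /a' eqxx /=.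
    case: (v0 \in U) => /=; case: leqP => /=; lia.
  have := sb U; have := cutP U; move: cE.
  have [vU|vU] /= := boolP (v0 \in U); first lia.
  have [aU|aU] := leqP (a p) (wsum w p U); last by lia.
  have [tU|tU] := boolP (tight U).
    have := wsum_sub w p (maxU _ tU); lia.
  move: tU; rewrite /tight vU /=; lia.
have sT (T : finType) (x : T) : \sum_v (v == x) = 1.
  by rewrite -sum_setT sum_in_eq inE.
exists (fun q v => J q v + ((q == p) && (v == v0))); split=> [q v|q|v].
- have := J1 q v; rewrite /w'; case: eqP => [->|]; case: eqP => [->|] //=; lia.
- have sE : \sum_v ((q == p) && (v == v0) : nat) = (q == p) * \sum_v (v == v0).
    by rewrite big_distrr; apply: eq_bigr => v _; case: (q == p); case: (v == v0).
  by rewrite big_split /= sE sT; have := J2 q; rewrite /a'; case: eqP => [->|_] /=; lia.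
- have sE : \sum_q ((q == p) && (v == v0) : nat) = (v == v0) * \sum_q (q == p).
    by rewrite big_distrr; apply: eq_bigr => q _; case: (q == p); case: (v == v0).
  by rewrite big_split J3 /b' /= sE sT; case: eqP => [->|_] /=; lia.
Qed.

End Flow.

Lemma sum_nat_le (T : finType) (f : T -> nat) (x : T) : f x <= \sum_v f v.
Proof. exact: sum_pred1_le. Qed.

Lemma sum_nat_le2 (T : finType) (f : T -> nat) (x y : T) :
  x != y -> f x + f y <= \sum_v f v.
Proof. by move=> xy; rewrite (bigD1 x) // (bigD1 y) 1?eq_sym //= addnA leq_addr. Qed.

Lemma sum_nat_gt0 (T : finType) (P : pred T) (f : T -> nat) :
  0 < \sum_(v | P v) f v -> exists2 v, P v & 0 < f v.
Proof.
rewrite lt0n sum_nat_eq0 negb_forall => /existsP[v].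
by rewrite negb_imply -lt0n => /andP[Pv fv]; exists v.
Qed.

Lemma sumT1 (T : finType) (x : T) : \sum_v (v == x) = 1.
Proof. by rewrite -sum_setT sum_in_eq inE. Qed.

(** With unit supplies and demands and the support of [W] as capacities, k-regularity gives the cut
    condition; the flow is a permutation matrix, and subtracting it lowers k. *)
Lemma birkhoff (T : finType) k (W : T -> T -> nat) :
    (forall a, \sum_b W a b = k) -> (forall b, \sum_a W a b = k) ->
  exists s : 'I_k -> T -> T, (forall i, injective (s i)) /\
    (forall a b, \sum_i (s i a == b) = W a b).
Proof.
elim: k W => [|k IH] W rowW colW.
  exists (fun _ => id); split=> [i|a b]; first by case: i.
  by have := sum_nat_le (W a) b; rewrite rowW big_ord0; lia.
pose w a b := minn 1 (W a b).
have [U|J [J1 J2 J3]] := @feasible_flow _ _ (fun _ => 1) (fun _ => 1) w.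
  have : \sum_(v in U) k.+1 <= \sum_p k.+1 * minn 1 (wsum w p U).
    rewrite -(eq_bigr _ (fun v _ => colW v)) exchange_big /=; apply: leq_sum => p _.
    have [w0|wp] := posnP (wsum w p U).
      rewrite w0 big1 // => v vU; have := sum_pred1_le (w p) vU.
      by rewrite -/(wsum w p U) w0 /w; lia.
    apply: (@leq_trans (\sum_b W p b)); last by rewrite rowW (minn_idPl wp) muln1.
    by rewrite [X in _ <= X](bigID (fun v => v \in U)) leq_addr.
  rewrite -big_distrr sum_nat_const sum1_card /=; rewrite mulnC leq_pmul2l //.
have rowJ a : \sum_b J a b = 1.
  have flow_total : \sum_a \sum_b J a b = \sum_(a : T) 1 by rewrite exchange_big; apply: eq_bigr.
  move: flow_total; rewrite (bigD1 a) //= [RHS](bigD1 a) //=.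
  have : \sum_(i | i != a) \sum_b J i b <= \sum_(i | i != a) 1 by apply: leq_sum.
  have := J2 a; lia.
have Jex a : exists b, 0 < J a b.
  by have [|b _ Jb] := @sum_nat_gt0 _ predT (J a); [rewrite rowJ|exists b].
pose f a := xchoose (Jex a).
have fP a : 0 < J a (f a) := xchooseP (Jex a).
have JE a b : J a b = (f a == b).
  have := fP a; have := rowJ a; case: eqP => [<-|/eqP neq].
    by have := sum_nat_le (J a) (f a); lia.
  by have := sum_nat_le2 (J a) neq; lia.
have injf : injective f.
  move=> a b fab; apply/eqP/negPn/negP => neq.
  by have := sum_nat_le2 (J^~ (f a)) neq; rewrite J3 !JE fab eqxx.
have [||s [injs sE]] := IH (fun a b => W a b - J a b).
- move=> a; rewrite sumnB ?rowW ?rowJ ?subn1 // => b _.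
  by have := J1 a b; rewrite /w; lia.
- move=> b; rewrite sumnB ?colW ?J3 ?subn1 // => a _.
  by have := J1 a b; rewrite /w; lia.
exists (fun i => if unlift ord0 i is Some j then s j else f); split=> [i|a b].
  by case: unliftP.
rewrite big_ord_recl unlift_none -JE.
under eq_bigr do rewrite liftK.
by rewrite sE subnKC //; have := J1 a b; rewrite /w; lia.
Qed.

(** * Switching edges *)

Section Switch.

Variable V : finType.
Implicit Types (G H : rel V) (v w : V) (U W : {set V}) (es rs ads : seq (V * V)).

Definition cnt G v U := \sum_(w in U) G v w.
Definition deg G v := cnt G v setT.

Lemma deg_sum G v : deg G v = \sum_w G v w.
Proof. exact: sum_setT. Qed.

Lemma degreeE G v : degree G v = deg G v.
Proof. by rewrite deg_sum /degree cardsE -sum1_card big_mkcond. Qed.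

Lemma cntUI G v U W : cnt G v (U :|: W) + cnt G v (U :&: W) = cnt G v U + cnt G v W.
Proof. exact: sum_setUI. Qed.

Lemma cntC G v U : cnt G v U + cnt G v (~: U) = deg G v.
Proof. by rewrite -cntUI setUCr setICr /cnt big_set0 addn0. Qed.

Lemma cnt_sub G v U W : U \subset W -> cnt G v U <= cnt G v W.
Proof. exact: sum_le_set. Qed.

Lemma cnt_card G v U : cnt G v U <= #|U|.
Proof. by rewrite -sum1_card; apply: leq_sum => w _; case: (G v w). Qed.

Lemma cnt_ex G v U : 0 < cnt G v U -> exists2 w, w \in U & G v w.
Proof. by case/sum_nat_gt0 => w wU; case Gvw: (G v w) => // _; exists w. Qed.

Definition samep (a b c d : V) := ((a == c) && (b == d)) || ((a == d) && (b == c)).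
Definition inE2 es v w := has (fun e => samep v w e.1 e.2) es.
Definition switch G rs ads v w := (G v w && ~~ inE2 rs v w) || inE2 ads v w.
Definition okE es :=
  all (fun e => e.1 != e.2) es && pairwise (fun e f => ~~ samep e.1 e.2 f.1 f.2) es.
Definition contr es v U :=
  \sum_(e <- es) ((v == e.1) * (e.2 \in U) + (v == e.2) * (e.1 \in U)).

Lemma samepP a b c d : reflect (a = c /\ b = d \/ a = d /\ b = c) (samep a b c d).
Proof.
by apply: (iffP orP) => [[]/andP[/eqP-> /eqP->]|[][-> ->]]; rewrite ?eqxx; auto.
Qed.

Lemma samepC a b c d : samep a b c d = samep b a c d.
Proof. by rewrite /samep orbC ![(b == _) && _]andbC. Qed.

Lemma inE2C es v w : inE2 es v w = inE2 es w v.
Proof. by apply: eq_has => e; rewrite samepC. Qed.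

Lemma inE2_sum es v w : okE es ->
  inE2 es v w = \sum_(e <- es) ((v == e.1) * (w == e.2) + (v == e.2) * (w == e.1)) :> nat.
Proof.
elim: es => [|e es IH]; first by rewrite big_nil.
rewrite /okE /= => /andP[/andP[ne ale] /andP[nsp pes]].
rewrite big_cons -IH ?/okE ?ale //.
have [vw|nvw] := boolP (samep v w e.1 e.2).
  have -> : inE2 es v w = false.
    apply/negP => /hasP[f fes sf]; move/allP: nsp => /(_ f fes) /negP; apply.
    by case/samepP: vw sf => -[-> ->] //; rewrite samepC.
  have ne' : e.2 != e.1 by rewrite eq_sym.
  by case/samepP: vw => -[-> ->]; rewrite !eqxx ?(negPf ne) ?(negPf ne').
move: nvw; rewrite /samep; case: (v == e.1); case: (w == e.1);
  case: (v == e.2); case: (w == e.2) => //.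
Qed.

Lemma sum_inE2 es v U : okE es -> \sum_(w in U) inE2 es v w = contr es v U.
Proof.
move=> ok; under eq_bigr do rewrite inE2_sum //.
rewrite exchange_big; apply: eq_bigr => e _ /=.
by rewrite big_split -!big_distrr /= !sum_in_eq.
Qed.

Lemma inE2_sub G es v w : symmetric G -> all (fun e => G e.1 e.2) es -> inE2 es v w -> G v w.
Proof.
by move=> sG /allP aG /hasP[e /aG Ge /samepP[][-> ->]] //; rewrite sG.
Qed.

Lemma inE2_subN G es v w : symmetric G -> all (fun e => ~~ G e.1 e.2) es ->
  inE2 es v w -> ~~ G v w.
Proof.
by move=> sG /allP aG /hasP[e /aG Ge /samepP[][-> ->]] //; rewrite sG.
Qed.

Lemma inE2_irr es v : okE es -> inE2 es v v = false.
Proof.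
case/andP=> /allP ne _; apply/negP => /hasP[e /ne nee /samepP[][e1 e2]];
  by rewrite -e1 -e2 eqxx in nee.
Qed.

Lemma sw_simple G rs ads : simple_graph G -> okE ads -> simple_graph (switch G rs ads).
Proof.
move=> [sG iG] ok; split=> [v w|v]; first by rewrite /switch [G v w]sG (inE2C rs) (inE2C ads).
by rewrite /switch iG (inE2_irr _ ok).
Qed.

Definition valid_sw G rs ads :=
  [&& okE rs, okE ads, all (fun e => G e.1 e.2) rs & all (fun e => ~~ G e.1 e.2) ads].

Lemma sw_valid_simple G rs ads : simple_graph G -> valid_sw G rs ads ->
  simple_graph (switch G rs ads).
Proof. by move=> gG /and4P[_ oa _ _]; exact: sw_simple. Qed.

(** Additive form, with the removed edges on the left, so that no truncated subtraction enters the
    later degree counts. *)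
Lemma sw_add G rs ads v w : simple_graph G -> valid_sw G rs ads ->
  switch G rs ads v w + inE2 rs v w = G v w + inE2 ads v w.
Proof.
move=> [sG iG] /and4P[_ _ rG aG]; rewrite /switch.
have := inE2_sub sG rG (v := v) (w := w); have := inE2_subN sG aG (v := v) (w := w).
by case: (G v w); case: (inE2 rs v w); case: (inE2 ads v w) => // A B;
  try (by have := A isT); have := B isT.
Qed.

Lemma cnt_sw G rs ads v U : simple_graph G -> valid_sw G rs ads ->
  cnt (switch G rs ads) v U + contr rs v U = cnt G v U + contr ads v U.
Proof.
move=> gG ok; have /and4P[or oa _ _] := ok.
by rewrite -!sum_inE2 // -!big_split; apply: eq_bigr => w _; rewrite /= sw_add.
Qed.

(** Ordered pairs are counted, so each edge of H outside G counts twice; hence the factors 2 in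
    [diff_swG] and [diff_swH]. *)
Definition diffn H G := \sum_v \sum_w (H v w && ~~ G v w).

Lemma sum_inE2_rel (P : rel V) es : symmetric P -> okE es ->
  \sum_v \sum_w (inE2 es v w && P v w) = 2 * \sum_(e <- es) P e.1 e.2.
Proof.
move=> sP ok; have sE v w : inE2 es v w && P v w = \sum_(e <- es)
    ((v == e.1) * ((w == e.2) * P e.1 e.2) + (v == e.2) * ((w == e.1) * P e.1 e.2)) :> nat.
  rewrite -mulnb inE2_sum // big_distrl; apply: eq_bigr => e _ /=.
  rewrite mulnDl -!mulnA; congr (_ + _).
    by case: eqP => [->|_]; rewrite ?mul0n //; case: eqP => [->|_]; rewrite ?mul0n.
  by case: eqP => [->|_]; rewrite ?mul0n //; case: eqP => [->|_]; rewrite ?mul0n // sP.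
under eq_bigr => v _ do under eq_bigr => w _ do rewrite sE.
under eq_bigr => v _ do rewrite exchange_big.
rewrite exchange_big big_distrr; apply: eq_bigr => e _ /=.
under eq_bigr => v _ do rewrite big_split -!big_distrr -!big_distrl /= !sumT1.
by rewrite big_split -!big_distrl /= !sumT1; lia.
Qed.

Lemma diff_swG H G rs ads : simple_graph G -> simple_graph H -> valid_sw G rs ads ->
  diffn H (switch G rs ads) + 2 * \sum_(e <- ads) H e.1 e.2 =
  diffn H G + 2 * \sum_(e <- rs) H e.1 e.2.
Proof.
move=> gG [sH iH] ok; have /and4P[or oa _ _] := ok.
rewrite -!sum_inE2_rel // -!big_split; apply: eq_bigr => v _ /=.
rewrite -!big_split; apply: eq_bigr => w _ /=; have := sw_add v w gG ok.
by case: (H v w); case: (G v w); case: (switch G rs ads v w) => //=; lia.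
Qed.

Lemma diff_swH H G rs ads : simple_graph G -> simple_graph H -> valid_sw H rs ads ->
  diffn (switch H rs ads) G + 2 * \sum_(e <- rs) ~~ G e.1 e.2 =
  diffn H G + 2 * \sum_(e <- ads) ~~ G e.1 e.2.
Proof.
move=> [sG iG] gH ok; have /and4P[or oa _ _] := ok.
rewrite -!(sum_inE2_rel (P := fun v w => ~~ G v w)) //; try by move=> v w; rewrite sG.
rewrite -!big_split; apply: eq_bigr => v _ /=.
rewrite -!big_split; apply: eq_bigr => w _ /=; have := sw_add v w gH ok.
by case: (H v w); case: (G v w); case: (switch H rs ads v w) => //=; lia.
Qed.

End Switch.

(** * Switches along alternating 4- and 6-cycles, and Kundu's theorem *)

Section Cycles.

Variable V : finType.
Implicit Types (G H : rel V) (U : {set V}).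

Lemma simple_neq G v w : simple_graph G -> G v w -> v != w.
Proof. by move=> [_ iG] Gvw; apply: contraTneq Gvw => ->; rewrite iG. Qed.

Lemma sw_keep G rs ads v w : G v w -> ~~ inE2 rs v w -> switch G rs ads v w.
Proof. by rewrite /switch => -> ->. Qed.

Lemma sw_new G rs ads v w : inE2 ads v w -> switch G rs ads v w.
Proof. by rewrite /switch orbC => ->. Qed.

Definition sw4 G a b c d := switch G [:: (a, b); (c, d)] [:: (b, c); (d, a)].

Lemma sw4_valid G a b c d : simple_graph G ->
    a != c -> b != d -> b != c -> d != a ->
    G a b -> G c d -> ~~ G b c -> ~~ G d a ->
  valid_sw G [:: (a, b); (c, d)] [:: (b, c); (d, a)].
Proof.
move=> gG ac bd bc da ab cd nbc nda.
rewrite /valid_sw /okE /= ab cd nbc nda bc da !andbT /=.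
rewrite (simple_neq gG ab) (simple_neq gG cd) /=.
rewrite /samep (negPf ac) (negPf bc) (negPf bd) !andbF /= negb_and.
by rewrite eq_sym (simple_neq gG ab).
Qed.

Lemma sw4_deg G a b c d v : simple_graph G ->
    valid_sw G [:: (a, b); (c, d)] [:: (b, c); (d, a)] ->
  deg (sw4 G a b c d) v = deg G v.
Proof.
move=> gG /(cnt_sw v setT gG); rewrite /contr !big_cons !big_nil /= !inE.
by rewrite -!/(deg _ _) -/(sw4 G a b c d); lia.
Qed.

Definition sw6 G a b c d e f :=
  switch G [:: (a, b); (c, d); (e, f)] [:: (b, c); (d, e); (f, a)].

Lemma sw6_valid G a b c d e f : simple_graph G ->
    a != c -> a != e -> a != f -> c != e -> c != f -> b != c -> d != e ->
    G a b -> G c d -> G e f -> ~~ G b c -> ~~ G d e -> ~~ G f a ->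
  valid_sw G [:: (a, b); (c, d); (e, f)] [:: (b, c); (d, e); (f, a)].
Proof.
move=> gG ac ae af ce cf bc de ab cd ef nbc nde nfa.
rewrite /valid_sw /okE /= ab cd ef nbc nde nfa bc de (eq_sym f) af !andbT /=.
rewrite (simple_neq gG ab) (simple_neq gG cd) (simple_neq gG ef) /=.
have dc := simple_neq gG cd; rewrite eq_sym in dc.
have fe := simple_neq gG ef; rewrite eq_sym in fe.
rewrite /samep (negPf ac) (negPf bc) (negPf ae) (negPf af) (negPf ce) (negPf cf) !andbF /=.
rewrite (eq_sym c d) (negPf dc) (eq_sym c a) (negPf ac) (eq_sym e f) (negPf fe).
by rewrite (eq_sym e a) (negPf ae) !andbF.
Qed.

Lemma sw6_deg G a b c d e f v : simple_graph G ->
    valid_sw G [:: (a, b); (c, d); (e, f)] [:: (b, c); (d, e); (f, a)] ->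
  deg (sw6 G a b c d e f) v = deg G v.
Proof.
move=> gG /(cnt_sw v setT gG); rewrite /contr !big_cons !big_nil /= !inE.
by rewrite -!/(deg _ _) -/(sw6 G a b c d e f); lia.
Qed.

Lemma deg_diff (P Q : rel V) v :
  deg P v + \sum_w (Q v w && ~~ P v w) = deg Q v + \sum_w (P v w && ~~ Q v w).
Proof.
rewrite !deg_sum -!big_split; apply: eq_bigr => w _ /=.
by case: (P v w); case: (Q v w).
Qed.

(* Otherwise N_G z \ N_H z, with s added, embeds in N_G u \ N_H u, while
   N_H u \ N_G u is no larger than N_H z \ N_G z; but for both vertices the
   two differences have sizes k apart. *)
Lemma kundu_count G H k s z u :
    simple_graph G -> simple_graph H -> (forall v, deg G v = deg H v + k) ->
    H s z -> ~~ G s z -> G s u -> ~~ H s u ->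
  (exists2 t, [/\ H u t, ~~ H z t & t != z] & ~~ G u t || G z t) \/
  (exists2 q, [/\ G z q, ~~ G u q & q != u] & ~~ H z q || H u q).
Proof.
move=> [sG iG] [sH iH] dGH Hsz nGsz Gsu nHsu.
have [/existsP[t /andP[/and3P[h1 h2 h3] h4]]|noH] := boolP
   [exists t, [&& H u t, ~~ H z t & t != z] && (~~ G u t || G z t)].
  by left; exists t.
have [/existsP[q /andP[/and3P[h1 h2 h3] h4]]|noG] := boolP
   [exists q, [&& G z q, ~~ G u q & q != u] && (~~ H z q || H u q)].
  by right; exists q.
have nH t : [&& H u t, ~~ H z t & t != z] && (~~ G u t || G z t) = false.
  by apply/negbTE; move: noH; rewrite negb_exists => /forallP.
have nG q : [&& G z q, ~~ G u q & q != u] && (~~ H z q || H u q) = false.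
  by apply/negbTE; move: noG; rewrite negb_exists => /forallP.
pose n1 (P Q : rel V) v := \sum_w (P v w && ~~ Q v w).
have e1 : n1 G H u = n1 H G u + k by have := dGH u; have := deg_diff G H u; rewrite /n1; lia.
have e2 : n1 G H z = n1 H G z + k by have := dGH z; have := deg_diff G H z; rewrite /n1; lia.
have uz : u != z by apply: contraTneq Gsu => ->.
(* [nH] and [nG] say nothing at [t = z] and [q = u], so these two terms are compensated by hand;
   both compensations record the status of the pair uz and cancel by symmetry. The extra 1 comes
   from [s]. *)
have l1 : n1 G H z + 1 + (G u z && ~~ H u z) <= n1 G H u + (G z u && ~~ H z u).
  pose f x w := (w == x) : nat.
  rewrite -(sumT1 s) -[X in _ + X <= _]muln1 -[X in _ <= _ + X]muln1.
  rewrite -{1}(sumT1 z) -(sumT1 u) !big_distrr -!big_split; apply: leq_sum => w _ /=.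
  move: (nH w) (nG w).
  have [->|ws] := eqVneq w s.
    rewrite (sG z s) (negPf nGsz) (sG u s) Gsu (sH u s) (negPf nHsu) /=.
    have -> : (s == z) = false by apply: contraTF Hsz => /eqP ->; rewrite iH.
    by rewrite !muln0; case: eqP => //= <-; rewrite iG in Gsu.
  have [->|wz] := eqVneq w z; first by rewrite iG /= muln1 leq_addr.
  have [->|wu] := eqVneq w u; first by rewrite iG /= muln1 muln0 !addn0.
  rewrite /= !muln0.
  by case: (G z w); case: (G u w); case: (H z w); case: (H u w) => //=; lia.
have l2 : n1 H G u <= n1 H G z.
  rewrite -(leq_add2r 1) -{1}(sumT1 s) -(sumT1 z) -!big_split.
  apply: leq_sum => w _ /=; move: (nH w) (nG w).
  have [->|ws] := eqVneq w s.
    rewrite (sG z s) (negPf nGsz) (sG u s) Gsu (sH u s) (negPf nHsu) /=.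
    by rewrite (sH z s) Hsz.
  have [->|wz] := eqVneq w z; first by case: (H u z); case: (G u z); rewrite ?iH ?iG.
  have [->|wu] := eqVneq w u; first by rewrite iG iH.
  by case: (G z w); case: (G u w); case: (H z w); case: (H u w).
rewrite (sG u z) (sH u z) leq_add2r e2 in l1.
by move: l1 l2; rewrite e1; clear; lia.
Qed.

Lemma sw_kunduH G H s z u t : simple_graph G -> simple_graph H ->
    H s z -> ~~ G s z -> G s u -> ~~ H s u ->
    H u t -> ~~ H z t -> t != z -> ~~ G u t || G z t ->
  [/\ simple_graph (sw4 H z s u t), forall v, deg (sw4 H z s u t) v = deg H v &
      diffn (sw4 H z s u t) G < diffn H G].
Proof.
move=> gG gH Hsz nGsz Gsu nHsu Hut nHzt tz imp.
have [sG iG] := gG; have [sH iH] := gH.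
have ok : valid_sw H [:: (z, s); (u, t)] [:: (s, u); (t, z)].
  apply: sw4_valid; rewrite ?(sH _ z) // 1?sH //.
  - by apply: contraNneq nGsz => ->.
  - by apply: contraNneq nHsu => ->; rewrite sH.
  - exact: simple_neq gG Gsu.
have /and4P[_ oa _ _] := ok.
split; first exact: sw_simple.
- by move=> v; rewrite sw4_deg.
- have := diff_swH gG gH ok; rewrite !big_cons !big_nil /= -/(sw4 H z s u t).
  by rewrite (sG z s) (sG t z) Gsu nGsz; move: imp; case: (G u t); case: (G z t); clear; lia.
Qed.

Lemma sw_kunduG G H s z u q : simple_graph G -> simple_graph H ->
    H s z -> ~~ G s z -> G s u -> ~~ H s u ->
    G z q -> ~~ G u q -> q != u -> ~~ H z q || H u q ->
  [/\ valid_sw G [:: (s, u); (q, z)] [:: (u, q); (z, s)],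
      simple_graph (sw4 G s u q z), forall v, deg (sw4 G s u q z) v = deg G v &
      diffn H (sw4 G s u q z) < diffn H G].
Proof.
move=> gG gH Hsz nGsz Gsu nHsu Gzq nGuq qu imp.
have [sG iG] := gG; have [sH iH] := gH.
have ok : valid_sw G [:: (s, u); (q, z)] [:: (u, q); (z, s)].
  apply: sw4_valid; rewrite // 1?eq_sym // 1?sG //.
  - by apply: contraNneq nGsz => <-; rewrite sG.
  - by apply: contraNneq nHsu => <-.
  - exact: simple_neq gH Hsz.
have /and4P[_ oa _ _] := ok.
split => //; first exact: sw_simple.
- by move=> v; rewrite sw4_deg.
- have := diff_swG gG gH ok; rewrite !big_cons !big_nil /= -/(sw4 G s u q z).
  by rewrite (sH z s) (sH q z) Hsz (negPf nHsu); move: imp; case: (H z q); case: (H u q); clear; lia.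
Qed.

(** Descent on [diffn]: by [kundu_count], any edge sz of H outside G gives a 4-switch in H or in G
    that removes more disagreement than it creates. *)
Lemma kundu G0 H0 k :
    simple_graph G0 -> simple_graph H0 -> (forall v, deg G0 v = deg H0 v + k) ->
  exists G H, [/\ simple_graph G, simple_graph H, forall v, deg G v = deg G0 v,
                 forall v, deg H v = deg H0 v & subrel H G].
Proof.
have [N] := ubnP (diffn H0 G0); elim: N G0 H0 => // N IH G H ltN gG gH dGH.
have [/existsP[s /existsP[z /andP[Hsz nGsz]]]|no] :=
    boolP [exists s, [exists z, H s z && ~~ G s z]]; last first.
  exists G, H; split=> // s z Hsz; apply: contraNT no => nGsz.
  by apply/existsP; exists s; apply/existsP; exists z; rewrite Hsz.
have [u /andP[Gsu nHsu]] : exists u, G s u && ~~ H s u.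
  have: 0 < \sum_w (G s w && ~~ H s w).
    have := dGH s; have := deg_diff G H s.
    by have := sum_nat_le (fun w => H s w && ~~ G s w : nat) z; rewrite /= Hsz nGsz; lia.
  by case/sum_nat_gt0 => w _; rewrite lt0b; exists w.
have [[t [h1 h2 h3 h4]]|[q [h1 h2 h3 h4]]] := kundu_count gG gH dGH Hsz nGsz Gsu nHsu.
- have [gH' dH' lt] := sw_kunduH gG gH Hsz nGsz Gsu nHsu h1 h2 h3 h4.
  have [||G' [H' [? ? dG'' dH'' ?]]] := IH G (sw4 H z s u t) _ gG gH'; first by lia.
    by move=> v; rewrite dH'.
  by exists G', H'; split=> // v; rewrite dH''.
- have [_ gG' dG' lt] := sw_kunduG gG gH Hsz nGsz Gsu nHsu h1 h2 h3 h4.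
  have [||G' [H' [? ? dG'' dH'' ?]]] := IH (sw4 G s u q z) H _ gG' gH; first by lia.
    by move=> v; rewrite dG'.
  by exists G', H'; split=> // v; rewrite dG''.
Qed.

End Cycles.

(** * Assigning neighbours to the poor vertices *)

Section FullFlow.

Variables (V : finType) (nu c k : nat) (dg : V -> nat) (Y0 : {set V}).
Implicit Types (G H J : rel V) (U : {set V}).

(* Big, poor and intermediate vertices, for B = nu + c.  A vertex in Y0 lies on
   both sides of the assignment; Y0 is empty, or consists of the only
   intermediate vertex. *)
Definition Bg := [set v | nu + c <= dg v].
Definition Po := [set v | dg v + k <= nu + c + 1].
Definition Hi := ~: (Bg :|: Po).
Definition Lf := ~: Po.
Definition Rt := Po :|: Y0.

(* By max-flow min-cut, deficiency G is the least total shortage when each vertex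
   of Rt asks for k neighbours in Lf and each vertex of Lf is used at most k times. *)
Definition lf_capacity G U := cut (fun p => (p \in Lf) * k) (fun p v => G p v : nat) U.
Definition deficiency G := \max_(U : {set V} | U \subset Rt) (k * #|U| - lf_capacity G U).
Definition flow_total J := \sum_p deg J p.
Definition indeg J v := \sum_p J p v.
Definition upd J a b t : rel V := fun p v => if (p == a) && (v == b) then t else J p v.

Definition is_flow J :=
  [/\ forall p v, J p v -> p \in Lf /\ v \in Rt,
      forall p, deg J p <= k & forall v, indeg J v <= k].

Lemma flow_total_col J : flow_total J = \sum_v indeg J v.
Proof. by rewrite exchange_big; apply: eq_bigr => p _; rewrite deg_sum. Qed.

Lemma updE J a b t p v :
  upd J a b t p v + (p == a) * ((v == b) * J a b) = J p v + (p == a) * ((v == b) * t).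
Proof.
rewrite /upd; case: (p =P a) => [->|_]; case: (v =P b) => [->|_] /=; rewrite ?mul1n ?mul0n ?addn0 //.
exact: addnC.
Qed.

Lemma deg_upd J a b t p : deg (upd J a b t) p + (p == a) * J a b = deg J p + (p == a) * t.
Proof.
have sE (f : bool) : \sum_v (p == a) * ((v == b) * f) = (p == a) * f.
  by rewrite -big_distrr -big_distrl /= sumT1 mul1n.
by rewrite !deg_sum -!sE -!big_split; apply: eq_bigr => v _; rewrite /= updE.
Qed.

Lemma indeg_upd J a b t v : indeg (upd J a b t) v + (v == b) * J a b = indeg J v + (v == b) * t.
Proof.
have sE (f : bool) : \sum_p (p == a) * ((v == b) * f) = (v == b) * f.
  by rewrite -big_distrl /= sumT1 mul1n.
by rewrite -(sE (J a b)) -(sE t) -!big_split; apply: eq_bigr => p _; rewrite /= updE.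
Qed.

Lemma flow_total_upd J a b t : flow_total (upd J a b t) + J a b = flow_total J + t.
Proof.
have sE (f : bool) : \sum_p (p == a) * f = f by rewrite -big_distrl /= sumT1 mul1n.
by rewrite -(sE (J a b)) -(sE t) -!big_split; apply: eq_bigr => p _; rewrite /= deg_upd.
Qed.

Lemma lf_capacityE G U : lf_capacity G U = \sum_(p in Lf) minn k (cnt G p U).
Proof.
rewrite [RHS]big_mkcond; apply: eq_bigr => p _ /=; rewrite -/(cnt G p U).
by case: (p \in Lf); rewrite ?mul1n // mul0n min0n.
Qed.

Lemma le_deficiency G U : U \subset Rt -> k * #|U| <= lf_capacity G U + deficiency G.
Proof.
move=> sU; rewrite -leq_subLR.
exact: (@leq_bigmax_cond _ (fun U : {set V} => U \subset Rt) (fun U => k * #|U| - lf_capacity G U) U sU).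
Qed.

(** Weak duality: a flow along edges of G that falls short of the demand by at most [t] bounds the
    shortage of every cut. *)
Lemma cut_duality G J t : is_flow J -> (forall p v, J p v -> G p v) ->
  k * #|Rt| <= flow_total J + t -> deficiency G <= t.
Proof.
move=> [JLR Jr Jc] JG le; apply/bigmax_leqP => U sU.
have leT : flow_total J <= lf_capacity G U + k * #|Rt :\: U|.
  rewrite flow_total_col (bigID (mem U)) /=; apply: leq_add.
    rewrite /indeg exchange_big lf_capacityE /= [X in _ <= X]big_mkcond; apply: leq_sum => p _.
    have leJ : \sum_(v in U) J p v <= deg J p.
      by rewrite deg_sum [X in _ <= X](bigID (mem U)) leq_addr.
    case: ifP => [pL|pL].
      rewrite leq_min (leq_trans leJ) //=; apply: leq_sum => v _.
      by case Jpv: (J p v); rewrite // JG.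
    by rewrite big1 // => v _; case Jpv: (J p v) => //; have [] := JLR _ _ Jpv; rewrite pL.
  rewrite (bigID (mem Rt)) /= [X in _ + X]big1 ?addn0.
    rewrite mulnC -sum_nat_const; apply: (leq_trans (leq_sum _ (fun v _ => Jc v))).
    by rewrite [X in _ <= X](eq_bigl (fun v => (v \notin U) && (v \in Rt))) // => v; rewrite !inE.
  move=> v /andP[_ vR]; apply: big1 => p _; case Jpv: (J p v) => //.
  by have [_] := JLR _ _ Jpv; rewrite (negPf vR).
have eR : #|Rt| = #|U| + #|Rt :\: U| by rewrite -(cardsID U Rt) (setIidPr sU).
by move: le leT; rewrite eR mulnDr; clear; lia.
Qed.

(** One arc of the flow may be missing from G: dropping it costs one unit, which the strict
    inequality pays for. *)
Lemma cut_duality1 G J t a b : is_flow J -> (forall p v, J p v -> ~~ ((p == a) && (v == b)) -> G p v) ->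
  k * #|Rt| < flow_total J + t -> deficiency G <= t.
Proof.
move=> [JLR Jr Jc] JG le; apply: (@cut_duality _ (upd J a b false)).
- split=> [p v|p|v]; first by rewrite /upd; case: ifP => // _; exact: JLR.
  + by have := deg_upd J a b false p; have := Jr p; clear; lia.
  + by have := indeg_upd J a b false v; have := Jc v; clear; lia.
- by move=> p v; rewrite /upd; case: ifP => // nab Jpv; apply: JG; rewrite ?nab.
- by have := flow_total_upd J a b false; move: le; case: (J a b); clear; lia.
Qed.

Hypotheses (cardV : #|V| = 2 * nu) (k2 : 1 < k) (kc : k <= c.+1) (cardBg : nu <= #|Bg|).
Hypothesis HY : Y0 = set0 \/ [/\ Y0 = Hi, #|Hi| <= 1 & k <= c].

Lemma Po_Bg v : v \in Po -> v \in Bg -> False.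
Proof. by rewrite !inE; move: k2; clear; lia. Qed.

Lemma Hi_Y0 y h : y \in Y0 -> h \in Hi -> h = y.
Proof.
case: HY => [->|[-> le1 _]]; first by rewrite inE.
by move=> yH; move/card_le1P: le1 => /(_ _ yH) ->; rewrite inE => /eqP.
Qed.

Lemma Y0_Hi y : y \in Y0 -> y \in Hi.
Proof. by case: HY => [->|[-> _ _]] //; rewrite inE. Qed.

Lemma Bg_Rt v : v \in Bg -> v \in Rt = false.
Proof.
move=> vB; apply/negP; rewrite in_setU => /orP[vP|/Y0_Hi]; first exact: Po_Bg vB.
by rewrite inE in_setU vB.
Qed.

Lemma Bg_Lf v : v \in Bg -> v \in Lf.
Proof. by move=> vB; rewrite inE; apply/negP => vP; exact: Po_Bg vB. Qed.

Lemma RtLf_Y0 v : v \in Rt -> v \in Lf -> v \in Y0.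
Proof. by rewrite in_setU in_setC => /orP[->|]. Qed.

Lemma card_Rt : #|Rt| <= nu.
Proof.
have : #|Rt| <= #|~: Bg|.
  by apply/subset_leq_card/subsetP => v vR; rewrite inE; apply/negP => /Bg_Rt; rewrite vR.
by have := cardsC Bg; rewrite cardV; move: cardBg; clear; lia.
Qed.

Definition hi_po_edges G := \sum_(z in Hi) cnt G z Po.
Definition hi_po_squares G := \sum_(z in Hi) cnt G z Po * cnt G z Po.
Definition hi_po_contr (es : seq (V * V)) :=
  \sum_(e <- es) ((e.1 \in Hi) * (e.2 \in Po) + (e.2 \in Hi) * (e.1 \in Po)).

Lemma hi_po_edges_sw G rs ads : simple_graph G -> valid_sw G rs ads ->
  hi_po_edges (switch G rs ads) + hi_po_contr rs = hi_po_edges G + hi_po_contr ads.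
Proof.
move=> gG ok; have sE es : hi_po_contr es = \sum_(z in Hi) contr es z Po.
  rewrite exchange_big; apply: eq_bigr => e _; rewrite big_split -!big_distrl /=.
  by rewrite !sum_in_eq.
by rewrite !sE -!big_split; apply: eq_bigr => z _; rewrite /= cnt_sw.
Qed.

Lemma Hi_Po v : v \in Hi -> v \in Po = false.
Proof. by rewrite inE in_setU negb_or => /andP[_ /negbTE]. Qed.

Lemma Po_Hi v : v \in Po -> v \in Hi = false.
Proof. by move=> vP; apply/negP => /Hi_Po; rewrite vP. Qed.

Lemma Bg_Hi v : v \in Bg -> v \in Hi = false.
Proof. by rewrite in_setC in_setU => ->. Qed.

Lemma Hi_Lf v : v \in Hi -> v \in Lf.
Proof. by move=> vH; rewrite inE Hi_Po. Qed.

Lemma Lf_cases v : v \in Lf -> v \in Bg \/ v \in Hi.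
Proof.
rewrite !in_setC in_setU => /negPf ->; rewrite orbF.
by case: (v \in Bg); [left|right].
Qed.

(** * Tight sets of a deficient realization, and nearly optimal flows *)

Section FixG.

Variable G : rel V.
Hypotheses (gG : simple_graph G) (dG : forall v, deg G v = dg v) (Dpos : 0 < deficiency G).

Definition tight U := (U \subset Rt) && (k * #|U| == lf_capacity G U + deficiency G).

Lemma tightUI U W : tight U -> tight W -> tight (U :|: W) && tight (U :&: W).
Proof.
case/andP=> sU /eqP tU /andP[sW /eqP tW].
have sUW : U :|: W \subset Rt by rewrite subUset sU.
have sI : U :&: W \subset Rt by rewrite (subset_trans (subsetIl _ _)).
have := le_deficiency G sUW; have := le_deficiency G sI; rewrite /tight sUW sI /=.
have := cut_submod (fun p => (p \in Lf) * k) (fun p v => G p v : nat) U W; rewrite -!/(lf_capacity G _).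
have := cardsUI U W; move: tU tW; clear => tU tW /(congr1 (muln k)); rewrite !mulnDr; lia.
Qed.

(** Tight sets are the extremal sets of a submodular inequality, hence form a lattice; its least and
    greatest members are found by cardinality. *)
Lemma tight_bounds : exists U0 U1 : {set V},
  [/\ tight U0, tight U1 & forall U, tight U -> U0 \subset U /\ U \subset U1].
Proof.
have [Um sUm tUm] : exists2 U : {set V}, U \subset Rt & deficiency G = k * #|U| - lf_capacity G U.
  have [|U sU tU] := @eq_bigmax_cond _ (fun U : {set V} => U \subset Rt)
    (fun U => k * #|U| - lf_capacity G U); last by exists U.
  by apply/card_gt0P; exists set0; rewrite unfold_in sub0set.
have tm : tight Um by rewrite /tight sUm tUm /=; move: Dpos; rewrite tUm; clear; lia.
have [U0 t0 min0] := arg_minnP (fun U : {set V} => #|U|) tm.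
have [U1 t1 max1] := arg_maxnP (fun U : {set V} => #|U|) tm.
exists U0, U1; split=> // U tU; split.
  have /andP[_ tI] := tightUI t0 tU; have := min0 _ tI; rewrite /= leqNgt.
  by apply: contraR => ns; apply: proper_card; rewrite properE subsetIl subsetI subxx.
have /andP[tX _] := tightUI t1 tU; have := max1 _ tX; rewrite /= leqNgt.
by apply: contraR => ns; apply: proper_card; rewrite properE subsetUl subUset subxx.
Qed.

Variables U0 U1 : {set V}.
Hypotheses (t0 : tight U0) (t1 : tight U1)
  (t01 : forall U, tight U -> U0 \subset U /\ U \subset U1).

Let U0Rt : U0 \subset Rt. Proof. by case/andP: t0. Qed.
Let U1Rt : U1 \subset Rt. Proof. by case/andP: t1. Qed.

(* Vertices whose contribution to the cut is, respectively, truncated at k and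
   below k: replacing an edge at the former by an edge at the latter raises the cut. *)
Definition Heavy := [set s in Lf | k < cnt G s U0].
Definition X := [set x in Bg | cnt G x U1 < k].

Lemma X_cnt0 x : x \in X -> cnt G x U0 < k.
Proof.
rewrite inE => /andP[_]; apply: leq_ltn_trans; apply: cnt_sub.
by case: (t01 t0).
Qed.

Lemma nontight U : U \subset Rt -> ~~ tight U -> k * #|U| < lf_capacity G U + deficiency G.
Proof. by move=> sU; rewrite /tight sU ltn_neqAle le_deficiency // andbT. Qed.

Lemma Bg_cnt_ge x U : x \in Bg -> U \subset Rt -> #|U| + c + 1 <= cnt G x U + nu.
Proof.
move=> xB sU; have := cntC G x U; rewrite dG.
have xU : x \in ~: U by rewrite inE; apply/negP => /(subsetP sU); rewrite Bg_Rt.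
have : cnt G x (~: U) < #|~: U|.
  rewrite (cardsD1 x) xU add1n ltnS; apply: leq_trans (cnt_card G x _).
  rewrite /cnt (big_setD1 x) //=; case: gG => _ ->; exact: leqnn.
have := cardsC U; move: xB; rewrite inE cardV; clear; lia.
Qed.

Lemma card_X : k < #|X| /\ nu < #|X| + #|Rt|.
Proof.
have := card_Rt; have := subset_leq_card U1Rt; have [_ /eqP tU1] := andP t1.
have le : k * #|Bg :\: X| + #|X| * (#|U1| + c + 1 - nu) <= lf_capacity G U1.
  rewrite lf_capacityE; apply: (@leq_trans (\sum_(p in Bg) minn k (cnt G p U1))); last first.
    by apply: sum_le_set; apply/subsetP => p; exact: Bg_Lf.
  rewrite [X in _ <= X](big_setID X) /= addnC; apply: leq_add.
    have -> : Bg :&: X = X by apply/setIidPr/subsetP => x; rewrite inE => /andP[].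
    rewrite -sum_nat_const; apply: leq_sum => x; rewrite inE => /andP[xB xk].
    by have := Bg_cnt_ge xB U1Rt; move: xk; clear; lia.
  rewrite mulnC -sum_nat_const; apply: leq_sum => x.
  by rewrite !inE => /andP[+ xB]; rewrite xB; clear; lia.
have eB : #|Bg| = #|X| + #|Bg :\: X|.
  rewrite -(cardsID X Bg); congr (#|pred_of_set _| + _).
  by apply/setIidPr/subsetP => x; rewrite inE => /andP[].
move: cardBg kc k2 Dpos le tU1; rewrite eB; move: (#|Bg :\: X|) (#|X|) (#|U1|) (lf_capacity _ _) (deficiency _).
clear => b n u m D b1 b2 b3 b4 b5 b6 b7 b8.
have b9 : k * u + n * c.+1 + n * u <= k * u + n * (u + c + 1 - nu) + n * nu by nia.
split; nia.
Qed.


(** The cut condition after adding xu, and deleting su if [b], with one unit of deficiency less. A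
    tight set lies between [U0] and [U1]: it gains at [x] and, [s] being heavy, loses nothing at
    [s]. Any other set has one unit of slack already, and needs two only if it loses at [s] without
    gaining at [x]. *)
Lemma cut_slack (b : bool) s u x (W : {set V}) : u \in U0 -> x \in X -> (b -> s \in Heavy) -> W \subset Rt ->
  k * #|W| + [&& b, u \in W & cnt G s W <= k] <
  lf_capacity G W + deficiency G + ((u \in W) && (cnt G x W < k)).
Proof.
move=> uU0 xX bs sW; have [tW|ntW] := boolP (tight W).
  have [sU0W sWU1] := t01 tW; have uW := subsetP sU0W _ uU0.
  have -> : cnt G x W < k.
    by apply: leq_ltn_trans (cnt_sub _ _ sWU1) _; move: xX; rewrite inE => /andP[].
  case/andP: tW => _ /eqP ->; rewrite uW.
  case: b bs => [/(_ isT)|_]; last by rewrite addn0 addn1.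
  rewrite inE => /andP[_ ltk]; rewrite /= [cnt G s W <= k]leqNgt.
  by rewrite (leq_trans ltk (cnt_sub _ _ sU0W)) addn0 addn1.
have := nontight sW ntW.
have [/and3P[bT uW sk]|_] := boolP [&& b, u \in W & _]; last by clear; lia.
rewrite uW; have [_|xk] /= := ltnP (cnt G x W) k; first by clear; lia.
(* Neither W ∩ U1 nor W ∪ U1 is tight; since [U1] is tight, submodularity passes both units of slack
   on to [W]. *)
have ntI : ~~ tight (W :&: U1).
  apply/negP => /t01[sU0 _].
  have : k < cnt G s U0 by have := bs bT; rewrite inE => /andP[].
  have : cnt G s U0 <= cnt G s W by apply: cnt_sub; rewrite (subset_trans sU0) ?subsetIl.
  by move: sk; clear; lia.
have ntU : ~~ tight (W :|: U1).
  apply/negP => /t01[_ sU].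
  have : cnt G x U1 < k by move: xX; rewrite inE => /andP[].
  have : cnt G x W <= cnt G x U1 by apply: cnt_sub; rewrite (subset_trans (subsetUl _ U1)).
  by move: xk; clear; lia.
have sI : W :&: U1 \subset Rt by rewrite (subset_trans (subsetIl _ _)).
have sU : W :|: U1 \subset Rt by rewrite subUset sW.
have := nontight sI ntI; have := nontight sU ntU.
have := cut_submod (fun p => (p \in Lf) * k) (fun p v => G p v : nat) W U1; rewrite -!/(lf_capacity G _).
have [_ /eqP] := andP t1.
have := cardsUI W U1 => /(congr1 (muln k)); rewrite !mulnDr; clear; lia.
Qed.

(* Adding the edge xu (and, for b = true, deleting su) raises the value of the
   minimum cut; an optimal flow must then use xu. *)
Lemma near_flow (b : bool) s u x :
    u \in U0 -> x \in X -> ~~ G x u -> (b -> s \in Heavy /\ G s u) ->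
  exists J, [/\ is_flow J, J x u, forall p v, J p v -> ~~ ((p == x) && (v == u)) -> G p v,
    b -> ~~ J s u & k * #|Rt| < flow_total J + deficiency G].
Proof.
move=> uU0 xX nGxu bs.
have uR := subsetP U0Rt _ uU0.
have xL : x \in Lf by apply: Bg_Lf; move: xX; rewrite inE => /andP[].
have bxs : b -> x != s by move=> /bs[_ Gsu]; apply: contraNneq nGxu => ->.
pose W p v : nat := [&& p \in Lf, v \in Rt &
  (G p v && ~~ [&& b, p == s & v == u]) || ((p == x) && (v == u))].
(* The extra source supplies the permitted shortage, one unit less than the deficiency, so that
   feasibility becomes the inequality of [cut_slack]. *)
pose a (o : V + unit) := if o is inl p then (p \in Lf) * k else (deficiency G).-1.
pose w (o : V + unit) v := if o is inl p then W p v else k.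
have ttE (f : unit -> nat) : \sum_o f o = f tt by rewrite (big_pred1 tt) //; case.
have [U|J0 [J1 J2 J3]] := @feasible_flow _ _ a (fun v => (v \in Rt) * k) w.
  rewrite /cut big_sumType /= ttE /wsum /= sum_nat_const.
  have -> : \sum_(v in U) (v \in Rt) * k = k * #|U :&: Rt|.
    rewrite -big_distrl mulnC /=; congr (_ * _); rewrite -sum1_card big_mkcond [RHS]big_mkcond.
    apply: eq_bigr => v _.
    by rewrite in_setI; case: (v \in U); case: (v \in Rt).
  set U' := U :&: Rt; have sU' : U' \subset Rt by exact: subsetIr.
  have lep p : p \in Lf -> minn k (cnt G p U') + (p == x) * ((u \in U') && (cnt G x U' < k))
     <= minn k (\sum_(v in U) W p v) + (p == s) * [&& b, u \in U' & cnt G s U' <= k].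
    move=> pL.
    have : cnt G p U' + (p == x) * (u \in U') <= \sum_(v in U) W p v + (p == s) * (b && (u \in U')).
      apply: (@leq_trans (\sum_(v in U') W p v + (p == s) * (b && (u \in U')))); last first.
        by rewrite leq_add2r; apply: sum_le_set; exact: subsetIl.
      rewrite -mulnb -(sum_in_eq U' u) [X in _ <= _ + X]mulnA !big_distrr -!big_split.
      apply: leq_sum => v; rewrite inE => /andP[_ vR] /=; rewrite /W pL vR /=.
      have [->|] := eqVneq v u; last by rewrite !muln0 !andbF; case: (G p v).
      have [->|_] := eqVneq p x; first by rewrite (negPf nGxu).
      by case: (G p u); case: (b); case: (p == s).
    have [->|_] := eqVneq p x.
      case: (eqVneq x s) => [xs|_]; last by case: (u \in U'); clear; lia.
      case: (b) bxs => [/(_ isT)|_]; first by rewrite xs eqxx.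
      by case: (u \in U'); clear; lia.
    have [->|_] := eqVneq p s; last by clear; lia.
    by case: (b); case: (u \in U'); clear; lia.
  have : lf_capacity G U' + ((u \in U') && (cnt G x U' < k)) <=
      \sum_p minn ((p \in Lf) * k) (\sum_(v in U) W p v) + [&& b, u \in U' & cnt G s U' <= k].
    have := @leq_sum _ (index_enum V) (fun p => p \in Lf) _ _ lep; rewrite !big_split /= lf_capacityE -!big_distrl /=.
    have -> : \sum_(p in Lf) (p == x) = 1 by rewrite sum_in_eq xL.
    rewrite mul1n; move=> H; apply: leq_trans H _; apply: leq_add.
      rewrite [X in X <= _]big_mkcond; apply: leq_sum => p _.
      by case: (p \in Lf); rewrite ?mul1n.
    by rewrite sum_in_eq; case: (s \in Lf); rewrite ?mul1n ?mul0n.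
  have := @cut_slack b s u x U' uU0 xX (fun bT => (bs bT).1) sU'.
  have : #|U'| <= #|U| by apply: subset_leq_card; exact: subsetIl.
  rewrite [#|U| * k]mulnC => lU; have : k * #|U'| <= k * #|U| by rewrite leq_mul2l lU orbT.
  by move: Dpos; clear; lia.
have JW p v : J0 (inl p) v = (0 < J0 (inl p) v) :> nat.
  by have := J1 (inl p) v; rewrite /= /W; case: [&& _, _ & _]; clear; lia.
pose J p v := 0 < J0 (inl p) v.
have JP p v : J p v -> 0 < W p v by move/leq_trans; apply; exact: (J1 (inl p) v).
have capJ : is_flow J.
  split=> [p v /JP|p|v].
  - by rewrite /W lt0b => /and3P[].
  - rewrite deg_sum; under eq_bigr do rewrite -JW.
    by apply: leq_trans (J2 (inl p)) _; rewrite /=; case: (p \in Lf); rewrite ?mul1n.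
  - rewrite /indeg; under eq_bigr do rewrite -JW.
    have := J3 v; rewrite big_sumType /=; case: (v \in Rt); clear; lia.
have Jex p v : J p v -> ~~ ((p == x) && (v == u)) -> G p v.
  by move=> /JP; rewrite /W lt0b => /and3P[_ _ /orP[/andP[]|->]].
have tJ : k * #|Rt| < flow_total J + deficiency G.
  have : \sum_v (v \in Rt) * k = flow_total J + \sum_v J0 (inr tt) v.
    rewrite flow_total_col -big_split; apply: eq_bigr => v _; rewrite -J3 big_sumType ttE.
    by congr (_ + _); apply: eq_bigr => p _; rewrite JW.
  rewrite -big_distrl -big_mkcond /= sum1_card mulnC => ->.
  by have := J2 (inr tt); rewrite /=; move: Dpos; clear; lia.
exists J; split=> //; last first.
  move=> bT; apply/negP => /JP; have [_ Gsu] := bs bT.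
  by rewrite /W bT !eqxx /= andbF (eq_sym s) (negPf (bxs bT)) !andbF.
(* Without the arc xu, [J] would run entirely along edges of G, and weak duality would put the
   deficiency below itself. *)
apply: contraT => nJ; have : deficiency G <= (deficiency G).-1; last by move: Dpos; clear; lia.
apply: (@cut_duality _ J) => //; last by move: tJ Dpos; clear; lia.
by move=> p v Jpv; apply: Jex => //; apply: contra nJ => /andP[/eqP<- /eqP<-].
Qed.


Lemma cnt_D1 v U u : u \in U -> cnt G v U = G v u + cnt G v (U :\ u).
Proof. by move=> uU; rewrite /cnt (big_setD1 u). Qed.

(** If [u] were adjacent to all of [X], removing it from [U0] would lower the capacity by |X| > k
    and the demand by only k, giving a set more deficient than the maximum. *)
Lemma X_nonadj u : u \in U0 -> exists2 x, x \in X & ~~ G x u.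
Proof.
move=> uU0; have [cX _] := card_X.
have [/exists_inP//|] := boolP [exists x in X, ~~ G x u].
rewrite negb_exists_in => /forall_inP allX.
have sU : U0 :\ u \subset Rt by apply: subset_trans U0Rt; exact: subD1set.
have ntU : ~~ tight (U0 :\ u).
  by apply/negP => /t01[/subsetP/(_ u uU0)]; rewrite !inE eqxx.
have := nontight sU ntU; have [_ /eqP] := andP t0.
have : lf_capacity G (U0 :\ u) + #|X| <= lf_capacity G U0.
  have -> : #|X| = \sum_(p in Lf) (p \in X).
    rewrite -sum1_card big_mkcond [RHS]big_mkcond; apply: eq_bigr => p _.
    case pX: (p \in X); last by case: ifP.
    by rewrite Bg_Lf //; move: pX; rewrite inE => /andP[].
  rewrite !lf_capacityE -big_split; apply: leq_sum => p _ /=; rewrite (cnt_D1 _ uU0).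
  case pX: (p \in X); last by case: (G p u); clear; lia.
  have := X_cnt0 pX; rewrite (cnt_D1 _ uU0); have := allX _ pX; rewrite negbK => ->.
  by clear; lia.
have := cardsD1 u U0; rewrite uU0 => ->; rewrite mulnDr; move: cX; clear; lia.
Qed.

Lemma Heavy_adj s x : s \in Heavy -> x \in X -> exists u, [/\ u \in U0, G s u & ~~ G x u].
Proof.
move=> sS xX; have := X_cnt0 xX; move: sS; rewrite inE => /andP[_ sk] xk.
have [/existsP[u /and3P[]]|] := boolP [exists u, [&& u \in U0, G s u & ~~ G x u]].
  by exists u.
rewrite negb_exists => /forallP no; have : cnt G s U0 <= cnt G x U0.
  apply: leq_sum => u uU0; have := no u; rewrite uU0.
  by case: (G s u); case: (G x u).
by move: sk xk; clear; lia.
Qed.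

Definition near J x u := [/\ is_flow J, J x u,
  forall p v, J p v -> ~~ ((p == x) && (v == u)) -> G p v & k * #|Rt| < flow_total J + deficiency G].

(** At most k - 1 of the flow arcs at [x] are edges of G, because one of them is the non-edge xu. *)
Lemma near_card J x u : x \in X -> ~~ G x u -> near J x u ->
  nu + c < \sum_p (G x p && ~~ J x p) + k.
Proof.
move=> xX nGxu [[_ Jr _] Jxu JG _].
have xB : nu + c <= dg x by move: xX; rewrite inE => /andP[+ _]; rewrite inE.
have : \sum_p (G x p && J x p) + 1 <= deg J x.
  rewrite -(sumT1 u) deg_sum -big_split; apply: leq_sum => p _ /=.
  have [->|pu] := eqVneq p u; first by rewrite Jxu (negPf nGxu).
  by case: (G x p); case: (J x p).
have : deg G x = \sum_p (G x p && ~~ J x p) + \sum_p (G x p && J x p).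
  by rewrite deg_sum -big_split; apply: eq_bigr => p _; case: (G x p); case: (J x p).
by rewrite dG; have := Jr x; move: xB; clear; lia.
Qed.

(* If all of these p were adjacent to w, then w would have too many neighbours
   to be poor. *)
Lemma near_pick J x u w e : x \in X -> ~~ G x u -> near J x u ->
    w \in Po -> G w e -> x != e -> ~~ (G x e && ~~ J x e) ->
  exists p, [/\ G x p, ~~ J x p, p != w & ~~ G p w].
Proof.
move=> xX nGxu nJ wPo Gwe xe nFe; have [sG iG] := gG.
have [/existsP[p /and4P[]]|] := boolP [exists p, [&& G x p, ~~ J x p, p != w & ~~ G p w]].
  by exists p.
rewrite negb_exists => /forallP no.
have we := simple_neq gG Gwe.
have : \sum_p (G x p && ~~ J x p) + 1 + (G x w && ~~ J x w) <= deg G w + (G x w && ~~ J x w).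
  rewrite -{1}(sumT1 e) -[X in _ + X <= _]muln1 -[X in _ <= _ + X]muln1.
  rewrite -{1}(sumT1 x) -(sumT1 w) deg_sum !big_distrr -!big_split; apply: leq_sum => p _ /=.
  have := no p; have [->|pe] := eqVneq p e.
    by rewrite (negPf nFe) (eq_sym e x) (negPf xe) Gwe muln0.
  have [->|px] := eqVneq p x.
    rewrite iG /= muln1 (sG w x); case: (G x w) => //=; case: (J x w) => //.
  have [->|pw] := eqVneq p w; first by rewrite iG muln1 muln0 !addn0.
  by rewrite (sG w p); case: (G x p); case: (J x p); case: (G p w); rewrite /= ?muln0 //.
move: wPo; rewrite inE dG; have := near_card xX nGxu nJ; clear; lia.
Qed.

Definition noJ J es := all (fun e => ~~ J e.1 e.2 && ~~ J e.2 e.1) es.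

Lemma noJP J es p v : noJ J es -> J p v -> ~~ inE2 es p v.
Proof.
move=> /allP nJ Jpv; apply/negP => /hasP[e /nJ /andP[n1 n2] /samepP[][pe ve]].
  by rewrite -pe -ve Jpv in n1.
by rewrite -pe -ve Jpv in n2.
Qed.

Lemma near_Po J x u a b : near J x u -> a \in Po -> ~~ J a b.
Proof.
by move=> [[JLR _ _] _ _ _] aP; apply/negP => /JLR[]; rewrite inE aP.
Qed.

Lemma near_Bg J x u a b : near J x u -> b \in Bg -> ~~ J a b.
Proof.
by move=> [[JLR _ _] _ _ _] bB; apply/negP => /JLR[_]; rewrite Bg_Rt.
Qed.

Lemma near_sym J x u a b : near J x u -> a \in Lf -> b \in Rt -> a != b -> ~~ J b a.
Proof.
move=> [[JLR _ _] _ _ _] aL bR ab; apply/negP => /JLR[bL aR].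
by rewrite (Hi_Y0 (RtLf_Y0 bR bL) (Y0_Hi (RtLf_Y0 aR aL))) eqxx in ab.
Qed.

(** [J] survives the switch, and its only illegal arc xu becomes an edge; so [J] itself certifies
    the smaller deficiency. In [near_sw_le] the switch may destroy one arc of [J], which uses up the
    gain. *)
Lemma near_sw_lt rs ads J x u : near J x u -> inE2 ads x u -> noJ J rs ->
  deficiency (switch G rs ads) < deficiency G.
Proof.
move=> [cJ Jxu JG tJ] axu nJ; rewrite -(prednK Dpos) ltnS.
apply: (@cut_duality _ J) => //; last by move: tJ Dpos; clear; lia.
move=> p v Jpv; have [/andP[/eqP-> /eqP->]|npv] := boolP ((p == x) && (v == u)).
  exact: sw_new.
by apply: sw_keep; [exact: JG|exact: noJP nJ Jpv].
Qed.

Lemma near_sw_le rs ads J x u a b : near J x u -> inE2 ads x u ->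
    noJ (upd J a b false) rs -> deficiency (switch G rs ads) <= deficiency G.
Proof.
move=> [cJ Jxu JG tJ] axu nJ; apply: (@cut_duality1 _ J _ a b) => //.
move=> p v Jpv nab; have [/andP[/eqP-> /eqP->]|npv] := boolP ((p == x) && (v == u)).
  exact: sw_new.
by apply: sw_keep; [exact: JG|apply: noJP nJ _; rewrite /upd (negPf nab)].
Qed.


(** * Contradiction at an extremal pair of positive deficiency *)

Variable H : rel V.
Hypotheses (gH : simple_graph H) (dH : forall v, deg H v + k = dg v).
(* G, H is extremal for the lexicographic order on the deficiency, the number of
   Hi-Po edges, the sum of squares (reversed) and the number of edges of H \ G. *)
Hypotheses (noD : forall G', simple_graph G' -> (forall v, deg G' v = dg v) -> deficiency G <= deficiency G')
  (noE : forall G', simple_graph G' -> (forall v, deg G' v = dg v) ->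
     deficiency G' <= deficiency G -> hi_po_edges G <= hi_po_edges G')
  (noQ : forall G', simple_graph G' -> (forall v, deg G' v = dg v) ->
     deficiency G' <= deficiency G -> hi_po_edges G' <= hi_po_edges G -> hi_po_squares G' <= hi_po_squares G)
  (noH : forall G' H', simple_graph G' -> (forall v, deg G' v = dg v) ->
     simple_graph H' -> (forall v, deg H' v + k = dg v) ->
     deficiency G' <= deficiency G -> hi_po_edges G' <= hi_po_edges G -> hi_po_squares G <= hi_po_squares G' -> diffn H G <= diffn H' G').

Let X_Bg x : x \in X -> x \in Bg. Proof. by rewrite inE => /andP[]. Qed.
Let Heavy_Lf s : s \in Heavy -> s \in Lf. Proof. by rewrite inE => /andP[]. Qed.
Let Lf_Po s : s \in Lf -> s \in Po = false. Proof. by rewrite inE => /negPf. Qed.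

Let X_Rt x u : x \in X -> u \in Rt -> x != u.
Proof. by move=> /X_Bg xB; apply: contraTneq => <-; rewrite Bg_Rt. Qed.
Let X_Po x w : x \in X -> w \in Po -> x != w.
Proof. by move=> /X_Bg xB wP; apply: contraTneq wP => <-; apply/negP => /Po_Bg; exact. Qed.
Let X_notPo x : x \in X -> x \in Po = false.
Proof. by move=> xX; apply/negP => /(X_Po xX); rewrite eqxx. Qed.
Let Po_Rt w : w \in Po -> w \in Rt. Proof. by move=> wP; rewrite in_setU wP. Qed.

(** Replacing wu and xp by ux and pw realizes the missing edge xu. This lowers the deficiency unless
    [J] uses the arc uw; in that case [u] is in [Y0], and the switch removes a Hi-Po edge. *)
Lemma U0_Po u w : u \in U0 -> w \in Po -> ~~ G u w.
Proof.
move=> uU0 wPo; apply/negP => Guw; have [sG iG] := gG.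
have [x xX nGxu] := X_nonadj uU0; have xB := X_Bg xX.
have [|J [cJ Jxu JG _ tJ]] := @near_flow false u u x uU0 xX nGxu; first by [].
have nJ : near J x u by [].
have uR := subsetP U0Rt _ uU0.
have xu := X_Rt xX uR; have xw := X_Po xX wPo.
have [||p [Gxp nJxp pw nGpw]] := near_pick (e := u) xX nGxu nJ wPo _ xu.
- by rewrite sG.
- by rewrite (negPf nGxu).
have ok : valid_sw G [:: (w, u); (x, p)] [:: (u, x); (p, w)].
  apply: sw4_valid; rewrite // 1?eq_sym // 1?sG //.
  by apply: contraNneq nGxu => <-.
have gG' := sw_valid_simple gG ok.
have dG' v : deg (switch G [:: (w, u); (x, p)] [:: (u, x); (p, w)]) v = dg v by rewrite -dG; exact: sw4_deg gG ok.
have axu : inE2 [:: (u, x); (p, w)] x u by rewrite /= /samep !eqxx orbT.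
have n1 := near_Po u nJ wPo; have n2 := near_Bg p nJ xB.
have [Juw|nJuw] := boolP (J u w); last first.
  have := noD gG' dG'; rewrite leqNgt (near_sw_lt nJ axu) //.
  by rewrite /noJ /= n1 nJuw nJxp n2.
have uL : u \in Lf by case: cJ => /(_ _ _ Juw)[].
have uY := RtLf_Y0 uR uL; have uH := Y0_Hi uY.
have := noE gG' dG'; rewrite (near_sw_le (a := u) (b := w) nJ axu) => [/(_ isT)|]; last first.
  by rewrite /noJ /upd /= !eqxx /= (negPf n1) (negPf n2) (negPf nJxp) !if_same.
have pH : p \in Hi = false.
  by apply/negP => /(Hi_Y0 uY) pu; rewrite -pu Gxp in nGxu.
have := hi_po_edges_sw gG ok; rewrite /hi_po_contr !big_cons !big_nil /= uH wPo pH (Bg_Hi xB) (X_notPo xX).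
by rewrite (Po_Hi wPo); clear; lia.
Qed.

Lemma deg_exchange (P : rel V) (U : {set V}) : symmetric P -> \sum_(u in U) deg P u = \sum_w cnt P w U.
Proof.
move=> sP; under eq_bigr do rewrite deg_sum; rewrite exchange_big.
by apply: eq_bigr => w _; apply: eq_bigr => u _; rewrite sP.
Qed.

(* Double counting the edges at U0 in G and in H: since the degrees differ by k on
   U0 and the cut is deficient, the heavy vertices send too many edges to U0 in G. *)
Lemma heavy_exchange : exists s z, [/\ s \in Heavy, H s z & ~~ G s z] /\
  k < \sum_(u in U0) (G s u && ~~ H s u).
Proof.
have [s sS ls] : exists2 s, s \in Heavy & cnt H s U0 + k < cnt G s U0.
  have [/exists_inP//|] := boolP [exists s in Heavy, cnt H s U0 + k < cnt G s U0].
  rewrite negb_exists_in => /forall_inP no; exfalso.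
  have e1 := deg_exchange U0 gG.1; have e2 := deg_exchange U0 gH.1.
  have e3 : \sum_(u in U0) deg G u = \sum_(u in U0) deg H u + k * #|U0|.
    rewrite mulnC -sum_nat_const -big_split; apply: eq_bigr => u _ /=.
    by rewrite dG -dH.
  (* A non-heavy vertex of [Lf] has its whole count below the truncation, a heavy one exceeds H by
     at most k by assumption, and a poor one has no neighbour in [U0]. The excess k|U0| of G over H
     would thus fit into the capacity. *)
  have e4 : \sum_w cnt G w U0 <= \sum_w cnt H w U0 + lf_capacity G U0.
    rewrite lf_capacityE [X in _ + X]big_mkcond -big_split; apply: leq_sum => w _ /=.
    have [wL|wP] := boolP (w \in Lf).
      have := no w; rewrite inE wL /=; move: (cnt G w U0) (cnt H w U0); clear => g h.
      by case: (ltnP k g) => [kg /(_ isT)|gk _]; lia.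
    rewrite /cnt big1 // => u uU0; have [sG _] := gG; rewrite sG.
    by rewrite (negPf (U0_Po uU0 _)) //; move: wP; rewrite inE negbK.
  have [_ /eqP] := andP t0; move: e1 e2 e3 e4 Dpos; clear; lia.
have e1 : cnt G s U0 <= cnt H s U0 + \sum_(u in U0) (G s u && ~~ H s u).
  by rewrite -big_split; apply: leq_sum => u _ /=; case: (G s u); case: (H s u).
have [z zU /andP[Hsz nGsz]] : exists2 z, z \in ~: U0 & H s z && ~~ G s z.
  have: 0 < \sum_(z in ~: U0) (H s z && ~~ G s z).
    have : cnt H s (~: U0) <= cnt G s (~: U0) + \sum_(z in ~: U0) (H s z && ~~ G s z).
      by rewrite -big_split; apply: leq_sum => u _ /=; case: (G s u); case: (H s u).
    have := cntC G s U0; have := cntC H s U0; rewrite dG -dH; move: ls; clear; lia.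
  by case/sum_nat_gt0 => z zU; rewrite lt0b; exists z.
by exists s, z; split; last by move: e1 ls; clear; lia.
Qed.

Section FixSZ.

Variables s z : V.
Hypotheses (sS : s \in Heavy) (Hsz : H s z) (nGsz : ~~ G s z).

Let sz : s != z. Proof. exact: simple_neq gH Hsz. Qed.
Let sL := Heavy_Lf sS.
Let sPo := Lf_Po sL.

Lemma near_s u x : u \in U0 -> x \in X -> ~~ G x u -> G s u ->
  exists J, [/\ near J x u, ~~ J s u & ~~ J u s].
Proof.
move=> uU0 xX nGxu Gsu.
have [|J [cJ Jxu JG nJs tJ]] := @near_flow true s u x uU0 xX nGxu; first by [].
exists J; split; [by []|exact: nJs|apply: (@near_sym J x u) => //].
  exact: subsetP U0Rt _ uU0.
exact: simple_neq gG Gsu.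
Qed.

(** Otherwise the switch from su, xp to ux, ps realizes xu without touching the flow and lowers the
    deficiency. *)
Lemma near_F u x J p : u \in U0 -> x \in X -> ~~ G x u -> G s u -> near J x u -> ~~ J s u ->
  ~~ J u s -> G x p -> ~~ J x p -> p != s -> G s p.
Proof.
move=> uU0 xX nGxu Gsu nJ n1 n2 Gxp n3 ps; apply: contraT => nGsp; have [sG iG] := gG.
have xu := X_Rt xX (subsetP U0Rt _ uU0).
have ok : valid_sw G [:: (s, u); (x, p)] [:: (u, x); (p, s)].
  apply: sw4_valid; rewrite // 1?eq_sym // 1?sG //.
  - by apply: contraNneq nGxu => ->.
  - by apply: contraNneq nGxu => <-.
have gG' := sw_valid_simple gG ok.
have dG' v : deg (switch G [:: (s, u); (x, p)] [:: (u, x); (p, s)]) v = dg v by rewrite -dG; exact: sw4_deg gG ok.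
have := noD gG' dG'; rewrite leqNgt (near_sw_lt nJ) //.
  by rewrite /= /samep !eqxx orbT.
by rewrite /noJ /= n1 n2 n3 (near_Bg p nJ (X_Bg xX)).
Qed.

Lemma near_notF u x J : u \in U0 -> x \in X -> ~~ G x u -> G s u -> near J x u -> ~~ J s u ->
  ~~ J u s -> ~~ (G x z && ~~ J x z).
Proof.
move=> uU0 xX nGxu Gsu nJ n1 n2; apply/negP => /andP[Gxz nJxz].
by have := near_F uU0 xX nGxu Gsu nJ n1 n2 Gxz nJxz; rewrite eq_sym sz (negPf nGsz) => /(_ isT).
Qed.

(** The 6-cycle trades su, xp, qz for ux, pq, zs. Of the removed edges only zq can carry flow, as an
    arc from [z], and it must, or the deficiency would fall. *)
Lemma six_switch u x J q : u \in U0 -> x \in X -> ~~ G x u -> G s u -> near J x u -> ~~ J s u ->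
    ~~ J u s -> x != z -> q \in Po -> G z q ->
  exists p, [/\ G x p, p != z, ~~ G p q & J z q] /\
    [/\ valid_sw G [:: (s, u); (x, p); (q, z)] [:: (u, x); (p, q); (z, s)],
      simple_graph (switch G [:: (s, u); (x, p); (q, z)] [:: (u, x); (p, q); (z, s)]),
      forall v, deg (switch G [:: (s, u); (x, p); (q, z)] [:: (u, x); (p, q); (z, s)]) v = dg v &
      deficiency (switch G [:: (s, u); (x, p); (q, z)] [:: (u, x); (p, q); (z, s)]) <= deficiency G].
Proof.
move=> uU0 xX nGxu Gsu nJ n1 n2 xz qPo Gzq; have [sG iG] := gG.
have nF := near_notF uU0 xX nGxu Gsu nJ n1 n2.
have Gqz : G q z by rewrite sG.
have [p [Gxp nJxp pq nGpq]] := near_pick xX nGxu nJ qPo Gqz xz nF.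
have pz : p != z by apply: contraNneq nF => <-; rewrite Gxp.
exists p; have xu := X_Rt xX (subsetP U0Rt _ uU0).
have ok : valid_sw G [:: (s, u); (x, p); (q, z)] [:: (u, x); (p, q); (z, s)].
  apply: sw6_valid => //.
  - by apply: contraNneq nGxu => <-.
  - by apply: contraFneq sPo => ->.
  - exact: X_Po.
  - by rewrite eq_sym.
  - by rewrite sG.
  - by rewrite sG.
have gG' := sw_valid_simple gG ok.
have dG' v : deg (switch G [:: (s, u); (x, p); (q, z)] [:: (u, x); (p, q); (z, s)]) v = dg v.
  by rewrite -dG; exact: sw6_deg gG ok.
have axu : inE2 [:: (u, x); (p, q); (z, s)] x u by rewrite /= /samep !eqxx orbT.
have n3 := near_Po z nJ qPo; have n4 := near_Bg p nJ (X_Bg xX).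
do 2!split => //.
  apply: contraT => n5; have := noD gG' dG'; rewrite leqNgt (near_sw_lt nJ axu) //.
  by rewrite /noJ /= n1 n2 nJxp n4 n3 n5.
apply: (near_sw_le (a := z) (b := q) nJ axu).
by rewrite /noJ /upd /= !eqxx /= (negPf n1) (negPf n2) (negPf nJxp) (negPf n4) (negPf n3) !if_same.
Qed.

Lemma X_neq_z : exists2 x, x \in X & x != z.
Proof.
have [+ _] := card_X => cX; have : 0 < #|X :\ z| by rewrite (cardsD1 z X) in cX; move: cX k2; clear; lia.
by case/card_gt0P => x; rewrite in_setD1 => /andP[xz xX]; exists x.
Qed.

(** Outside [Rt], the vertex [z] receives no flow, hence has no neighbour in [X], and its poor
    neighbours all take flow from it, so there are at most k. By [card_X] a big vertex cannot have
    so small a degree; for an intermediate one, a 6-switch contradicts extremality. *)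
Lemma z_Rt : z \in Rt.
Proof.
apply: contraT => zR; have [sG iG] := gG.
have zL : z \in Lf by move: zR; rewrite in_setU in_setC negb_or => /andP[].
have zPo := Lf_Po zL.
have nXz x : x \in X -> ~~ G x z.
  move=> xX; have [u [uU0 Gsu nGxu]] := Heavy_adj sS xX.
  have [J [nJ n1 n2]] := near_s uU0 xX nGxu Gsu.
  have := near_notF uU0 xX nGxu Gsu nJ n1 n2; apply: contra => -> /=.
  by case: nJ => [[JLR _ _] _ _ _]; apply: contra zR => /JLR[].
have [x xX xz] := X_neq_z; have [u [uU0 Gsu nGxu]] := Heavy_adj sS xX.
have [J [nJ n1 n2]] := near_s uU0 xX nGxu Gsu.
have JPo q : q \in Po -> G z q -> J z q.
  by move=> qPo Gzq; have [p [[]]] := six_switch uU0 xX nGxu Gsu nJ n1 n2 xz qPo Gzq.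
have cntJ : cnt G z Po <= k.
  have [[_ Jr _] _ _ _] := nJ; apply: leq_trans (Jr z); rewrite deg_sum -sum_setT.
  apply: (@leq_trans (\sum_(q in Po) J z q)); last by apply: sum_le_set; exact: subsetT.
  by apply: leq_sum => q qPo; case Gzq: (G z q) => //; rewrite JPo.
have dz : dg z + #|X| + #|Po| < 2 * nu + cnt G z Po.
  have sX : s \in X = false.
    apply/negP => /X_cnt0; move: sS; rewrite inE => /andP[_]; clear; lia.
  have : \sum_w G z w + \sum_w (w \in X) + \sum_w (w \in Po) + 1 <=
      \sum_(w : V) 1 + \sum_w (G z w * (w \in Po)).
    rewrite -{1}(sumT1 s) -!big_split; apply: leq_sum => w _ /=.
    have [->|ws] := eqVneq w s; first by rewrite sX sPo [G z s]sG (negPf nGsz).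
    case wX: (w \in X); first by rewrite (X_notPo wX) sG (negPf (nXz _ wX)).
    by case: (G z w); case: (w \in Po).
  rewrite -dG deg_sum -!big_mkcond !sum1_card cardT -cardE cardV.
  suff -> : \sum_w G z w * (w \in Po) = cnt G z Po by clear; lia.
  by rewrite [RHS]big_mkcond; apply: eq_bigr => w _; case: ifP; rewrite ?muln1 ?muln0.
have [_ cX] := card_X; have cR : #|Rt| <= #|Po| + #|Y0| by rewrite cardsU leq_subr.
(* If [Y0] is a singleton, [card_X] gives one unit less for |X| + |Po|; the assumption [k <= c] in
   [HY] makes up for it. *)
have [zB|zH] := Lf_cases zL.
  have zge : nu + c <= dg z by move: zB; rewrite inE.
  move: dz cX cR cntJ zge kc; case: HY => [->|[-> c1 c2]].
    by rewrite cards0; clear; lia.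
  by move: c1 c2; clear; lia.
have Y00 : Y0 = set0.
  by case: HY => // -[YH _ _]; move: zR; rewrite in_setU YH zH orbT.
have zpsi : nu + c + 1 < dg z + k by move: zPo; rewrite inE; clear; lia.
have [q qPo Gzq] : exists2 q, q \in Po & G z q.
  apply: cnt_ex; move: dz cX cR zpsi kc; rewrite Y00 cards0; clear; lia.
have [p [[Gxp pz nGpq Jzq] [ok gG' dG' leD]]] := six_switch uU0 xX nGxu Gsu nJ n1 n2 xz qPo Gzq.
have uPo : u \in Po by have := subsetP U0Rt _ uU0; rewrite in_setU Y00 in_set0 orbF.
have eE := hi_po_edges_sw gG ok; have leE := noE gG' dG' leD.
move: eE; rewrite /hi_po_contr !big_cons !big_nil /= (Bg_Hi (X_Bg xX)) (X_notPo xX) uPo (Po_Hi uPo) qPo.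
rewrite (Po_Hi qPo) zPo zH sPo => eE.
have pH : p \in Hi by move: eE leE; case: (p \in Hi) => //; clear; lia.
have sH' : s \in Hi = false by move: eE leE; rewrite pH; case: (s \in Hi) => //; clear; lia.
have px : p != x by rewrite eq_sym; exact: simple_neq gG Gxp.
have [[JLR Jr Jc] Jxu JG tJ] := nJ.
have nJpq : ~~ J p q.
  by apply: contra nGpq => Jpq; apply: JG => //; rewrite (negPf px).
(* With a spare unit at [p], the unit on the removed edge zq moves to the new edge pq, so the whole
   flow survives and the deficiency falls. *)
have [rowp|rowp] := ltnP (deg J p) k.
  have := noD gG' dG'; rewrite leqNgt => /negP; case.
  pose J1 := upd J z q false; have J1pq : J1 p q = false by rewrite /J1 /upd (negPf pz) (negPf nJpq).
  have e1 v := deg_upd J1 p q true v; have e2 v := deg_upd J z q false v.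
  have e3 v := indeg_upd J1 p q true v; have e4 v := indeg_upd J z q false v.
  have e5 := flow_total_upd J1 p q true; have e6 := flow_total_upd J z q false.
  rewrite J1pq in e1 e3 e5; rewrite Jzq in e2 e4 e6.
  rewrite -(prednK Dpos) ltnS; apply: (@cut_duality _ (upd J1 p q true)).
  - split=> [a b|a|a].
    + rewrite /upd; case: ifP => [/andP[/eqP-> /eqP->] _|_]; first by rewrite Hi_Lf ?Po_Rt.
      by rewrite /J1 /upd; case: ifP => // _; exact: JLR.
    + have := e1 a; have := e2 a; have := Jr a; rewrite -/J1.
      by case: (a =P p) => [->|_]; move: rowp; clear; lia.
    + by have := e3 a; have := e4 a; have := Jc a; rewrite -/J1; clear; lia.
  - move=> a b; rewrite /upd; case: ifP => [/andP[/eqP-> /eqP->] _|npq J1ab].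
      by apply: sw_new; rewrite /= /samep !eqxx !orbT.
    have [/andP[/eqP-> /eqP->]|nxu] := boolP ((a == x) && (b == u)).
      by apply: sw_new; rewrite /= /samep !eqxx !orbT.
    apply: sw_keep; first by apply: JG nxu; move: J1ab; rewrite /J1 /upd; case: ifP.
    apply: noJP J1ab; rewrite /noJ /J1 /upd /= !eqxx /= (negPf n1) (negPf n2).
    have n3 := near_Po z nJ qPo; have n4 := near_Bg p nJ (X_Bg xX).
    have nJxp : ~~ J x p by apply/negP => /JLR[_]; rewrite in_setU Y00 in_set0 orbF (Hi_Po pH).
    by rewrite (negPf n3) (negPf n4) (negPf nJxp) !if_same.
  - by rewrite -/J1 in e6; move: tJ Dpos e5 e6; clear; lia.
(* Now [p] has k flow arcs, hence at least as many poor neighbours as [z]. Moving [q] from [z] to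
   [p] keeps the number of Hi-Po edges and raises the sum of squares. *)
have leE' : hi_po_edges (switch G [:: (s, u); (x, p); (q, z)] [:: (u, x); (p, q); (z, s)]) <= hi_po_edges G.
  by move: eE; rewrite pH sH'; clear; lia.
have := noQ gG' dG' leD leE'; rewrite leqNgt => /negP; case.
have cE v : v \in Hi -> cnt (switch G [:: (s, u); (x, p); (q, z)] [:: (u, x); (p, q); (z, s)]) v Po
    + (v == z) = cnt G v Po + (v == p).
  move=> vH; have := cnt_sw v Po gG ok; rewrite /contr !big_cons !big_nil /=.
  have nv w : w \in Hi = false -> v == w = false.
    by move=> wH; apply/negbTE; apply: contraFneq wH => <-.
  rewrite (nv s sH') (nv u (Po_Hi uPo)) (nv x (Bg_Hi (X_Bg xX))) (nv q (Po_Hi qPo)).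
  by rewrite qPo sPo zPo (X_notPo xX) (Hi_Po pH); clear; lia.
have cz := cE z zH; have cp := cE p pH.
rewrite eqxx (eq_sym z p) (negPf pz) in cz; rewrite eqxx (negPf pz) in cp.
have rz : 0 < cnt G z Po by move: cz; clear; lia.
have lep : k <= cnt G p Po.
  apply: leq_trans rowp _; rewrite deg_sum [X in _ <= X]big_mkcond; apply: leq_sum => v _.
  case Jpv: (J p v) => //; have [_] := JLR _ _ Jpv; rewrite in_setU Y00 in_set0 orbF => ->.
  by rewrite JG // (negPf px).
have qE G0 : hi_po_squares G0 = cnt G0 z Po * cnt G0 z Po + (cnt G0 p Po * cnt G0 p Po +
    \sum_(v in Hi | (v != z) && (v != p)) cnt G0 v Po * cnt G0 v Po).
  rewrite /hi_po_squares (bigD1 z zH) (bigD1 p) /=; last by rewrite pz andbT; exact: pH.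
  do 2!congr (_ + _).
  by apply: eq_bigl => v; rewrite andbA.
rewrite !qE; set S := \sum_(v in Hi | _) _; set S' := \sum_(v in Hi | _) _.
have -> : S' = S.
  apply: eq_bigr => v /andP[vH /andP[vz vp]]; have := cE v vH.
  by rewrite (negPf vz) (negPf vp) !addn0 => ->.
move: cz cp rz lep cntJ; move: (cnt G z Po) (cnt G p Po) (cnt _ z Po) (cnt _ p Po) S.
clear => a b a' b' S0 cz cp rz lep cntJ; have -> : b' = b.+1 by lia.
have -> : a = a'.+1 by lia.
by nia.
Qed.

Lemma card_Y0 : #|Y0| <= 1.
Proof. by case: HY => [->|[-> + _]] //; rewrite cards0. Qed.

Lemma Y0z_Po q : z \in Y0 -> q \in Po -> ~~ G z q.
Proof.
move=> zY qPo; apply/negP => Gzq; have [sG iG] := gG.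
have zH := Y0_Hi zY; have zPo := Hi_Po zH.
have [x xX xz] := X_neq_z; have [u [uU0 Gsu nGxu]] := Heavy_adj sS xX.
have [J [nJ n1 n2]] := near_s uU0 xX nGxu Gsu.
have [p [[Gxp pz nGpq Jzq] [ok gG' dG' leD]]] := six_switch uU0 xX nGxu Gsu nJ n1 n2 xz qPo Gzq.
have Hz w : w != z -> w \in Hi = false.
  by move=> wz; apply/negP => /(Hi_Y0 zY) E; rewrite E eqxx in wz.
have := noE gG' dG' leD; have := hi_po_edges_sw gG ok.
rewrite /hi_po_contr !big_cons !big_nil /= (Hz s sz) (Hz x xz) (Hz p pz) zH zPo qPo sPo (X_notPo xX).
by rewrite (Po_Hi qPo); clear; lia.
Qed.

(** More than k > 1 vertices qualify as [u] and [Y0] holds at most one, so [u] can be taken poor.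
    The exchange of [kundu_count] then lowers [diffn]; what remains is that a switch in G worsens
    none of the three higher measures. *)
Lemma no_heavy_exchange : k < \sum_(u in U0) (G s u && ~~ H s u) -> False.
Proof.
move=> ku; have [sG iG] := gG; have zR := z_Rt.
have [u [uU0 Gsu nHsu uY]] : exists u, [/\ u \in U0, G s u, ~~ H s u & u \notin Y0].
  have [/existsP[u /and4P[]]|] := boolP [exists u, [&& u \in U0, G s u, ~~ H s u & u \notin Y0]].
    by exists u.
  rewrite negb_exists => /forallP no; have : \sum_(u in U0) (G s u && ~~ H s u) <= #|Y0|.
    rewrite -sum1_card [X in X <= _]big_mkcond [X in _ <= X]big_mkcond.
    apply: leq_sum => u _; have := no u.
    by case: (u \in U0); case: (G s u); case: (H s u); case: (u \in Y0).
  by have := card_Y0; move: ku k2; clear; lia.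
have uR := subsetP U0Rt _ uU0.
have uPo : u \in Po by move: uR; rewrite in_setU (negPf uY) orbF.
have nGzu : ~~ G z u.
  move: zR; rewrite in_setU => /orP[zPo|zY]; last exact: Y0z_Po.
  by rewrite sG; exact: U0_Po.
have dGH v : deg G v = deg H v + k by rewrite dG dH.
have [[t [h1 h2 h3 h4]]|[q [h1 h2 h3 h4]]] := kundu_count gG gH dGH Hsz nGsz Gsu nHsu.
  have [gH' dH' lt] := sw_kunduH gG gH Hsz nGsz Gsu nHsu h1 h2 h3 h4.
  have := noH gG dG gH' _ (leqnn _) (leqnn _) (leqnn _); rewrite leqNgt lt.
  by move=> H'; have := H' (fun v => etrans (congr1 (addn^~ k) (dH' v)) (dH v)).
have [ok gG' dG'' lt] := sw_kunduG gG gH Hsz nGsz Gsu nHsu h1 h2 h3 h4.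
have dG' v : deg (sw4 G s u q z) v = dg v by rewrite dG'' dG.
have zPoq : z \in Y0 -> q \in Po = false.
  by move=> zY; apply/negP => /(Y0z_Po zY); rewrite h1.
have HzY w : z \in Y0 -> w != z -> w \in Hi = false.
  by move=> zY wz; apply/negP => /(Hi_Y0 zY) E; rewrite E eqxx in wz.
have qz : q != z by rewrite eq_sym; exact: simple_neq gG h1.
have cE v : v \in Hi -> cnt (sw4 G s u q z) v Po = cnt G v Po.
  move=> vH; have := cnt_sw v Po gG ok; rewrite /contr !big_cons !big_nil /=.
  rewrite -/(sw4 G s u q z) sPo uPo.
  have -> : (v == u) = false by apply: contraTF uPo => /eqP <-; rewrite Hi_Po.
  move: zR; rewrite in_setU => /orP[zPo|zY].
    have -> : (v == z) = false by apply: contraTF zPo => /eqP <-; rewrite Hi_Po.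
    by rewrite zPo; clear; lia.
  have nv w : w != z -> v == w = false.
    by move=> wz; apply: contraTF vH => /eqP ->; rewrite HzY.
  by rewrite (nv s sz) (nv q qz) (zPoq zY); clear; lia.
have eE : hi_po_edges (sw4 G s u q z) = hi_po_edges G by apply: eq_bigr => v vH; rewrite cE.
have eQ : hi_po_squares (sw4 G s u q z) = hi_po_squares G by apply: eq_bigr => v vH; rewrite cE.
have leD : deficiency (sw4 G s u q z) <= deficiency G.
  have [x xX nGxu] := X_nonadj uU0.
  have [J [nJ n1 n2]] := near_s uU0 xX nGxu Gsu.
  have [[JLR Jr Jc] Jxu JG tJ] := nJ.
  have nJzq : ~~ J z q.
    apply/negP => /JLR[zL qR]; have zY := RtLf_Y0 zR zL.
    move: qR; rewrite in_setU (zPoq zY) /= => qY.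
    by rewrite (Hi_Y0 zY (Y0_Hi qY)) eqxx in qz.
  (* Dropping the non-edge xu leaves an optimal flow of G that avoids su and has a spare unit at
     [u]. If the switch destroys the arc qz, the new edge qu carries that unit instead. *)
  pose J1 := upd J x u false.
  have e1 v := deg_upd J x u false v; have e3 v := indeg_upd J x u false v.
  have e5 := flow_total_upd J x u false; rewrite Jxu in e1 e3 e5.
  have J1G a b : J1 a b -> G a b by rewrite /J1 /upd; case: ifP => // nab /JG; rewrite nab => /(_ isT).
  have J1J a b : J1 a b -> J a b by rewrite /J1 /upd; case: ifP.
  have nJ1 rs : noJ J rs -> noJ J1 rs.
    move=> /allP no; apply/allP => e /no /andP[m1 m2].
    by rewrite (contra (@J1J _ _) m1) (contra (@J1J _ _) m2).
  have [Jqz|nJqz] := boolP (J1 q z); last first.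
    apply: (@cut_duality _ J1).
    - split=> [a b /J1J|a|a]; first exact: JLR.
        by have := e1 a; have := Jr a; rewrite -/J1; clear; lia.
      by have := e3 a; have := Jc a; rewrite -/J1; clear; lia.
    - move=> a b J1ab; apply: sw_keep; first exact: J1G.
      apply: noJP J1ab; rewrite /noJ /= nJqz (contra (@J1J _ _) nJzq).
      by rewrite (contra (@J1J _ _) n1) (contra (@J1J _ _) n2).
    - by rewrite -/J1 in e5; move: tJ e5; clear; lia.
  pose J2 := upd J1 q z false.
  have J2qu : J2 q u = false.
    rewrite /J2 /upd; case: ifP => // _; apply: contraNF h2 => /J1G; by rewrite sG.
  have f1 v := deg_upd J1 q z false v; have f3 v := indeg_upd J1 q z false v.
  have f5 := flow_total_upd J1 q z false; rewrite Jqz in f1 f3 f5.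
  have g1 v := deg_upd J2 q u true v; have g3 v := indeg_upd J2 q u true v.
  have g5 := flow_total_upd J2 q u true; rewrite J2qu in g1 g3 g5.
  have [qL _] := JLR _ _ (J1J _ _ Jqz).
  have J2J a b : J2 a b -> J1 a b by rewrite /J2 /upd; case: ifP.
  apply: (@cut_duality _ (upd J2 q u true)).
  - split=> [a b|a|a].
    + by rewrite /upd; case: ifP => [/andP[/eqP-> /eqP->] //|_ /J2J /J1J]; exact: JLR.
    + by have := e1 a; have := f1 a; have := g1 a; have := Jr a; rewrite -/J1 -/J2; clear; lia.
    + by have := e3 a; have := f3 a; have := g3 a; have := Jc a; rewrite -/J1 -/J2; clear; lia.
  - move=> a b; rewrite /upd; case: ifP => [/andP[/eqP-> /eqP->] _|_ J2ab].
      by apply: sw_new; rewrite /= /samep !eqxx !orbT.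
    apply: sw_keep; first exact: J1G (J2J _ _ J2ab).
    apply: noJP J2ab; rewrite /noJ /= (contra (@J2J _ _) (contra (@J1J _ _) nJzq)).
    rewrite (contra (@J2J _ _) (contra (@J1J _ _) n1)).
    by rewrite (contra (@J2J _ _) (contra (@J1J _ _) n2)) /J2 /upd !eqxx.
  - by rewrite -/J1 -/J2 in e5 f5 g5 *; move: tJ e5 f5 g5; clear; lia.
have : diffn H G <= diffn H (sw4 G s u q z) by apply: noH; rewrite ?eE ?eQ.
by rewrite leqNgt lt.
Qed.

End FixSZ.

Lemma no_minimal : False.
Proof. by have [s [z [[sS Hsz nGsz] ku]]] := heavy_exchange; exact: (no_heavy_exchange sS Hsz nGsz ku). Qed.

End FixG.

Lemma hi_po_squares_le G : hi_po_squares G <= #|V| * (#|V| * #|V|).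
Proof.
apply: (@leq_trans (\sum_(z in Hi) #|V| * #|V|)).
  apply: leq_sum => z _; have le := leq_trans (cnt_card G z Po) (max_card _).
  exact: leq_mul.
by rewrite sum_nat_const leq_mul2r max_card orbT.
Qed.

Lemma zero_deficiency G0 H0 :
    simple_graph G0 -> (forall v, deg G0 v = dg v) ->
    simple_graph H0 -> (forall v, deg H0 v + k = dg v) ->
  exists G, [/\ simple_graph G, forall v, deg G v = dg v & deficiency G = 0].
Proof.
move=> gG0 dG0 gH0 dH0; apply: NNPP => none.
have pos G : simple_graph G -> (forall v, deg G v = dg v) -> 0 < deficiency G.
  by move=> gG dG; rewrite lt0n; apply/negP => /eqP D0; apply: none; exists G.
(* [C] bounds the sum of squares, turning its growth into descent of [C - hi_po_squares G]; the four
   nested inductions below are the lexicographic order. *)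
pose C := #|V| * (#|V| * #|V|).
suff: forall N1 N2 N3 N4 G H, simple_graph G -> (forall v, deg G v = dg v) ->
    simple_graph H -> (forall v, deg H v + k = dg v) ->
    deficiency G < N1 -> hi_po_edges G < N2 -> C - hi_po_squares G < N3 -> diffn H G < N4 -> False.
  by move=> F; exact: (F _ _ _ _ G0 H0 gG0 dG0 gH0 dH0 (ltnSn _) (ltnSn _) (ltnSn _) (ltnSn _)).
elim=> // N1 IH1; elim=> // N2 IH2; elim=> // N3 IH3; elim=> // N4 IH4.
move=> G H gG dG gH dH l1 l2 l3 l4.
have [U0 [U1 [t0 t1 t01]]] := tight_bounds (pos G gG dG).
apply: (no_minimal gG dG (pos G gG dG) t0 t1 t01 gH dH).
- move=> G' gG' dG'; rewrite leqNgt; apply/negP => lt.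
  apply: (IH1 _ _ _ G' H gG' dG' gH dH _ (ltnSn _) (ltnSn _) (ltnSn _)).
  exact: leq_trans lt _.
- move=> G' gG' dG' leD; rewrite leqNgt; apply/negP => lt.
  apply: (IH2 _ _ G' H gG' dG' gH dH _ _ (ltnSn _) (ltnSn _)); last exact: leq_trans lt _.
  exact: leq_ltn_trans leD _.
- move=> G' gG' dG' leD leE; rewrite leqNgt; apply/negP => lt.
  apply: (IH3 _ G' H gG' dG' gH dH _ _ _ (ltnSn _)).
  + exact: leq_ltn_trans leD _.
  + exact: leq_ltn_trans leE _.
  + by have := hi_po_squares_le G'; rewrite -/C; move: lt l3; clear; lia.
- move=> G' H' gG' dG' gH' dH' leD leE leQ; rewrite leqNgt; apply/negP => lt.
  apply: (IH4 G' H' gG' dG' gH' dH').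
  + exact: leq_ltn_trans leD _.
  + exact: leq_ltn_trans leE _.
  + by move: leQ l3; clear; lia.
  + exact: leq_trans lt _.
Qed.

Lemma exists_full_flow G0 H0 :
    simple_graph G0 -> (forall v, deg G0 v = dg v) ->
    simple_graph H0 -> (forall v, deg H0 v + k = dg v) ->
  exists G J, [/\ simple_graph G, forall v, deg G v = dg v,
    forall p v, J p v -> [/\ p \in Lf, v \in Rt & G p v],
    forall p, deg J p <= k & forall v, indeg J v = (v \in Rt) * k].
Proof.
move=> gG0 dG0 gH0 dH0; have [G [gG dG D0]] := zero_deficiency gG0 dG0 gH0 dH0.
pose W p v : nat := [&& p \in Lf, v \in Rt & G p v].
have [U|J0 [J1 J2 J3]] := @feasible_flow _ _ (fun p => (p \in Lf) * k) (fun v => (v \in Rt) * k) W.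
  rewrite -big_distrl /=; have -> : \sum_(v in U) (v \in Rt) = #|U :&: Rt|.
    rewrite -sum1_card big_mkcond [RHS]big_mkcond; apply: eq_bigr => v _.
    by rewrite in_setI; case: (v \in U); case: (v \in Rt).
  rewrite mulnC; apply: leq_trans (le_deficiency G (subsetIr U Rt)) _; rewrite D0 addn0.
  apply: leq_sum => p _; have [pL|] := boolP (p \in Lf); last by rewrite mul0n !min0n.
  rewrite leq_min geq_minl /= (leq_trans (geq_minr _ _)) // /wsum [X in X <= _]big_mkcond.
  rewrite [X in _ <= X]big_mkcond; apply: leq_sum => v _; rewrite in_setI /W pL.
  by case: (v \in U); case: (v \in Rt).
have JW p v : J0 p v = (0 < J0 p v) :> nat.
  by have := J1 p v; rewrite /= /W; case: [&& _, _ & _]; clear; lia.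
exists G, (fun p v => 0 < J0 p v); split=> // [p v lt|p|v].
- by have := leq_trans lt (J1 p v); rewrite /W lt0b => /and3P[].
- rewrite deg_sum; under eq_bigr do rewrite -JW.
  by apply: leq_trans (J2 p) _; case: (p \in Lf); rewrite ?mul1n.
- by rewrite /indeg; under eq_bigr do rewrite -JW.
Qed.

End FullFlow.

(** * Completing the matchings *)

Section Colours.

Variables (V : finType) (k : nat) (J : rel V) (R : {set V}).
Hypotheses (rowJ : forall p, deg J p <= k) (colJ : forall v, indeg J v = (v \in R) * k).

Lemma bip_colouring : exists f : 'I_k -> V -> V,
  [/\ forall i v, v \in R -> J (f i v) v,
      forall i, {in R &, injective (f i)} &
      forall i j v, v \in R -> f i v = f j v -> i = j].
Proof.
pose W (a b : V + V) : nat := match a, b with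
  | inl p, inl v => J p v
  | inr v, inr p => J p v
  | inl p, inr q => (p == q) * (k - deg J p)
  | inr v, inl w => (v == w) * (k - indeg J v) end.
have colJk v : indeg J v <= k by rewrite colJ; case: (v \in R); rewrite ?mul1n.
have sE (v : V) m (f : V -> nat) : (forall w, f w = (v == w) * m) -> \sum_w f w = m.
  move=> fE; rewrite (eq_bigr (fun w => (w == v) * m)) => [|w _]; last by rewrite fE eq_sym.
  by rewrite -big_distrl /= sumT1 mul1n.
have rowW a : \sum_b W a b = k.
  rewrite big_sumType /=; case: a => [p|v] /=.
    by rewrite (sE p (k - deg J p) (fun q => (p == q) * (k - deg J p))) // -(deg_sum J p) subnKC.
  by rewrite (sE v (k - indeg J v) (fun w => (v == w) * (k - indeg J v))) // addnC -/(indeg J v) subnKC.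
have colW b : \sum_a W a b = k.
  rewrite big_sumType /=; case: b => [v|p] /=.
    rewrite (sE v (k - indeg J v) (fun w => (w == v) * (k - indeg J w))) -/(indeg J v) ?subnKC // => w.
    by rewrite eq_sym; case: eqP => [->|].
  rewrite addnC (sE p (k - deg J p) (fun q => (q == p) * (k - deg J q))) -?(deg_sum J p) ?subnKC // => w.
  by rewrite eq_sym; case: eqP => [->|].
have [s [injs sW]] := birkhoff rowW colW.
have Ws i a : 0 < W a (s i a).
  by rewrite -sW (bigD1 i) //= eqxx.
have sR i v : v \in R -> exists2 p, s i (inr v) = inr p & J p v.
  move=> vR; have := Ws i (inr v); case: (s i (inr v)) => [w|p] /=.
    by rewrite colJ vR mul1n subnn muln0.
  by rewrite lt0b; exists p.
exists (fun i v => if s i (inr v) is inr p then p else v); split=> [i v vR|i v w vR wR|i j v vR].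
- by have [p ->] := sR i v vR.
- have [p e1 _] := sR i v vR; have [q e2 _] := sR i w wR; rewrite e1 e2 => pq.
  by have := injs i (inr v) (inr w); rewrite e1 e2 pq => /(_ erefl) [].
- have [p e1 _] := sR i v vR; have [q e2 _] := sR j v vR; rewrite e1 e2 => pq.
  apply/eqP/negPn/negP => ij.
  have := sW (inr v) (inr q); rewrite (bigD1 i) //= (bigD1 j) 1?eq_sym //= e1 e2 pq !eqxx.
  by case: (J q v); clear; lia.
Qed.

End Colours.

Section Families.

Variables (V : finType) (k : nat) (G : rel V).
Hypothesis gG : simple_graph G.
Implicit Types (F : 'I_k -> V -> V).

(* Matchings are involutions; the fixed points are the uncovered vertices. *)
Definition fam F :=
  [/\ forall i, involutive (F i), forall i v, F i v != v -> G v (F i v) &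
      forall i j v, F i v = F j v -> F i v != v -> i = j].

Lemma flow_fam (J : rel V) (L R Y : {set V}) :
    (forall p v, J p v -> [/\ p \in L, v \in R & G p v]) ->
    (forall p, deg J p <= k) -> (forall v, indeg J v = (v \in R) * k) ->
    (forall v, v \in L -> v \in R -> v \in Y) -> #|Y| <= 1 ->
  exists F, [/\ fam F, forall i v, v \in R -> F i v != v &
     forall i v, v \notin R -> F i v != v -> F i v \in R].
Proof.
move=> JP rowJ colJ LRY Y1; have [sG iG] := gG.
have [f [fJ fi fd]] := bip_colouring rowJ colJ.
have Yu v w : v \in Y -> w \in Y -> v = w.
  by move=> vY; move/card_le1P: Y1 => /(_ v vY) ->; rewrite inE => /eqP.
have fL i v : v \in R -> f i v \in L by move=> /(fJ i) /JP[].
have fG i v : v \in R -> G (f i v) v by move=> /(fJ i) /JP[].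
have fne i v : v \in R -> f i v != v by move=> /(fG i) /(simple_neq gG).
(* A vertex of [R] that already serves as a partner in colour [i] gives up its own arc and stays
   covered. Such a vertex lies in [Y], so the conflict occurs at most once per colour. *)
pose ok i v := (v \in R) && ~~ [exists w, (w \in R) && (f i w == v)].
pose im i v := [pick w | ok i w && (f i w == v)].
pose F i v := if im i v is Some w then w else if v \in R then f i v else v.
have imY i v w : v \in R -> w \in R -> f i w = v -> v \in Y.
  by move=> vR wR fw; apply: LRY => //; rewrite -fw fL.
have notok i v : v \in R -> ~~ ok i v -> exists2 w, ok i w & f i w = v.
  move=> vR; rewrite /ok vR /= negbK => /existsP[w /andP[wR /eqP fw]]; exists w => //.
  rewrite wR /=; apply/existsP => -[w' /andP[w'R /eqP fw']].
  have := fne i w wR.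
  by rewrite fw (Yu v w (imY i v w vR wR fw) (imY i w w' wR w'R fw')) eqxx.
have imE i w : ok i w -> im i (f i w) = Some w.
  move=> ow; rewrite /im; case: pickP => [w' /andP[ow' /eqP fw]|/(_ w)]; last by rewrite ow eqxx.
  by congr Some; apply: (fi i) => //; [case/andP: ow'|case/andP: ow].
have imN i w : ok i w -> im i w = None.
  move=> /andP[_ /existsP no]; rewrite /im; case: pickP => // w' /andP[/andP[w'R _] fw].
  by case: no; exists w'; rewrite w'R.
have okR i w : ok i w -> w \in R by case/andP.
have FE i v : [\/ exists w, [/\ ok i w, v = f i w & F i v = w],
    ok i v /\ F i v = f i v | v \notin R /\ F i v = v].
  rewrite /F; case E: (im i v) => [w|].
    move: E; rewrite /im; case: pickP => // w' /andP[ow /eqP <-] [<-].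
    by constructor 1; exists w'.
  have [vR|vR] := boolP (v \in R); last by constructor 3.
  constructor 2; split=> //; apply: contraT => /(notok i v vR) [w ow fw].
  by rewrite -fw imE in E.
have Ff i w : ok i w -> F i (f i w) = w by move=> ow; rewrite /F imE.
have Fo i w : ok i w -> F i w = f i w by move=> ow; rewrite /F imN // (okR i).
exists F; split; first split.
- move=> i v; case: (FE i v) => [[w [ow -> ->]]|[ov ->]|[vR E]]; last by rewrite !E.
    by rewrite Fo // Ff.
  exact: Ff.
- move=> i v; case: (FE i v) => [[w [ow -> ->]]|[ov ->]|[vR ->]] //.
  + by move=> _; apply: fG; exact: okR ow.
  + by move=> _; rewrite sG; apply: fG; exact: okR ov.
  + by rewrite eqxx.
- move=> i j v; case: (FE i v) => [[w [ow vE ->]]|[ov ->]|[vR ->]]; last by rewrite eqxx.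
    case: (FE j v) => [[w' [ow' vE' ->]]|[ov' ->]|[vR' ->]] E ne.
    + by apply: (fd i j w); [exact: okR ow|rewrite -vE vE' E].
    + have vR := okR _ _ ov'; have wR := okR _ _ ow.
      by rewrite (Yu w v) ?eqxx // in ne; [exact: imY (esym E)|exact: imY (esym vE)].
    + by rewrite E eqxx in ne.
  case: (FE j v) => [[w' [ow' vE' ->]]|[ov' ->]|[vR' ->]] E ne.
  + have vR := okR _ _ ov; have wR := okR _ _ ow'.
    have fvw : f i v = w' by [].
    by rewrite E (Yu w' v) ?eqxx // in ne; [exact: imY fvw|exact: imY (esym vE')].
  + by apply: (fd i j v) => //; exact: okR ov.
  + by rewrite E eqxx in ne.
- move=> i v vR; case: (FE i v) => [[w [ow -> ->]]|[ov ->]|[]]; last by rewrite vR.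
    by rewrite eq_sym; apply: fne; exact: okR ow.
  exact: fne.
- move=> i v vR; case: (FE i v) => [[w [ow -> ->]] _|[ov _]|[_ ->]]; last by rewrite eqxx.
    exact: okR ow.
  by rewrite (okR _ _ ov) in vR.
Qed.

End Families.

(** * Short augmenting paths and completion under Ore's condition *)

Section Augment.

Variables (V : finType) (k : nat) (G : rel V).
Hypothesis gG : simple_graph G.
Implicit Types (F : 'I_k -> V -> V) (f : V -> V) (S : {set V}).

Definition free F v w := G v w && [forall i, F i v != w].
Definition dfree F v := \sum_w free F v w.
Definition updF F i f : 'I_k -> V -> V := fun j => if j == i then f else F j.
Definition ufix f S := \sum_(v in S) (f v == v).

Lemma freeG F v w : free F v w -> G v w.
Proof. by case/andP. Qed.

Lemma freeN F v w i : free F v w -> F i v != w.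
Proof. by case/andP => _ /forallP. Qed.

Lemma free_irr F v : free F v v = false.
Proof. by rewrite /free; case: gG => _ ->. Qed.

Lemma free_sym F v w : fam G F -> free F v w = free F w v.
Proof.
move=> [inv _ _]; rewrite /free; case: gG => -> _; congr (_ && _).
by apply: eq_forallb => i; congr (~~ _); apply/eqP/eqP => <-; rewrite inv.
Qed.

Lemma dfree_ge F v : deg G v <= dfree F v + \sum_i (F i v != v).
Proof.
have -> : \sum_i (F i v != v) = \sum_w \sum_i ((F i v == w) && (F i v != v)).
  rewrite exchange_big; apply: eq_bigr => i _ /=.
  rewrite -[LHS]mul1n -(sumT1 (F i v)) big_distrl; apply: eq_bigr => w _ /=.
  by rewrite eq_sym; case: (F i v == w); case: (F i v != v).
rewrite deg_sum -big_split; apply: leq_sum => w _ /=; rewrite /free.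
case Gvw: (G v w) => //=; case: forallP => //= /forallP; rewrite negb_forall.
case/existsP=> i; rewrite negbK => e; rewrite add0n (bigD1 i) //= e (eqP e) eq_sym.
by rewrite (simple_neq gG Gvw).
Qed.

Lemma cov_le F v (i j : 'I_k) : i != j ->
  \sum_l (F l v != v) + (F i v == v) + (F j v == v) <= k.
Proof.
move=> ij; have ji : j != i by rewrite eq_sym.
rewrite (bigD1 i) //= (bigD1 j) //=.
set S := \sum_(l < k | _) _; have : S + 2 <= k.
  have ek : \sum_(l < k) 1 = k by rewrite sum1_card card_ord.
  rewrite -[X in _ <= X]ek [X in _ <= X](bigD1 i) //= [X in _ <= _ + X](bigD1 j) //=.
  by rewrite addnC addnA leq_add2l; apply: leq_sum => l _; case: (_ == _).
by move: S => S; case: (F i v == v); case: (F j v == v); clear; lia.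
Qed.

Lemma cov_le1 F v (i : 'I_k) : F i v = v -> \sum_l (F l v != v) + 1 <= k.
Proof.
move=> e; rewrite (bigD1 i) //= e eqxx /=.
have ek : \sum_(l < k) 1 = k by rewrite sum1_card card_ord.
by rewrite -[X in _ <= X]ek [X in _ <= X](bigD1 i) //= addnC leq_add2l; apply: leq_sum => l _; case: (_ == _).
Qed.

Lemma fam_upd F i f : fam G F -> involutive f ->
  (forall v, f v != v -> f v = F i v \/ free F v (f v)) -> fam G (updF F i f).
Proof.
move=> [inv FG dis] invf fE; split=> [j|j v|j l v]; rewrite /updF.
- by case: ifP.
- case: ifP => _ ne; last exact: FG.
  by case: (fE v ne) => [e|/freeG//]; rewrite e; apply: FG; rewrite -e.
- case: eqP => [->|_]; case: eqP => [->|_] // E ne; last exact: dis E ne.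
    case: (fE v ne) => [e|fr]; first by apply: dis (v) _ _; rewrite -e.
    by have := freeN l fr; rewrite E eqxx.
  rewrite E in ne; case: (fE v ne) => [e|fr]; last by have := freeN j fr; rewrite E eqxx.
  by apply: dis (v) _ _; rewrite E // -e.
Qed.

(** The former mates of [u] and [w] become uncovered. An uncovered [u] or [w] is its own former
    mate, which the earlier tests catch. *)
Definition setp f u w v :=
  if v == u then w else if v == w then u else if (v == f u) || (v == f w) then v else f v.

Lemma setp_inv f u w : involutive f -> involutive (setp f u w).
Proof.
move=> inv v; rewrite {2}/setp.
have [->|vu] := eqVneq v u; first by rewrite /setp eqxx; case: eqP.
have [->|vw] := eqVneq v w; first by rewrite /setp eqxx.
case: ifP => [e|ne]; first by rewrite /setp (negPf vu) (negPf vw) e.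
rewrite /setp !(inv_eq inv) !inv (negPf vu) (negPf vw) /=.
by case/norP: (negbT ne) => /negPf -> /negPf ->.
Qed.

Lemma setp_edge F i u w v : fam G F -> free F u w -> setp (F i) u w v != v ->
  setp (F i) u w v = F i v \/ free F v (setp (F i) u w v).
Proof.
move=> fF fr; rewrite /setp; have [->|vu] := eqVneq v u; first by right.
have [->|vw] := eqVneq v w; first by right; rewrite (free_sym _ _ fF).
by case: ifP => [_|]; [rewrite eqxx|left].
Qed.

Definition aug F i u w := exists F', [/\ fam G F', forall j, j != i -> F' j = F j &
  forall v, (F' i v == v) = [&& F i v == v, v != u & v != w]].

Lemma updF_i F i f : updF F i f i = f. Proof. by rewrite /updF eqxx. Qed.
Lemma updF_j F i j f : j != i -> updF F i f j = F j.
Proof. by rewrite /updF => /negPf ->. Qed.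

Lemma aug_edge F i u w : fam G F -> F i u = u -> F i w = w -> free F u w -> aug F i u w.
Proof.
move=> fF eu ew fr; have [inv FG dis] := fF.
exists (updF F i (setp (F i) u w)); split=> [|j|v].
- by apply: fam_upd => // [|v]; [exact: setp_inv|exact: setp_edge].
- exact: updF_j.
- rewrite updF_i /setp eu ew; have uw := simple_neq gG (freeG fr).
  have [->|vu] := eqVneq v u; first by rewrite eq_sym (negPf uw) andbF.
  by have [->|vw] := eqVneq v w; rewrite ?(negPf uw) ?andbF ?andbT //= eq_sym.
Qed.

Lemma aug_move F i u a : fam G F -> F i u = u -> F i a != a -> free F u a ->
  exists F', [/\ fam G F', forall j, j != i -> F' j = F j,
    forall v, (F' i v == v) = (v == F i a) || ((F i v == v) && (v != u)) &
    F' i = setp (F i) u a].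
Proof.
move=> fF eu na fr; have [inv FG dis] := fF.
exists (updF F i (setp (F i) u a)); split=> [|j|v|]; last exact: updF_i.
- by apply: fam_upd => // [|v]; [exact: setp_inv|exact: setp_edge].
- exact: updF_j.
- rewrite updF_i /setp eu; have ua := simple_neq gG (freeG fr).
  have [->|vu] := eqVneq v u.
    by rewrite andbF orbF eq_sym (negPf ua) eq_sym (inv_eq (inv i)) eu eq_sym (negPf ua).
  have [->|va] /= := eqVneq v a; first by rewrite (negPf ua) (eq_sym a (F i a)) (negPf na).
  by rewrite andbT; case: (v == F i a); rewrite ?eqxx.
Qed.

Lemma free_stable F F' i v w : free F v w -> (forall j, j != i -> F' j = F j) ->
  F' i v != w -> free F' v w.
Proof.
move=> fr eF ne; rewrite /free (freeG fr); apply/forallP => j.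
by have [->//|ji] := eqVneq j i; rewrite eF // freeN.
Qed.

Lemma aug_path F i u a x : fam G F -> F i u = u -> F i x = x -> u != x ->
  free F u a -> F i a != a -> free F x (F i a) -> aug F i u x.
Proof.
move=> fF eu ex ux fr na fr'; have [inv FG dis] := fF.
have [F1 [fF1 e1 fix1 _]] := aug_move fF eu na fr.
have ax : a != x by apply: contraNneq na => ->; rewrite ex.
have xa : x != F i a by apply: contraNneq ax => e; rewrite -(inv i a) -e ex.
have f1a : F1 i (F i a) = F i a by apply/eqP; rewrite fix1 eqxx.
have f1x : F1 i x = x by apply/eqP; rewrite fix1 ex eqxx (eq_sym x u) ux orbT.
have fr1 : free F1 x (F i a) by apply: free_stable fr' e1 _; rewrite f1x.
have [F2 [fF2 e2 fix2]] := aug_edge fF1 f1x f1a fr1.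
exists F2; split=> // [j ji|v]; first by rewrite e2 ?e1.
rewrite fix2 fix1; have [->|vFa] := eqVneq v (F i a); last by rewrite /= andbT andbA.
by rewrite inv (eq_sym a) (negPf na) !andbF.
Qed.

Lemma augment F i u x : fam G F -> F i u = u -> F i x = x -> u != x ->
  (exists w, [/\ aug F i u w, F i w = w & u != w]) \/
  (forall a, free F u a -> F i a != a /\ ~~ free F x (F i a)).
Proof.
move=> fF eu ex ux.
have [/existsP[a /andP[fr /eqP ea]]|no1] := boolP [exists a, free F u a && (F i a == a)].
  left; exists a; split=> //; first exact: aug_edge.
  exact: simple_neq gG (freeG fr).
have na a : free F u a -> F i a != a.
  by move=> fr; move: no1; rewrite negb_exists => /forallP/(_ a); rewrite fr.
have [/existsP[a /andP[fr fr']]|no2] := boolP [exists a, free F u a && free F x (F i a)].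
  by left; exists x; split=> //; apply: aug_path fr'; rewrite ?na.
right=> a fr; split; first exact: na.
by move: no2; rewrite negb_exists => /forallP/(_ a); rewrite fr.
Qed.

Lemma dfree_reindex F i u : fam G F -> dfree F u = \sum_w free F u (F i w).
Proof. by move=> [inv _ _]; rewrite /dfree (reindex_inj (inv_inj (inv i))). Qed.

(** Ore's disjointness, pointwise: a mate of a free neighbour of [u] that is also a free neighbour
    of [x] would give an augmenting path. Summing over [w] yields [nowin_count]. *)
Lemma nowin_le1 F i u x : fam G F -> F i u = u -> F i x = x -> u != x ->
    (forall a, free F u a -> F i a != a /\ ~~ free F x (F i a)) ->
  forall w, free F u (F i w) + free F x w + (w == u) + (w == x) <= 1.
Proof.
move=> fF eu ex ux nw w; have [inv FG dis] := fF.
have nux : free F u x = false.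
  by apply/negP => /nw[]; rewrite ex eqxx.
have nxu : free F x u = false by rewrite (free_sym _ _ fF).
have [->|wu] := eqVneq w u; first by rewrite eu free_irr nxu (negPf ux).
have [->|wx] := eqVneq w x; first by rewrite ex nux free_irr.
case fr: (free F u (F i w)); last by case: (free F x w).
by have [_] := nw _ fr; rewrite inv => /negPf ->.
Qed.

Lemma nowin_count F i u x : fam G F -> F i u = u -> F i x = x -> u != x ->
    (forall a, free F u a -> F i a != a /\ ~~ free F x (F i a)) ->
  dfree F u + dfree F x + 2 <= #|V|.
Proof.
move=> fF eu ex ux nw; have := leq_sum _ (fun w _ => nowin_le1 fF eu ex ux nw w).
move=> /(_ (index_enum V) predT).
by rewrite !big_split /= -dfree_reindex // !sumT1 sum1_card -addnA.
Qed.

Lemma odd_ufix f : involutive f -> odd (ufix f setT) = odd #|V|.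
Proof.
move=> inv; pose A := [set v | f v != v].
suff odA (B : {set V}) : (forall v, v \in B -> f v \in B /\ f v != v) -> odd #|B| = false.
  have -> : ufix f setT = #|~: A|.
    by rewrite -sum1_card /ufix sum_setT [RHS]big_mkcond; apply: eq_bigr => v _;
      rewrite !inE negbK; case: (f v == v).
  rewrite -(cardsC A) oddD (odA A) // => v; rewrite !inE => nv.
  by rewrite inv eq_sym nv.
have [n] := ubnP #|B|; elim: n B => // n IH B ltB clB.
have [->|[v vB]] := set_0Vmem B; first by rewrite cards0.
have [fB fv] := clB v vB.
have fB' : f v \in B :\ v by rewrite in_setD1 fv.
have cB : #|B| = #|(B :\ v) :\ f v|.+2 by rewrite (cardsD1 v B) vB (cardsD1 (f v) (B :\ v)) fB'.
rewrite cB /= negbK; apply: IH; first by move: ltB; rewrite cB; clear; lia.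
move=> w; rewrite !in_setD1 => /and3P[wfv wv wB]; have [fwB fw] := clB w wB.
by rewrite fwB fw !(inv_eq inv) inv wv wfv.
Qed.

(** By parity a colour missing one vertex misses two. Each has at least deg - k + 1 free edges, so
    by the degree hypothesis their free degrees sum to more than |V| - 2 and a short augmentation
    exists. Augmenting uncovers nothing, so the hypothesis persists. *)
Lemma perfect_family F : ~~ odd #|V| -> fam G F ->
    (forall i v, F i v = v -> #|V| + 2 * k <= 2 * deg G v + 3) ->
  exists F', fam G F' /\ forall i v, F' i v != v.
Proof.
move=> evV; have [n] := ubnP (\sum_i ufix (F i) setT).
elim: n F => // n IH F lt fF big; have [inv FG dis] := fF.
have [/existsP[i /existsP[u /eqP eu]]|no] := boolP [exists i, [exists u, F i u == u]]; last first.
  exists F; split=> // i v; apply: contra no => e.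
  by apply/existsP; exists i; apply/existsP; exists v.
have [x ex ux] : exists2 x, F i x = x & u != x.
  have [/existsP[x /andP[/eqP ex ux]]|nox] := boolP [exists x, (F i x == x) && (u != x)].
    by exists x.
  have := odd_ufix (inv i); have -> : ufix (F i) setT = 1; last by rewrite (negPf evV).
  rewrite -(sumT1 u) -sum_setT; apply: eq_bigr => v _.
  have [->|vu] := eqVneq v u; first by rewrite eu eqxx.
  by move: nox; rewrite negb_exists => /forallP/(_ v); rewrite (eq_sym u) vu andbT => /negPf ->.
case: (augment fF eu ex ux) => [[w [[F' [fF' eF fixF]] ew uw]]|nw].
  apply: (IH F') => // [|j v]; last first.
    have [->|ji] := eqVneq j i; last by rewrite eF //; exact: big.
    by move=> /eqP; rewrite fixF => /and3P[/eqP e _ _]; exact: big e.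
  have lt' : ufix (F' i) setT < ufix (F i) setT.
    rewrite /ufix [X in X < _](bigD1 u) ?inE // [X in _ < X](bigD1 u) ?inE //=.
    rewrite fixF !eqxx eu !eqxx andbF add0n add1n ltnS; apply: leq_sum => v _.
    by rewrite fixF; case: (F i v == v) => //=; exact: leq_b1.
  rewrite -ltnS; apply: leq_ltn_trans lt; rewrite (bigD1 i) //= [X in _ < X](bigD1 i) //= -addSn.
  rewrite leq_add // leq_eqVlt; apply/orP; left; apply/eqP; apply: eq_bigr => j ji.
  by rewrite eF.
have := nowin_count fF eu ex ux nw; have := dfree_ge F u; have := dfree_ge F x.
have := big i u eu; have := big i x ex; have := cov_le1 eu; have := cov_le1 ex.
clear; lia.
Qed.

End Augment.

(** * Covering the intermediate vertices with two-colour exchanges *)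

Section Finish.

Variables (V : finType) (nu c k : nat) (G : rel V) (Bg Po Hi : {set V}).
Hypotheses (gG : simple_graph G) (cardV : #|V| = 2 * nu) (k3 : 2 < k) (kc : 3 * k <= 2 * c + 6).
Hypotheses (cardBg : nu <= #|Bg|)
  (degBg : forall v, v \in Bg -> nu + c <= deg G v)
  (degHi : forall v, v \in Hi -> nu + c + 1 < deg G v + k)
  (Bg_Po : forall v, v \in Bg -> v \notin Po) (Bg_Hi : forall v, v \in Bg -> v \notin Hi)
  (parts : forall v, [|| v \in Bg, v \in Po | v \in Hi]).
Implicit Types (F : 'I_k -> V -> V) (S : {set V}).

Lemma ufix_aug (f g : V -> V) u w S :
    (forall v, (g v == v) = [&& f v == v, v != u & v != w]) ->
    f u = u -> f w = w -> u != w ->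
  ufix g S + (u \in S) + (w \in S) = ufix f S.
Proof.
move=> gE eu ew uw; rewrite -(sum_in_eq S u) -(sum_in_eq S w) -!big_split.
apply: eq_bigr => v _ /=; rewrite gE.
have [->|vu] := eqVneq v u; first by rewrite eu eqxx (negPf uw).
have [->|vw] := eqVneq v w; first by rewrite ew eqxx.
by rewrite !andbT !addn0.
Qed.

Lemma ufix_move (f g : V -> V) u b S :
    (forall v, (g v == v) = (v == b) || ((f v == v) && (v != u))) ->
    f u = u -> f b != b ->
  ufix g S + (u \in S) = ufix f S + (b \in S).
Proof.
move=> gE eu nb; rewrite -(sum_in_eq S u) -(sum_in_eq S b) -!big_split.
apply: eq_bigr => v _ /=; rewrite gE.
have bu : b != u by apply: contraNneq nb => ->; rewrite eu.
have [->|vb] := eqVneq v b; first by rewrite (negPf bu) (negPf nb).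
have [->|vu] := eqVneq v u; first by rewrite eu eqxx.
by rewrite andbT.
Qed.

(** The last clause provides, for each intermediate vertex missed by a colour, a big vertex missed
    by the same colour to augment with. *)
Definition admissible F := [/\ fam G F, forall i v, v \in Po -> F i v != v &
  forall i, ufix (F i) Hi <= ufix (F i) Bg].
Definition hi_uncovered F := \sum_i ufix (F i) Hi.

Lemma hi_uncovered_lt F F' i : (forall j, j != i -> ufix (F' j) Hi <= ufix (F j) Hi) ->
  ufix (F' i) Hi < ufix (F i) Hi -> hi_uncovered F' < hi_uncovered F.
Proof.
move=> le lt; rewrite /hi_uncovered (bigD1 i) //= [X in _ < X](bigD1 i) //= -addSn.
by rewrite leq_add //; apply: leq_sum.
Qed.

Lemma Hi_Bg v : v \in Hi -> (v \in Bg) = false.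
Proof. by move=> vH; apply/negP => /Bg_Hi; rewrite vH. Qed.

Lemma aug_progress F i u w : admissible F -> aug G F i u w -> u \in Hi -> F i u = u -> F i w = w ->
  u != w -> exists F', admissible F' /\ hi_uncovered F' < hi_uncovered F.
Proof.
move=> [fF FP FHB] [F' [fF' eF fixF]] uH eu ew uw; exists F'.
have e1 S := ufix_aug S fixF eu ew uw.
split; first split=> // [j v vP|j].
- have [->|ji] := eqVneq j i; last by rewrite eF ?FP.
  by rewrite fixF (negPf (FP i v vP)).
- have [->|ji] := eqVneq j i; last by rewrite eF.
  have := e1 Hi; have := e1 Bg; have := FHB i; rewrite uH (Hi_Bg uH).
  by case wB: (w \in Bg); [rewrite (negPf (Bg_Hi wB))|]; clear; lia.
apply: (@hi_uncovered_lt _ _ i) => [j ji|]; first by rewrite eF.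
by have := e1 Hi; rewrite uH; clear; lia.
Qed.

Lemma kc1 : k <= c.+1. Proof. by move: kc k3; clear; lia. Qed.

(* If no short augmentation joins u and x, the degree conditions are tight:
   every other vertex is a free neighbour of x, or the mate of a free neighbour of u. *)
Lemma tight_pair F i u x : fam G F -> u \in Hi -> x \in Bg -> F i u = u -> F i x = x ->
    (forall a, free G F u a -> F i a != a /\ ~~ free G F x (F i a)) ->
  [/\ forall w, w != u -> w != x -> ~~ free G F u (F i w) -> free G F x w,
      forall j, j != i -> F j x != x &
      dfree G F u + 2 <= nu].
Proof.
move=> fF uH xB eu ex nw.
have ux : u != x by apply: contraTneq uH => ->; exact: Bg_Hi.
have le1 := nowin_le1 gG fF eu ex ux nw.
have cnt := nowin_count gG fF eu ex ux nw.
have d1 := dfree_ge gG F u; have d2 := dfree_ge gG F x.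
have b1 := degHi uH; have b2 := degBg xB.
have c1 := cov_le1 eu; have c2 := cov_le1 ex; have kc' := kc1.
(* The free degrees of [u] and [x] sum to at least 2 nu + 2c + 4 - 3k, so [kc] leaves [nowin_count]
   no slack; a second colour missing [x] would add one more. The last bound follows since [x] alone
   has at least nu free edges. *)
split=> [w wu wx nfr|j ji|].
- apply: contraT => nfx.
  have : \sum_w (free G F u (F i w) + free G F x w + (w == u) + (w == x)) < #|V|.
    rewrite -sum1_card (bigD1 w) //= [X in _ < X](bigD1 w) //=.
    rewrite (negPf nfr) (negPf nfx) (negPf wu) (negPf wx) !add0n add1n ltnS.
    exact: leq_sum.
  rewrite !big_split /= -dfree_reindex // !sumT1 cardV -/(dfree G F x).
  by move: d1 d2 b1 b2 c1 c2 kc; clear; lia.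
- apply/negP => /eqP ejx; have := cov_le F x ji; rewrite ejx ex !eqxx.
  by move: cnt d1 d2 b1 b2 c1 kc; rewrite cardV; clear; lia.
- by move: cnt d2 b2 c2 kc'; rewrite cardV; clear; lia.
Qed.

(* An alternating F i / F j path through x, ending at a free neighbour a of u. *)
Definition chain F i j u x (P : {set V}) a :=
  [/\ x \in P, u \notin P, a \in P, a != x & free G F u a] /\
  [/\ forall v, v \in P -> F i v \in P, forall v, v \in P -> v != x -> F i v != v &
     forall v, v \in P -> v != a -> [/\ F j v \in P, F j v != a & F j v != v]].

(** Starting at [x] along colour [j], let y be the j-mate of the current end [a]. By [tight], either
    y is a free neighbour of [x] and the chain stops, or the i-mate of y is again a free neighbour
    of [u] and becomes the new end. The chain also stops if [j] misses [a]; since [P] grows, it does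
    stop. *)
Lemma kempe_chain F i j u x : fam G F -> j != i -> F i u = u -> F i x = x ->
    u != x -> F j x != x -> F j x != u ->
    (forall a, free G F u a -> F i a != a /\ ~~ free G F x (F i a)) ->
    (forall w, w != u -> w != x -> ~~ free G F u (F i w) -> free G F x w) ->
  exists P a, chain F i j u x P a /\ (F j a != a -> F j a \notin P /\ free G F x (F j a)).
Proof.
move=> fF ji eu ex ux njx nju nw tight; have [invF _ _] := fF.
have step n P a : chain F i j u x P a -> #|V| < #|P| + n ->
    exists P a, chain F i j u x P a /\ (F j a != a -> F j a \notin P /\ free G F x (F j a)).
  elim: n P a => [|n IH] P a ch lt.
    by have := subset_leq_card (subsetT P); rewrite cardsT; move: lt; clear; lia.
  have [[xP uP aP ax fra] [Pi Pix Pj]] := ch.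
  have [eja|nja] := eqVneq (F j a) a; first by exists P, a; split; rewrite ?eja ?eqxx.
  have yP : F j a \notin P.
    by apply/negP => yP; have [_] := Pj _ yP nja; rewrite invF eqxx.
  have yu : F j a != u.
    apply/negP => /eqP e; have := freeN j fra; by rewrite -e invF eqxx.
  have yx : F j a != x by apply: contraNneq yP => ->.
  have [fr|nfr] := boolP (free G F u (F i (F j a))); last first.
    by exists P, a; split=> // _; split=> //; apply: tight.
  set y := F j a in nja yP yu yx fr; set a' := F i y in fr.
  have a'P : a' \notin P by apply/negP => /Pi; rewrite invF (negPf yP).
  have a'y : a' != y by have [] := nw _ fr; rewrite /a' invF eq_sym.
  have a'x : a' != x by apply: contraNneq a'P => ->.
  have ua' : u != a' := simple_neq gG (freeG fr).
  apply: (IH (a' |: (y |: P)) a'); last first.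
    rewrite !cardsU1 in_setU1 (negPf a'y) (negPf a'P) yP /=.
    by apply: leq_trans lt _; rewrite !add1n !addSn addnS; exact: leqnSn.
  split; split=> //.
  - by rewrite !in_setU1 xP !orbT.
  - by rewrite !in_setU1 (negPf ua') (eq_sym u y) (negPf yu).
  - by rewrite in_setU1 eqxx.
  - move=> v; rewrite !in_setU1 => /or3P[/eqP->|/eqP->|/Pi ->]; rewrite ?orbT //.
      by rewrite invF eqxx orbT.
    by rewrite eqxx.
  - move=> v; rewrite !in_setU1 => /or3P[/eqP->|/eqP->|vP]; last exact: Pix.
      by move=> _; rewrite invF eq_sym.
    by [].
  - move=> v; rewrite !in_setU1 => /or3P[/eqP->|/eqP->|vP] va'; first by rewrite eqxx in va'.
      rewrite {1 2 3}/y invF aP !orbT; split=> //; first by apply: contraNneq a'P => <-.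
      by rewrite eq_sym.
    have [->|va] := eqVneq v a; first by rewrite -/y eqxx orbT (eq_sym y).
    have [jP ja jv] := Pj v vP va; rewrite jP !orbT; split=> //.
    by apply: contraNneq a'P => <-.
set y := F j x in njx nju.
have nfxy : ~~ free G F x y by apply/negP => /(freeN j); rewrite eqxx.
have fra : free G F u (F i y).
  by apply: contraT => nfr; have := tight y nju njx nfr; rewrite (negPf nfxy).
have [nya _] := nw _ fra; rewrite invF in nya.
have ya : F i y != y by rewrite eq_sym.
have ax : F i y != x.
  by apply: contraNneq njx => e; rewrite -(invF i y) e ex.
apply: (step #|V|.+1 [set x; y; F i y] (F i y)); last by rewrite addnS ltnS leq_addl.
have ua := simple_neq gG (freeG fra).
split; split=> //.
- by rewrite !inE eqxx.
- by rewrite !inE !negb_or ux (eq_sym u y) nju ua.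
- by rewrite !inE eqxx !orbT.
- by move=> v; rewrite !inE => /orP[/orP[]|] /eqP->; rewrite ?ex ?invF eqxx ?orbT.
- move=> v; rewrite !inE => /orP[/orP[]|] /eqP-> //; first by rewrite eqxx.
  by move=> _; rewrite invF eq_sym.
- move=> v; rewrite !inE => /orP[/orP[]|] /eqP-> va; last by rewrite eqxx in va.
    by rewrite -/y eqxx orbT; split.
  by rewrite {1 2 3}/y invF eqxx; split=> //; rewrite eq_sym.
Qed.

(* Exchanging the colours i and j along the chain P lets u be matched to a in
   colour i and x to the old F j a in colour j. *)
Lemma kempe F i j u x : admissible F -> j != i -> u \in Hi -> x \in Bg -> F i u = u -> F i x = x ->
    F j x != u -> exists F', admissible F' /\ hi_uncovered F' < hi_uncovered F.
Proof.
move=> iF ji uH xB eu ex nju; have [fF FP FHB] := iF; have [invF FG dis] := fF.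
have ux : u != x by apply: contraTneq uH => ->; exact: Bg_Hi.
have [[w [au ew uw]]|nw] := augment gG fF eu ex ux; first exact: aug_progress iF au uH eu ew uw.
have [tight cov _] := tight_pair fF uH xB eu ex nw.
have njx := cov j ji.
have [P [a [[[xP uP aP ax fra] [Pi Pix Pj]] aw]]] := kempe_chain fF ji eu ex ux njx nju nw tight.
set w := F j a in aw.
have ua := simple_neq gG (freeG fra).
have wu : w != u.
  by apply/negP => /eqP e; have := freeN j fra; rewrite -e invF eqxx.
(* The two colours are swapped inside [P]; [fi] receives the edge ua and [fj] the edge xw. If
   [w == a], colour [j] missed [a] and now misses [x] instead. *)
pose fi v := if v == a then u else if v == u then a else if v \in P then F j v else F i v.
pose fj v := if v == x then (if w == a then x else w) else
  if v \in P then F i v else if v == w then x else F j v.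
have notPi v : v \notin P -> F i v \notin P by apply: contra => /Pi; rewrite invF.
have notPj v : v \notin P -> v != w -> F j v \notin P.
  move=> vP vw; apply: contra vP => jP; have [e|na] := eqVneq (F j v) a.
    by rewrite /w -e invF eqxx in vw.
  by have [] := Pj _ jP na; rewrite invF.
have wP : w != a -> w \notin P by case/aw.
have fra' : free G F a u by rewrite (free_sym gG _ _ fF).
have va v : v \notin P -> v != a by move=> vP; apply: contraNneq vP => ->.
have vx v : v \notin P -> v != x by move=> vP; apply: contraNneq vP => ->.
have vu v : v \in P -> v != u by move=> vP; apply: contraTneq vP => ->.
have fia : fi a = u by rewrite /fi eqxx.
have fiu : fi u = a by rewrite /fi (negPf ua) eqxx.
have fiP v : v \in P -> v != a -> fi v = F j v.
  by move=> vP nva; rewrite /fi (negPf nva) (negPf (vu v vP)) vP.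
have fiN v : v \notin P -> v != u -> fi v = F i v.
  by move=> vP nvu; rewrite /fi (negPf (va v vP)) (negPf nvu) (negPf vP).
have fjx : fj x = if w == a then x else w by rewrite /fj eqxx.
have fjP v : v \in P -> v != x -> fj v = F i v.
  by move=> vP nvx; rewrite /fj (negPf nvx) vP.
have fjw : w != a -> fj w = x.
  by move=> wa; have wN := wP wa; rewrite /fj (negPf (vx w wN)) (negPf wN) eqxx.
have fjN v : v \notin P -> v != w -> fj v = F j v.
  by move=> vP vw; rewrite /fj (negPf (vx v vP)) (negPf vP) (negPf vw).
have Fiu v : v != u -> F i v != u.
  by move=> nvu; apply: contraNneq nvu => e; rewrite -(invF i v) e eu.
have Fix v : v != x -> F i v != x.
  by move=> nvx; apply: contraNneq nvx => e; rewrite -(invF i v) e ex.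
have invi : involutive fi.
  move=> v; have [->|nva] := eqVneq v a; first by rewrite fia fiu.
  have [->|nvu] := eqVneq v u; first by rewrite fiu fia.
  have [vP|vP] := boolP (v \in P).
    by have [jP ja _] := Pj v vP nva; rewrite (fiP v) // fiP // invF.
  by rewrite (fiN v) // fiN ?notPi ?Fiu ?invF.
have wNa v : v \notin P -> v == w -> w != a.
  by move=> vP /eqP <-; exact: va.
have Fjw v : v \notin P -> F j v != w.
  by move=> vP; apply: contraNneq vP => e; rewrite -(invF j v) e invF.
have invj : involutive fj.
  move=> v; have [->|nvx] := eqVneq v x.
    by rewrite fjx; have [wa|wa] := eqVneq w a; [rewrite fjx wa eqxx|rewrite fjw].
  have [vP|vP] := boolP (v \in P).
    by rewrite (fjP v) // fjP ?Pi ?Fix ?invF.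
  have [vw|vw] := eqVneq v w; last by rewrite (fjN v) // fjN ?notPj ?Fjw ?invF.
  have wa : w != a by rewrite -vw va.
  by rewrite vw fjw // fjx (negPf wa).
have fiE v : fi v != v -> [\/ fi v = F i v, fi v = F j v | free G F v (fi v)].
  have [->|nva] := eqVneq v a; first by rewrite fia; constructor 3.
  have [->|nvu] := eqVneq v u; first by rewrite fiu; constructor 3.
  by move=> _; have [vP|vP] := boolP (v \in P); [rewrite fiP //; constructor 2|rewrite fiN //; constructor 1].
have fjE v : fj v != v -> [\/ fj v = F i v, fj v = F j v | free G F v (fj v)].
  have [->|nvx] := eqVneq v x.
    rewrite fjx; have [_|wa] := eqVneq w a; first by rewrite eqxx.
    by constructor 3; case/aw: wa.
  move=> _; have [vP|vP] := boolP (v \in P); first by rewrite fjP //; constructor 1.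
  have [vw|vw] := eqVneq v w; last by rewrite fjN //; constructor 2.
  have wa : w != a by rewrite -vw va.
  by rewrite vw fjw //; constructor 3; rewrite (free_sym gG _ _ fF); case/aw: wa.
have disij v : fi v = fj v -> fi v = v.
  have [->|nva] := eqVneq v a.
    by rewrite fia fjP // => e; rewrite -(invF i a) -e eu eqxx in ua.
  have [->|nvu] := eqVneq v u.
    rewrite fiu fjN 1?eq_sym // => e; have := freeN j fra; by rewrite -e eqxx.
  have [vP|vP] := boolP (v \in P).
    rewrite fiP //; have [jP ja jv] := Pj v vP nva.
    have [vEx|nvx] := eqVneq v x.
      rewrite vEx fjx; have [_ //|wa] := eqVneq w a.
      by move=> e; move: jP; rewrite vEx e (negPf (wP wa)).
    rewrite fjP // => e; apply/eqP; apply: contraT => ne.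
    by have := dis j i v e ne => ij; rewrite ij eqxx in ji.
  rewrite fiN //; have [vw|vw] := eqVneq v w.
    have wa : w != a by rewrite -vw va.
    by rewrite vw fjw // => e; move: (vx v vP); rewrite vw -(invF i w) e ex eqxx.
  rewrite fjN // => e; apply/eqP; apply: contraT => ne.
  by have := dis i j v e ne => ij; rewrite ij eqxx in ji.
pose F' l := if l == i then fi else if l == j then fj else F l.
have F'i : F' i = fi by rewrite /F' eqxx.
have F'j : F' j = fj by rewrite /F' (negPf ji) eqxx.
have F'N l : l != i -> l != j -> F' l = F l by rewrite /F' => /negPf -> /negPf ->.
have old l v g : l != i -> l != j -> F l v != v ->
    [\/ g = F i v, g = F j v | free G F v g] -> F l v != g.
  move=> li lj ne [->|->|/freeN//]; apply/negP => /eqP e; have := dis _ _ v e ne => E.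
    by rewrite E eqxx in li.
  by rewrite E eqxx in lj.
have fF' : fam G F'.
  split=> [l|l v|l m v].
  - by rewrite /F'; case: ifP => // _; case: ifP.
  - rewrite /F'; case: ifP => [_ ne|_].
      by case: (fiE v ne) => [e|e|/freeG//]; rewrite e; apply: FG; rewrite -e.
    case: ifP => [_ ne|_]; last exact: FG.
    by case: (fjE v ne) => [e|e|/freeG//]; rewrite e; apply: FG; rewrite -e.
  - have [->|li] := eqVneq l i; have [->|mi] := eqVneq m i; rewrite // ?F'i.
    + have [->|mj] := eqVneq m j; first by rewrite F'j => /disij ->; rewrite eqxx.
      rewrite F'N // => e ne; have ne' : F m v != v by rewrite -e.
      by have := old m v _ mi mj ne' (fiE v ne); rewrite e eqxx.
    + have [->|lj] := eqVneq l j; first by rewrite F'j => e; rewrite e (disij v (esym e)) eqxx.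
      rewrite F'N // => e ne; have ne' : fi v != v by rewrite -e.
      by have := old l v _ li lj ne (fiE v ne'); rewrite e eqxx.
    + have [->|lj] := eqVneq l j; have [->|mj] := eqVneq m j; rewrite // ?F'j.
      * rewrite F'N // => e ne; have ne' : F m v != v by rewrite -e.
        by have := old m v _ mi mj ne' (fjE v ne); rewrite e eqxx.
      * rewrite F'N // => e ne; have ne' : fj v != v by rewrite -e.
        by have := old l v _ li lj ne (fjE v ne'); rewrite e eqxx.
      * by rewrite !F'N //; exact: dis.
have fixi v : (fi v == v) = [&& F i v == v, v != u & v != x].
  have [->|nva] := eqVneq v a; first by rewrite fia (negPf ua) (negPf (Pix a aP ax)).
  have [->|nvu] := eqVneq v u; first by rewrite fiu (eq_sym a) (negPf ua) andbF.
  have [vP|vP] := boolP (v \in P); last by rewrite fiN // vx //= andbT.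
  rewrite fiP //; have [_ _ /negPf ->] := Pj v vP nva.
  by have [_|nvx] := eqVneq v x; rewrite ?andbF // (negPf (Pix v vP nvx)).
(* Colour [j] can only trade the gap at [a] for one at [x]; since [x] is big, no intermediate vertex
   is newly uncovered. *)
have fixj v : (fj v == v) + (w == a) * (v == a) = (F j v == v) + (w == a) * (v == x).
  have [->|nvx] := eqVneq v x.
    rewrite fjx (eq_sym x) (negPf ax) (negPf njx) muln0 muln1 addn0.
    have [_|wa] := eqVneq w a; first by rewrite eqxx.
    by rewrite (negPf (vx w (wP wa))).
  rewrite muln0 addn0; have [vP|vP] := boolP (v \in P).
    rewrite fjP // (negPf (Pix v vP nvx)) add0n.
    have [->|nva] := eqVneq v a; first by rewrite muln1.
    by rewrite muln0; have [_ _ /negPf ->] := Pj v vP nva.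
  rewrite (negPf (va v vP)) muln0 addn0; have [vw|vw] := eqVneq v w; last by rewrite fjN.
  have wa : w != a by rewrite -vw va.
  have wx := vx w (wP wa).
  by rewrite vw fjw // invF (eq_sym x) (negPf wx) (eq_sym a) (negPf wa).
have ei S := ufix_aug S fixi eu ex ux.
have ej S : ufix fj S + (w == a) * (a \in S) = ufix (F j) S + (w == a) * (x \in S).
  rewrite -!sum_in_eq !big_distrr -!big_split; apply: eq_bigr => v _; exact: fixj.
have xH : x \in Hi = false by apply/negP; apply/negP; exact: Bg_Hi.
have lej : ufix fj Hi <= ufix (F j) Hi by have := ej Hi; rewrite xH; clear; lia.
exists F'; split; first split=> // [l v vP|l].
- have [->|li] := eqVneq l i; first by rewrite F'i fixi (negPf (FP i v vP)).
  have [->|lj] := eqVneq l j; last by rewrite F'N // FP.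
  rewrite F'j; have := fixj v; rewrite (negPf (FP j v vP)).
  have -> : v == x = false by apply: contraTF vP => /eqP ->; exact: Bg_Po.
  by rewrite muln0; case: (fj v == v).
- have [->|li] := eqVneq l i.
    have := ei Hi; have := ei Bg; have := FHB i; rewrite F'i uH xB xH (Hi_Bg uH).
    by clear; lia.
  have [->|lj] := eqVneq l j; last by rewrite F'N // FHB.
  rewrite F'j; have := ej Bg; have := ej Hi; have := FHB j; rewrite xB xH.
  by case aB: (a \in Bg); [rewrite (negPf (Bg_Hi aB))|]; clear; lia.
apply: (@hi_uncovered_lt _ _ i) => [l li|].
  by have [->|lj] := eqVneq l j; [rewrite F'j|rewrite F'N].
by rewrite F'i; have := ei Hi; rewrite uH; clear; lia.
Qed.

(** Gaps can be relocated among big vertices: matching [x] to [w] releases the old mate of [w],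
    which is big too. *)
Lemma move_inv F i x w : admissible F -> x \in Bg -> F i x = x -> free G F x w -> F i w != w ->
    F i w \in Bg ->
  exists F', [/\ admissible F', hi_uncovered F' = hi_uncovered F, forall j, j != i -> F' j = F j &
    forall v, (F' i v == v) = (v == F i w) || ((F i v == v) && (v != x))].
Proof.
move=> [fF FP FHB] xB ex fr nw wB; have [invF _ _] := fF.
have [F' [fF' eF fixF _]] := aug_move gG fF ex nw fr; exists F'.
have nb : F i (F i w) != F i w by rewrite invF eq_sym.
have e1 S := ufix_move S fixF ex nb.
have eH : ufix (F' i) Hi = ufix (F i) Hi.
  by have := e1 Hi; rewrite (negPf (Bg_Hi xB)) (negPf (Bg_Hi wB)) !addn0.
have eB : ufix (F' i) Bg = ufix (F i) Bg.
  by have := e1 Bg; rewrite xB wB; clear; lia.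
split=> //; first split=> // [j v vP|j].
- have [->|ji] := eqVneq j i; last by rewrite eF ?FP.
  by rewrite fixF (negPf (FP i v vP)) orbF; apply: contraTneq vP => ->; exact: Bg_Po.
- by have [->|ji] := eqVneq j i; [rewrite eH eB|rewrite eF].
- by apply: eq_bigr => j _; have [->|ji] := eqVneq j i; [exact: eH|rewrite eF].
Qed.

(** [kempe] needs a missed big vertex that is not the j-mate of [u]. As [u] has at most nu - 2 free
    edges, some big [b] avoids both its free neighbours and its j-mate. If [b] is covered, tightness
    makes its mate a free neighbour of [x], and the gap moves from [x] to [b]. *)
Lemma cover_hi F i u : admissible F -> u \in Hi -> F i u = u -> exists F', admissible F' /\ hi_uncovered F' < hi_uncovered F.
Proof.
move=> iF uH eu; have [fF FP FHB] := iF; have [invF FG dis] := fF.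
have [x xB ex] : exists2 x, x \in Bg & F i x = x.
  have : 0 < ufix (F i) Bg.
    apply: leq_trans (FHB i); apply: leq_trans (sum_pred1_le (P := mem Hi) _ uH).
    by rewrite eu eqxx.
  by case/sum_nat_gt0 => x xB; rewrite lt0b => /eqP; exists x.
have ux : u != x by apply: contraTneq uH => ->; exact: Bg_Hi.
have [[w [au ew uw]]|nw] := augment gG fF eu ex ux; first exact: aug_progress iF au uH eu ew uw.
have [tight cov cu] := tight_pair fF uH xB eu ex nw.
have [j ji] : exists j, j != i.
  have : 0 < #|[set~ i]| by rewrite cardsC1 card_ord; move: k3; clear; lia.
  by case/card_gt0P => j; rewrite !inE; exists j.
have [b [bB nub njb]] : exists b, [/\ b \in Bg, ~~ free G F u b & F j b != u].
  have [/existsP[b /and3P[]]|] := boolP [exists b, [&& b \in Bg, ~~ free G F u b & F j b != u]].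
    by exists b.
  rewrite negb_exists => /forallP no.
  have : \sum_b (b \in Bg) <= dfree G F u + \sum_b (b == F j u).
    rewrite -big_split; apply: leq_sum => b _ /=; have := no b.
    case: (b \in Bg) => //; case: (free G F u b) => //=; rewrite negbK => /eqP <-.
    by rewrite invF eqxx.
  rewrite sumT1 -big_mkcond sum1_card; move: cu cardBg; clear; lia.
have [eb|nb] := eqVneq (F i b) b; first exact: kempe iF ji uH bB eu eb njb.
have frw : free G F x (F i b).
  apply: tight; last by rewrite invF.
  - by apply: contraTneq uH => e; rewrite -eu -e invF; exact: Bg_Hi.
  - by apply: contraNneq nb => e; rewrite -{2}(invF i b) e ex.
have nb' : F i (F i b) != F i b by rewrite invF eq_sym.
have bB' : F i (F i b) \in Bg by rewrite invF.
have [F' [iF' eM eF fixF]] := move_inv iF xB ex frw nb' bB'.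
rewrite -eM; apply: (@kempe F' i j u b) => //; last by rewrite eF.
- by apply/eqP; rewrite fixF eu eqxx ux orbT.
- by apply/eqP; rewrite fixF invF eqxx.
Qed.

Lemma complete_family F : admissible F -> exists F', fam G F' /\ forall i v, F' i v != v.
Proof.
have [n] := ubnP (hi_uncovered F); elim: n F => // n IH F lt iF.
have [/existsP[i /existsP[u /andP[uH /eqP eu]]]|no] :=
    boolP [exists i, [exists u, (u \in Hi) && (F i u == u)]].
  have [F' [iF' lt']] := cover_hi iF uH eu.
  by apply: (IH F') => //; apply: leq_trans lt' _; rewrite -ltnS.
have [fF FP _] := iF; apply: (perfect_family gG _ fF) => [|i v ev].
  by rewrite cardV mul2n odd_double.
have vB : v \in Bg.
  have := parts v; case/or3P => // [vP|vH]; first by have := FP i v vP; rewrite ev eqxx.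
  case/negP: no; apply/existsP; exists i; apply/existsP; exists v.
  by rewrite vH ev eqxx.
by have := degBg vB; have := kc1; rewrite cardV; clear; lia.
Qed.

End Finish.

(** * Packings *)

Section Packing.

Variables (V : finType).
Implicit Types (G H : rel V) (dg : V -> nat).

Definition packing k dg := exists G (F : 'I_k -> V -> V),
  [/\ simple_graph G, forall v, deg G v = dg v, fam G F & forall i v, F i v != v].

Lemma packing_high nu c k dg G0 H0 :
    #|V| = 2 * nu -> 2 < k -> 3 * k <= 2 * c + 6 -> nu <= #|Bg nu c dg| ->
    simple_graph G0 -> (forall v, deg G0 v = dg v) ->
    simple_graph H0 -> (forall v, deg H0 v + k = dg v) -> packing k dg.
Proof.
move=> cV k3 kc cB gG0 dG0 gH0 dH0; have k2 := ltnW k3; have kc' := kc1 k3 kc.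
have [G [J [gG dG JP Jr Jc]]] := exists_full_flow cV k2 kc' cB (or_introl (erefl (@set0 V))) gG0 dG0 gH0 dH0.
set L := Lf nu c k dg in JP; set R := Rt nu c k dg set0 in JP Jc.
have RE : R = Po nu c k dg by rewrite /R /Rt setU0.
have LR v : v \in L -> v \in R -> v \in @set0 V.
  by rewrite RE in_setC => /negPf ->.
have [|F [fF cov mate]] := flow_fam gG JP Jr Jc LR; first by rewrite cards0.
rewrite RE in cov mate.
have BP v : v \in Bg nu c dg -> v \notin Po nu c k dg.
  by move=> vB; apply/negP => vP; exact: (Po_Bg k2 vP vB).
have HB v : v \in Bg nu c dg -> v \notin Hi nu c k dg.
  by move=> vB; rewrite in_setC in_setU vB.
have parts v : [|| v \in Bg nu c dg, v \in Po nu c k dg | v \in Hi nu c k dg].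
  by rewrite in_setC in_setU; case: (v \in Bg nu c dg); case: (v \in Po nu c k dg).
have [|||F' [fF' pF']] := @complete_family _ nu c k G _ _ _ gG cV k3 kc cB _ _ BP HB parts F.
- by move=> v; rewrite inE dG.
- by move=> v; rewrite in_setC in_setU negb_or => /andP[_]; rewrite inE dG; clear; lia.
(* Covered big vertices inject into [Po] through their mates, so at least |Bg| - |Po| big ones are
   missed; |Hi| = 2 nu - |Bg| - |Po| is no larger because |Bg| >= nu. *)
- split=> // i; have [inv _ _] := fF.
  pose C := [set v in Bg nu c dg | F i v != v].
  have cC : #|C| <= #|Po nu c k dg|.
    rewrite -(card_imset C (inv_inj (inv i))); apply/subset_leq_card/subsetP => w.
    case/imsetP => v; rewrite inE => /andP[vB nv] ->.
    exact: mate (BP v vB) nv.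
  have e1 : ufix (F i) (Bg nu c dg) + #|C| = #|Bg nu c dg|.
    rewrite -!sum1_card (eq_bigl (fun v => (v \in Bg nu c dg) && (F i v != v))); last by move=> v; rewrite inE.
    rewrite big_mkcondr -big_split; apply: eq_bigr => v _ /=.
    by case: (F i v == v).
  have e2 : ufix (F i) (Hi nu c k dg) <= #|Hi nu c k dg|.
    by rewrite -sum1_card; apply: leq_sum => v _; case: (_ == _).
  have e3 : #|Bg nu c dg| + #|Po nu c k dg| + #|Hi nu c k dg| = 2 * nu.
    rewrite -cV -(cardsC (Bg nu c dg :|: Po nu c k dg)) cardsU.
    suff -> : Bg nu c dg :&: Po nu c k dg = set0 by rewrite cards0 subn0.
    apply/setP => v; rewrite in_setI in_set0; case vB: (v \in Bg _ _ _) => //=.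
    by apply/negbTE/BP.
  by move: cC e1 e2 e3 cB; clear; lia.
by exists G, F'.
Qed.

Definition compl G v w := (v != w) && ~~ G v w.

Lemma compl_simple G : simple_graph G -> simple_graph (compl G).
Proof.
move=> [sG _]; split=> [v w|v]; last by rewrite /compl eqxx.
by rewrite /compl eq_sym sG.
Qed.

Lemma compl_deg G v : simple_graph G -> deg (compl G) v + deg G v + 1 = #|V|.
Proof.
move=> [_ iG]; rewrite -(sumT1 v) -sum1_card !deg_sum -!big_split; apply: eq_bigr => w _ /=.
by rewrite /compl eq_sym; case: eqP => [->|_]; [rewrite iG|case: (G v w)].
Qed.

Lemma fam_deg k G (F : 'I_k -> V -> V) v : fam G F -> (forall i v, F i v != v) ->
  deg (fun v w => [exists i, F i v == w]) v = k.
Proof.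
move=> [_ _ dis] pF; rewrite deg_sum.
have inj : injective (F ^~ v) by move=> i j /dis ->.
transitivity #|[set F i v | i : 'I_k]|; last by rewrite card_imset // card_ord.
rewrite -sum1_card [RHS]big_mkcond; apply: eq_bigr => w _ /=.
case: existsP => [[i /eqP <-]|no]; first by rewrite imset_f.
by case: imsetP => // -[i _ e]; case: no; exists i; rewrite e.
Qed.

(* Complementing G and deleting the matchings from it exchange their roles. *)
Lemma packing_dual k dg dg' : (forall v, dg v + dg' v + 1 = #|V| + k) ->
  packing k dg' -> packing k dg.
Proof.
move=> dd [G' [F [[sG' iG'] dG' fF pF]]]; have [inv FG dis] := fF.
pose K v w := [exists i, F i v == w].
pose H v w := G' v w && ~~ K v w.
have sK : symmetric K.
  by move=> v w; apply: eq_existsb => i; apply/eqP/eqP => <-; rewrite inv.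
have gH : simple_graph H.
  by split=> [v w|v]; rewrite /H ?iG' // sG' sK.
exists (compl H), F; split=> //; first exact: compl_simple.
- move=> v; have := compl_deg v gH; have := fam_deg v fF pF; have := dd v; rewrite -dG'.
  have : deg G' v = deg H v + deg K v.
    rewrite !deg_sum -big_split; apply: eq_bigr => w _; rewrite /H /=.
    case Kvw: (K v w); last by rewrite andbT addn0.
    by case/existsP: Kvw => i /eqP <-; rewrite FG.
  by rewrite -/K; clear; lia.
- split=> // i v nv; rewrite /compl eq_sym nv /H negb_and negbK.
  by apply/orP; right; apply/existsP; exists i.
Qed.

(** In the complement of H the threshold is nu + k: big there means [dg v < nu], poor means
    [dg v >= nu + k - 2]. The vertices of [Bg nu c dg] are thus poor; they number at least m - 1
    among the at most m vertices with [dg v >= nu], which leaves at most one intermediate vertex. *)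
Lemma packing_low nu c m k dg G0 H0 :
    #|V| = 2 * nu -> 2 < k -> 3 * k <= 2 * c + 6 -> m <= nu ->
    m <= #|Bg nu c dg| + 1 -> #|[set v | m <= dg v]| <= m ->
    simple_graph G0 -> (forall v, deg G0 v = dg v) ->
    simple_graph H0 -> (forall v, deg H0 v + k = dg v) -> packing k dg.
Proof.
move=> cV k3 kc mnu mB cm gG0 dG0 gH0 dH0; have k2 := ltnW k3; have kc' := kc1 k3 kc.
pose dg' v := 2 * nu + k - dg v - 1.
have dlt v : dg v < 2 * nu by rewrite -dG0 -cV; have := compl_deg v gG0; clear; lia.
apply: (@packing_dual _ _ dg'); first by move=> v; have := dlt v; rewrite /dg' cV; clear; lia.
have cge : #|[set v | nu <= dg v]| <= m.
  apply: leq_trans cm; apply/subset_leq_card/subsetP => v; rewrite !inE; exact: leq_trans.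
have cB : nu <= #|Bg nu k dg'|.
  have : #|~: [set v | nu <= dg v]| <= #|Bg nu k dg'|.
    apply/subset_leq_card/subsetP => v; rewrite !inE /dg'; have := dlt v; clear; lia.
  have := cardsC [set v | nu <= dg v]; rewrite cV; move: cge mnu; clear; lia.
have cH : #|Hi nu k k dg'| <= 1.
  have : #|Hi nu k k dg'| + #|Bg nu c dg| <= #|[set v | nu <= dg v]|.
    have dj : Hi nu k k dg' :&: Bg nu c dg = set0.
      apply/setP => v; rewrite !inE /dg'; have := dlt v; move: kc'; clear; lia.
    have <- : #|Hi nu k k dg' :|: Bg nu c dg| = #|Hi nu k k dg'| + #|Bg nu c dg|.
      by rewrite cardsU dj cards0 subn0.
    apply/subset_leq_card/subsetP => v; rewrite !inE /dg'; have := dlt v; clear; lia.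
  move: cge mB; clear; lia.
have kk : k <= k.+1 by [].
have HY : Hi nu k k dg' = set0 \/ [/\ Hi nu k k dg' = Hi nu k k dg', #|Hi nu k k dg'| <= 1 & k <= k].
  by right.
have [||||G [J [gG dG JP Jr Jc]]] := @exists_full_flow _ nu k k dg' (Hi nu k k dg') cV k2 kk cB HY (compl H0) (compl G0).
- exact: compl_simple.
- by move=> v; have := compl_deg v gH0; have := dH0 v; have := dlt v; rewrite cV /dg'; clear; lia.
- exact: compl_simple.
- by move=> v; have := compl_deg v gG0; have := dG0 v; have := dlt v; rewrite cV /dg'; clear; lia.
have LR v : v \in Lf nu k k dg' -> v \in Rt nu k k dg' (Hi nu k k dg') -> v \in Hi nu k k dg'.
  by rewrite in_setC in_setU => /negPf ->.
have [F [fF cov mate]] := flow_fam gG JP Jr Jc LR cH.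
have evV : ~~ odd #|V| by rewrite cV mul2n odd_double.
have [|F' [fF' pF']] := perfect_family gG evV fF; last by exists G, F'.
(* Poor and intermediate vertices are all covered, so a missed vertex has degree at least nu + k. *)
move=> i v ev; have : v \in Bg nu k dg'.
  have vR : v \notin Rt nu k k dg' (Hi nu k k dg') by apply/negP => /(cov i); rewrite ev eqxx.
  move: vR; rewrite in_setU negb_or => /andP[vP].
  by rewrite in_setC negbK in_setU (negPf vP) orbF.
by rewrite inE dG cV; clear; lia.
Qed.

End Packing.

(** * The cases k = 1 and k = 2 *)

Section SmallK.

Variable V : finType.
Implicit Types (G H K : rel V) (dg : V -> nat) (s : V -> V).

Lemma one_regular K : (forall v, deg K v = 1) -> symmetric K ->
  exists t : V -> V, [/\ involutive t, forall v, K v (t v) & forall v w, K v w -> w = t v].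
Proof.
move=> dK sK; have ex v : exists w, K v w.
  have : 0 < \sum_w K v w by rewrite -deg_sum dK.
  by case/sum_nat_gt0 => w _; rewrite lt0b; exists w.
pose t v := xchoose (ex v); have tK v : K v (t v) := xchooseP (ex v).
have uniq v w : K v w -> w = t v.
  move=> Kvw; apply/eqP; apply: contraT => ne.
  have := sum_nat_le2 (fun w => K v w : nat) ne; rewrite -deg_sum dK Kvw tK.
  by [].
by exists t; split=> // v; apply/esym/uniq; rewrite sK.
Qed.

Lemma packing1 dg G0 H0 : simple_graph G0 -> (forall v, deg G0 v = dg v) ->
  simple_graph H0 -> (forall v, deg H0 v + 1 = dg v) -> packing 1 dg.
Proof.
move=> gG0 dG0 gH0 dH0; have dGH v : deg G0 v = deg H0 v + 1 by rewrite dG0.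
have [G [H [gG gH dG dH HG]]] := kundu gG0 gH0 dGH.
pose K v w := G v w && ~~ H v w; have [sG iG] := gG; have [sH iH] := gH.
have dK v : deg K v = 1.
  have := deg_diff G H v; rewrite dG dH dGH -(deg_sum K) big1; first by clear; lia.
  by move=> w _; case Hvw: (H v w); rewrite /= ?HG.
have sK : symmetric K by move=> v w; rewrite /K sG sH.
have [t [invt tK _]] := one_regular dK sK.
exists G, (fun _ => t); split=> // [v||i v].
- by rewrite dG dG0.
- split=> // [i v _|i j v _ _]; first by case/andP: (tK v).
  by rewrite !ord1.
- by rewrite eq_sym; apply: simple_neq gG _; case/andP: (tK v).
Qed.

(** Takes every second edge of a path with an even number of vertices. *)
Lemma pair_path s z n : uniq (traject s z n) -> ~~ odd n ->
  exists g : V -> V, forall v, v \in traject s z n ->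
    [/\ g v \in traject s z n, g (g v) = v & g v = s v \/ s (g v) = v].
Proof.
have [m] := ubnP n; elim: m n z => // m IH [|[|n]] z ltn //=; first by exists id.
rewrite negbK => /and3P[zn szn un] od.
have [|g gP] := IH n _ _ un od; first by move: ltn; clear; lia.
have zs : s z != z by apply: contraNneq zn => e; rewrite inE {1}e eqxx.
exists (fun v => if v == z then s z else if v == s z then z else g v) => v.
rewrite !in_cons => /or3P[/eqP->|/eqP->|vn].
- by rewrite /= !eqxx orbT (negPf zs); split=> //; left.
- by rewrite /= !eqxx (negPf zs) eqxx; split=> //; right.
- have [gn ggv gs] := gP v vn.
  have nz w : w \in traject s (s (s z)) n -> (w == z = false) /\ (w == s z = false).
    move=> wn; split; last by apply: contraNF szn => /eqP e; rewrite e in wn.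
    by apply: contraNF zn => /eqP e; rewrite e in wn; rewrite in_cons wn orbT.
  have [e1 e2] := nz _ vn; have [e3 e4] := nz _ gn.
  by rewrite /= e1 e2 e3 e4 gn !orbT.
Qed.

Definition orbs s v := [set w in orbit s v].

Lemma orbs_closed s v w : injective s -> (s w \in orbs s v) = (w \in orbs s v).
Proof.
move=> inj; rewrite !inE -!fconnect_orbit; apply/idP/idP => c.
  by apply: connect_trans c _; rewrite fconnect_sym // fconnect1.
by apply: connect_trans c _; exact: fconnect1.
Qed.

Lemma card_orbs s v : #|orbs s v| = order s v.
Proof. by rewrite cardsE (card_uniqP (orbit_uniq s v)) size_orbit. Qed.

Lemma orbs_eq s v w : injective s -> w \in orbs s v -> orbs s w = orbs s v.
Proof.
move=> inj; rewrite inE -fconnect_orbit => c; apply/setP => z; rewrite !inE -!fconnect_orbit.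
by apply/esym; apply: same_connect c z; exact: fconnect_sym.
Qed.

Lemma even_orbits s (B : {set V}) : injective s -> (forall v, v \in B -> s v \in B) ->
  (forall v, v \in B -> ~~ odd (order s v)) -> ~~ odd #|B|.
Proof.
move=> inj; have [n] := ubnP #|B|; elim: n B => // n IH B ltB clB evB.
have [->|[v vB]] := set_0Vmem B; first by rewrite cards0.
pose O := orbs s v; have clO w := orbs_closed v w inj.
have OB : O \subset B.
  apply/subsetP => w; rewrite inE => /trajectP[i _ ->]; elim: i => //= i; exact: clB.
have cO := card_orbs s v.
have cB : #|B| = order s v + #|B :\: O| by rewrite -cO -/O -(cardsID O B) (setIidPr OB).
have ogt : 0 < order s v by exact: order_gt0.
rewrite cB oddD (negPf (evB v vB)) /=; apply: IH.
- by move: ltB; rewrite cB; move: ogt; clear; lia.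
- by move=> w; rewrite !in_setD clO => /andP[-> /clB].
- by move=> w; rewrite in_setD => /andP[_ /evB].
Qed.

(** The measure of the descent; at zero, [s] is an involution and hence a matching. *)
Definition nonpairs s := #|[set v | s (s v) != v]|.

Lemma rearrange s (S : {set V}) (g : V -> V) x : injective s ->
    (forall v, (s v \in S) = (v \in S)) -> (forall v, v \in S -> g v \in S /\ g (g v) = v) ->
    x \in S -> s (s x) != x ->
  injective (fun v => if v \in S then g v else s v) /\
  nonpairs (fun v => if v \in S then g v else s v) < nonpairs s.
Proof.
move=> inj clS gS xS nx; split=> [v w /=|].
  have [vS|vS] := boolP (v \in S); have [wS|wS] := boolP (w \in S) => e.
  - by rewrite -(gS v vS).2 e (gS w wS).2.
  - by have [] := gS v vS; rewrite e clS (negPf wS).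
  - by have [] := gS w wS; rewrite -e clS (negPf vS).
  - exact: inj.
apply: proper_card; apply/properP; split; last first.
  by exists x; rewrite inE // xS; have [-> ->] := gS x xS; rewrite eqxx.
apply/subsetP => v; rewrite !inE; have [vS|vS] := boolP (v \in S).
  by have [-> ->] := gS v vS; rewrite eqxx.
by rewrite clS (negPf vS).
Qed.

Definition minus G H : rel V := fun v w => G v w && ~~ H v w.

(* If H x y = H x' y', a 4-switch in H or in G puts the edges xy and x'y' in
   place of xx' and yy' in the difference G \ H. *)
Lemma merge_switch G H x y x' y' :
    simple_graph G -> simple_graph H -> subrel H G ->
    minus G H x x' -> minus G H y y' -> ~~ minus G H x y -> ~~ minus G H x' y' ->
    x != y -> x' != y' -> x != y' -> x' != y -> H x y = H x' y' ->
  exists G' H', [/\ [/\ simple_graph G', simple_graph H' & subrel H' G'],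
    forall v, deg G' v = deg G v, forall v, deg H' v = deg H v, minus G' H' x y &
    forall v w, v != x -> v != y -> w != x -> w != y -> minus G H v w -> minus G' H' v w].
Proof.
move=> gG gH HG /andP[Gx Hx] /andP[Gy Hy] nK nK' xy xy' nxy nxy' hE.
have [sG iG] := gG; have [sH iH] := gH.
have xx := simple_neq gG Gx; have yy := simple_neq gG Gy.
have [Hxy|nHxy] := boolP (H x y).
  have Hxy' : H x' y' by rewrite -hE.
  have ok : valid_sw H [:: (x, y); (y', x')] [:: (y, y'); (x', x)].
    apply: sw4_valid; rewrite // 1?eq_sym // 1?sH //.
  exists G, (switch H [:: (x, y); (y', x')] [:: (y, y'); (x', x)]); split=> //.
  - split=> //; first exact: sw_valid_simple.
    move=> v w /orP[/andP[/HG //]|]; apply: inE2_sub => //=.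
    by rewrite Gy [G x' x]sG Gx.
  - by move=> v; exact: sw4_deg gH ok.
  - rewrite /minus HG // /switch /= /samep !eqxx /= andbF /= orbF.
    by rewrite (negPf xy) (negPf nxy) (negPf xx) (eq_sym y x') (negPf nxy').
  - move=> v w vx vy wx wy /andP[Gvw nHvw]; rewrite /minus Gvw /switch (negPf nHvw) /= /samep.
    by rewrite (negPf vx) (negPf vy) (negPf wx) (negPf wy) !andbF.
have nHxy' : ~~ H x' y' by rewrite -hE.
have nG : ~~ G x y by move: nK; rewrite /minus nHxy andbT.
have nG' : ~~ G x' y' by move: nK'; rewrite /minus nHxy' andbT.
have ok : valid_sw G [:: (x, x'); (y', y)] [:: (x', y'); (y, x)].
  by apply: sw4_valid; rewrite // 1?eq_sym // sG.
exists (switch G [:: (x, x'); (y', y)] [:: (x', y'); (y, x)]), H; split=> //.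
- split=> //; first exact: sw_valid_simple.
  move=> v w Hvw; apply: sw_keep; first exact: HG.
  by apply: contraL Hvw; apply: inE2_subN => //=; rewrite Hx [H y' y]sH Hy.
- by move=> v; exact: sw4_deg gG ok.
- by rewrite /minus nHxy andbT; apply: sw_new; rewrite /= /samep !eqxx !orbT.
- move=> v w vx vy wx wy /andP[Gvw nHvw]; rewrite /minus nHvw andbT; apply: sw_keep => //.
  by rewrite /= /samep (negPf vx) (negPf vy) (negPf wx) (negPf wy) !andbF.
Qed.

Section Merge.

Variables (G H : rel V) (s : V -> V).
Hypotheses (gG : simple_graph G) (gH : simple_graph H) (HG : subrel H G)
  (dGH : forall v, deg G v = deg H v + 2) (inj : injective s)
  (sK : forall v, minus G H v (s v)).

Lemma minus_sym : symmetric (minus G H).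
Proof. by move=> v w; rewrite /minus; case: gG => -> _; case: gH => -> _. Qed.

Lemma minus_deg v : deg (minus G H) v = 2.
Proof.
have := deg_diff G H v; rewrite dGH -(deg_sum (minus G H)) big1; first by clear; lia.
by move=> w _; case Hvw: (H v w); rewrite /= ?HG.
Qed.

(** In an orbit of length at least three, the image and the preimage of a vertex under [s] are
    distinct and exhaust its degree 2, so the orbit is a whole component of the difference. *)
Lemma minus_orbs x w z : s (s x) != x -> w \in orbs s x -> minus G H w z -> z \in orbs s x.
Proof.
move=> nx wO Kwz.
have nw : s (s w) != w.
  move: wO; rewrite inE => /trajectP[i _ ->]; rewrite -!iterS -addn2 iterD /=.
  by apply: contra nx => /eqP e; apply/eqP; elim: i e => [|i IH] //= /inj.
apply: contraT => zO; have sp := f_finv inj w.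
have pO : finv s w \in orbs s x by rewrite -(orbs_closed x _ inj) sp.
have sO : s w \in orbs s x by rewrite orbs_closed.
have : \sum_v (v == s w) + \sum_v (v == finv s w) + \sum_v (v == z) <= deg (minus G H) w.
  rewrite deg_sum -!big_split; apply: leq_sum => v _ /=.
  have [->|vs] := eqVneq v (s w).
    rewrite sK; have -> : (s w == z) = false by apply: contraNF zO => /eqP <-.
    by have -> : (s w == finv s w) = false by apply: contraNF nw => /eqP ->; rewrite sp.
  have [->|vp] := eqVneq v (finv s w).
    have -> : (finv s w == z) = false by apply: contraNF zO => /eqP <-.
    by rewrite minus_sym; have := sK (finv s w); rewrite sp => ->.
  by have [->|] := eqVneq v z; rewrite ?Kwz.
by rewrite !sumT1 minus_deg.
Qed.

(* Otherwise s x s exchanges the pairs in H with the pairs outside H, although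
   their total number is odd. *)
Lemma good_pair (O1 O2 : {set V}) : odd #|O1| -> odd #|O2| ->
    (forall v, v \in O1 -> s v \in O1) -> (forall v, v \in O2 -> s v \in O2) ->
  exists x y, [/\ x \in O1, y \in O2 & H x y = H (s x) (s y)].
Proof.
move=> od1 od2 cl1 cl2.
have [/existsP[x /existsP[y /and3P[xO yO /eqP e]]]|no] :=
  boolP [exists x, [exists y, [&& x \in O1, y \in O2 & H x y == H (s x) (s y)]]].
  by exists x, y.
have nE x y : x \in O1 -> y \in O2 -> H (s x) (s y) = ~~ H x y.
  move=> xO yO; move: no; rewrite negb_exists => /forallP/(_ x).
  rewrite negb_exists => /forallP/(_ y); rewrite xO yO /=.
  by case: (H x y); case: (H (s x) (s y)).
pose h := [set p : V * V | H p.1 p.2]; pose X := setX O1 O2.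
pose phi (p : V * V) := (s p.1, s p.2).
have iphi : injective phi by move=> [a b] [a' b'] [/inj -> /inj ->].
have l1 : #|X :&: h| <= #|X :\: h|.
  rewrite -(card_imset _ iphi); apply/subset_leq_card/subsetP => p /imsetP[[a b]].
  rewrite !inE /= => /andP[/andP[aO bO] Hab] -> /=.
  by rewrite cl1 // cl2 // nE // Hab.
have l2 : #|X :\: h| <= #|X :&: h|.
  rewrite -(card_imset _ iphi); apply/subset_leq_card/subsetP => p /imsetP[[a b]].
  rewrite !inE /= => /andP[Hab /andP[aO bO]] -> /=.
  by rewrite cl1 // cl2 // nE // Hab.
have cX : odd #|X| by rewrite cardsX oddM od1.
have e : #|X :&: h| = #|X :\: h| by apply/eqP; rewrite eqn_leq l1 l2.
by move: cX; rewrite -(cardsID h X) e addnn odd_double.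
Qed.

(** An even cycle is matched along itself. An odd one has an odd companion because |V| is even;
    [merge_switch] creates an edge ab between the two, and removing a and b leaves two paths with an
    even number of vertices each. *)
Lemma pair_orbits x : ~~ odd #|V| -> s (s x) != x ->
  exists G' H' s', [/\ [/\ simple_graph G', simple_graph H' & subrel H' G'],
    forall v, deg G' v = deg G v, forall v, deg H' v = deg H v, injective s' &
    (forall v, minus G' H' v (s' v)) /\ nonpairs s' < nonpairs s].
Proof.
move=> evV nx; have xO : x \in orbs s x by rewrite inE in_orbit.
have [odx|evx] := boolP (odd (order s x)); last first.
  have [g gP] := pair_path (orbit_uniq s x) evx.
  have gP' v : v \in orbs s x -> [/\ g v \in orbs s x, g (g v) = v & g v = s v \/ s (g v) = v].
    by rewrite !inE; exact: gP.
  have clS v := orbs_closed x v inj.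
  have [|injs lts] := rearrange (g := g) inj clS _ xO nx; first by move=> v /gP'[].
  exists G, H, (fun v => if v \in orbs s x then g v else s v); do 2!split=> //.
  move=> v; case: ifP => // vO; have [_ _ [->//|e]] := gP' v vO.
  by rewrite minus_sym -{2}e.
have [y0 y0x ody] : exists2 y0, y0 \notin orbs s x & odd (order s y0).
  have [/existsP[y /andP[yx ody]]|no] := boolP [exists y, (y \notin orbs s x) && odd (order s y)].
    by exists y.
  have /negP[] : ~~ odd #|~: orbs s x|.
    apply: (even_orbits inj) => v; rewrite in_setC => vx.
      by rewrite in_setC (orbs_closed x v inj).
    by move: no; rewrite negb_exists => /forallP/(_ v); rewrite vx.
  by move: evV; rewrite -(cardsC (orbs s x)) oddD card_orbs odx /= negbK.
have [|||| a [b [aO bO hE]]] := @good_pair (orbs s x) (orbs s y0).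
- by rewrite card_orbs.
- by rewrite card_orbs.
- by move=> v; rewrite orbs_closed.
- by move=> v; rewrite orbs_closed.
have oa := orbs_eq inj aO; have ob := orbs_eq inj bO.
have dj v w : v \in orbs s x -> w \in orbs s y0 -> v != w.
  move=> vO wO; apply: contraNneq y0x => e; rewrite -e in wO.
  by rewrite -(orbs_eq inj vO) (orbs_eq inj wO) inE in_orbit.
have sa : s a \in orbs s x by rewrite orbs_closed.
have sb : s b \in orbs s y0 by rewrite orbs_closed.
have noK v w : v \in orbs s x -> w \in orbs s y0 -> ~~ minus G H v w.
  by move=> vO wO; apply/negP => /(minus_orbs nx vO) wx; have := dj w w wx wO; rewrite eqxx.
have [G' [H' [gGH dG' dH' Kab Kold]]] := merge_switch gG gH HG (sK a) (sK b)
  (noK _ _ aO bO) (noK _ _ sa sb) (dj _ _ aO bO) (dj _ _ sa sb) (dj _ _ aO sb) (dj _ _ sa bO) hE.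
have [gG' gH' HG'] := gGH.
have path v : odd (order s v) -> exists n, [/\ orbit s v = v :: traject s (s v) n,
    uniq (traject s (s v) n), v \notin traject s (s v) n & ~~ odd n].
  move=> od; exists (order s v).-1.
  have e : orbit s v = v :: traject s (s v) (order s v).-1.
    by rewrite /orbit -{1}(prednK (order_gt0 s v)).
  have := orbit_uniq s v; rewrite e /= => /andP[-> ->]; split=> //.
  by move: od; rewrite -{1}(prednK (order_gt0 s v)).
have oda : odd (order s a) by rewrite -card_orbs oa card_orbs.
have odb : odd (order s b) by rewrite -card_orbs ob card_orbs.
have [n1 [e1 u1 a1 o1]] := path a oda; have [n2 [e2 u2 b2 o2]] := path b odb.
have [g1 g1P] := pair_path u1 o1; have [g2 g2P] := pair_path u2 o2.
set T1 := traject s (s a) n1 in e1 u1 a1 g1P; set T2 := traject s (s b) n2 in e2 u2 b2 g2P.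
have O1 v : (v \in orbs s x) = (v == a) || (v \in T1) by rewrite -oa inE e1 in_cons.
have O2 v : (v \in orbs s y0) = (v == b) || (v \in T2) by rewrite -ob inE e2 in_cons.
have T1x v : v \in T1 -> v \in orbs s x by rewrite O1 => ->; rewrite orbT.
have T2y v : v \in T2 -> v \in orbs s y0 by rewrite O2 => ->; rewrite orbT.
have ab := dj a b aO bO.
have T1N v : v \in T1 -> v != a /\ v != b.
  by move=> vT; split; [apply: contraNneq a1 => <-|apply: dj => //; exact: T1x].
have T2N v : v \in T2 -> [/\ v != a, v != b & v \notin T1].
  move=> vT; split; first by rewrite eq_sym; apply: dj => //; exact: T2y.
    by apply: contraNneq b2 => <-.
  by apply/negP => vT1; have := dj v v (T1x v vT1) (T2y v vT); rewrite eqxx.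
pose g v := if v == a then b else if v == b then a else if v \in T1 then g1 v else g2 v.
have ga : g a = b by rewrite /g eqxx.
have gb : g b = a by rewrite /g eq_sym (negPf ab) eqxx.
have gT1 v : v \in T1 -> g v = g1 v.
  by move=> vT; have [/negPf va /negPf vb] := T1N v vT; rewrite /g va vb vT.
have gT2 v : v \in T2 -> g v = g2 v.
  by move=> vT; have [/negPf va /negPf vb /negPf vT1] := T2N v vT; rewrite /g va vb vT1.
pose S := orbs s x :|: orbs s y0.
have SP v : v \in S -> [\/ v = a, v = b, v \in T1 | v \in T2].
  rewrite in_setU O1 O2 => /orP[/orP[/eqP->|vT]|/orP[/eqP->|vT]].
  - by constructor 1.
  - by constructor 3.
  - by constructor 2.
  - by constructor 4.
have T1S v : v \in T1 -> v \in S by move=> vT; rewrite in_setU T1x.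
have T2S v : v \in T2 -> v \in S by move=> vT; rewrite in_setU T2y ?orbT.
have aS : a \in S by rewrite in_setU aO.
have bS : b \in S by rewrite in_setU bO orbT.
have gS v : v \in S -> g v \in S /\ g (g v) = v.
  case/SP => [->|->|vT|vT]; rewrite ?ga ?gb //.
    by have [gT ggv _] := g1P v vT; rewrite (gT1 v) // gT1 // T1S.
  by have [gT ggv _] := g2P v vT; rewrite (gT2 v) // gT2 // T2S.
have clS v : (s v \in S) = (v \in S) by rewrite !in_setU (orbs_closed x v inj) (orbs_closed y0 v inj).
have xS : x \in S by rewrite in_setU xO.
have [injs lts] := rearrange inj clS gS xS nx.
exists G', H', (fun v => if v \in S then g v else s v); do 2!split=> //.
have sKp (t : V -> V) v : t v = s v \/ s (t v) = v -> minus G H v (t v).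
  by case=> [->//|e]; rewrite minus_sym -{2}e.
have symK' v w : minus G' H' v w = minus G' H' w v.
  by rewrite /minus; case: gG' => -> _; case: gH' => -> _.
move=> v; case: ifP => [|vS].
  case/SP => [->|->|vT|vT]; rewrite ?ga ?gb //; first by rewrite symK'.
    have [gT _ gs] := g1P v vT; rewrite gT1 //.
    have [va vb] := T1N v vT; have [ga' gb'] := T1N _ gT.
    by apply: Kold => //; exact: sKp.
  have [gT _ gs] := g2P v vT; rewrite gT2 //.
  have [va vb _] := T2N v vT; have [ga' gb' _] := T2N _ gT.
  by apply: Kold => //; exact: sKp.
have nS w : w \in S = false -> w != a /\ w != b.
  by move=> wS; split; apply: contraFneq wS => ->.
have [va vb] := nS v vS; have [sva svb] := nS (s v) (etrans (clS v) vS).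
exact: Kold.
Qed.

End Merge.

Lemma packing2 dg G0 H0 : ~~ odd #|V| -> simple_graph G0 -> (forall v, deg G0 v = dg v) ->
  simple_graph H0 -> (forall v, deg H0 v + 2 = dg v) -> packing 2 dg.
Proof.
move=> evV gG0 dG0 gH0 dH0; have dGH0 v : deg G0 v = deg H0 v + 2 by rewrite dG0.
have [G1 [H1 [gG1 gH1 dG1 dH1 HG1]]] := kundu gG0 gH0 dGH0.
have dGH1 v : deg G1 v = deg H1 v + 2 by rewrite dG1 dH1.
have K2 := minus_deg HG1 dGH1.
(* The 2-regular difference is a sum of two permutation matrices. Only the first is kept and turned
   into an involution; what it leaves of the final difference is 1-regular, so it is a second
   matching. *)
have [||t [injt tW]] := @birkhoff V 2 (fun v w => minus G1 H1 v w).
- by move=> v; rewrite -deg_sum.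
- by move=> v; under eq_bigr do rewrite minus_sym //; rewrite -deg_sum.
have sK1 v : minus G1 H1 v (t ord0 v).
  by have := tW v (t ord0 v); rewrite big_ord_recl eqxx; case: (minus _ _ _ _).
have dG2 v : deg G1 v = dg v by rewrite dG1.
move: gG1 gH1 HG1 dG2 dGH1 (injt ord0) sK1; move: (t ord0).
clear -evV; move=> s; have [n] := ubnP (nonpairs s); elim: n s G1 H1 => // n IH s G H lt.
move=> gG gH HG dG dGH inj sK.
have [/existsP[x nx]|no] := boolP [exists x, s (s x) != x].
  have [G' [H' [s' [[gG' gH' HG'] dG' dH' inj' [sK' lt']]]]] := pair_orbits gG gH HG dGH inj sK evV nx.
  apply: (IH s' G' H') => //; first by rewrite -ltnS; apply: leq_trans lt' lt.
  - by move=> v; rewrite dG'.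
  - by move=> v; rewrite dG' dH'.
have invs : involutive s.
  by move=> x; apply/eqP; move: no; rewrite negb_exists => /forallP/(_ x); rewrite negbK.
have symK := minus_sym gG gH.
pose L v w := minus G H v w && (w != s v).
have symL : symmetric L.
  move=> v w; rewrite /L symK; congr (_ && ~~ _).
  by apply/eqP/eqP => ->; rewrite invs.
have dL v : deg L v = 1.
  have := minus_deg HG dGH v; have : deg (minus G H) v = deg L v + \sum_w (w == s v).
    rewrite !deg_sum -big_split; apply: eq_bigr => w _; rewrite /L /=.
    by have [->|] := eqVneq w (s v); rewrite ?sK ?andbT ?addn0.
  by rewrite sumT1; clear; lia.
have [r [invr rL _]] := one_regular dL symL.
have Gs v : G v (s v) by case/andP: (sK v).
have Gr v : G v (r v) by case/andP: (rL v) => /andP[].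
have rs v : r v != s v by case/andP: (rL v).
exists G, (fun i : 'I_2 => if i == ord0 then s else r); split=> // [|i v].
- split=> [i|i v _|i j v]; try by case: ifP.
  case: eqP => [->|i0]; case: eqP => [->|j0] // e _.
  + by have := rs v; rewrite e eqxx.
  + by have := rs v; rewrite e eqxx.
  + apply/val_inj; have : val i <> 0 by move=> i'; apply: i0; apply/val_inj.
    have : val j <> 0 by move=> j'; apply: j0; apply/val_inj.
    by have := ltn_ord i; have := ltn_ord j; rewrite /=; clear; lia.
- by case: ifP => _; rewrite eq_sym; apply: simple_neq gG _.
Qed.

End SmallK.

(** * From the conditions on the sequence to degree counts *)

Local Open Scope ring_scope.

Lemma durfee_ge n (s : n.-tuple int) i :
  (0 < i <= n)%N -> i%:Z - 1 <= term s i -> (i <= durfee s)%N.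
Proof.
move=> lei si; rewrite /durfee.
by apply: (leq_bigmax_seq (F := id)) => //; rewrite mem_index_iota ltnS.
Qed.

Lemma ceil_half (z t : int) : (Num.ceil (z%:~R / 2 : rat) <= t) = (z <= 2 * t).
Proof. by rewrite ceil_le_int ler_pdivrMr // -(intrM _ t 2) ler_int mulrC. Qed.

Lemma card_ltn_ord n q : (q <= n)%N -> #|[set i : 'I_n | (i < q)%N]| = q.
Proof.
move=> qn; rewrite -sum1_card (eq_bigl (fun i : 'I_n => (i < q)%N)) => [|i]; last by rewrite inE.
by rewrite -(big_ord_widen n (fun=> 1%N) qn) sum1_card card_ord.
Qed.

Lemma term_tnth n (s : n.-tuple int) (i : 'I_n) : term s i.+1 = tnth s i.
Proof. by rewrite /term /= (tnth_nth 0). Qed.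

Lemma nonincreasing_tnth n (s : n.-tuple int) (i j : 'I_n) :
  nonincreasing s -> (i <= j)%N -> tnth s j <= tnth s i.
Proof.
move=> ns ij; rewrite !(tnth_nth 0).
have tr : transitive (fun x y : int => y <= x) by move=> a b c ab ca; exact: le_trans ca ab.
by apply: (sorted_leq_nth tr (@lexx _ _) 0 ns); rewrite ?inE ?size_tuple.
Qed.

(** Serves both conditions: [p] is the identity for the sequence itself, and [rev_ord] for the
    complement, whose terms come in reversed vertex order. *)
Lemma packing_durfee n k (s : n.-tuple int) (dg : 'I_n -> nat) (p : 'I_n -> 'I_n) (G0 H0 : rel 'I_n) :
    (0 < n)%N -> ~~ odd n -> (2 < k)%N -> involutive p ->
    (forall i, (dg (p i))%:Z = tnth s i) ->
    (forall i j : 'I_n, (i <= j)%N -> tnth s j <= tnth s i) -> (forall i, 1 <= tnth s i) ->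
    n%:Z + 3 * k%:Z <= 2 * term s (minn n./2 (durfee s - 1)) + 6 ->
    simple_graph G0 -> (forall v, deg G0 v = dg v) ->
    simple_graph H0 -> (forall v, deg H0 v + k = dg v)%N -> packing k dg.
Proof.
move=> n0 evn k3 pinv dE sdec spos hD gG0 dG0 gH0 dH0.
have nE : n = (2 * n./2)%N by rewrite mul2n even_halfK.
(* [c] is the ceiling of (3k - 6)/2, so the hypothesis on the term reads exactly: it is at least nu
   + c. *)
set m := durfee s in hD; pose nu := n./2; pose c := uphalf (3 * k - 6).
have cV : #|'I_n| = (2 * nu)%N by rewrite card_ord.
have cE : (3 * k <= 2 * c + 6 <= 3 * k + 1)%N.
  by have := odd_double_half (3 * k - 6).+1; rewrite /c uphalfE; move: k3; clear; lia.
(* This keeps the index min(nu, m - 1) at least 1, where the 1-based [term] is meaningful. *)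
have m2 : (2 <= m)%N.
  have n1 : (1 < n)%N by move: n0 nE; clear; lia.
  apply: durfee_ge; first by rewrite n1.
  by rewrite (term_tnth s (Ordinal n1)); exact: spos.
pose q := minn nu (m - 1).
have q0 : (0 < q)%N by rewrite /q /nu; move: n0 nE m2; clear; lia.
have qn : (q.-1 < n)%N by rewrite /q /nu; move: n0 nE; clear; lia.
have qs : (q <= n)%N by move: q0 qn; clear; lia.
have cB : (q <= #|Bg nu c dg|)%N.
  rewrite -{1}(card_ltn_ord qs) -(card_imset _ (inv_inj pinv)).
  apply/subset_leq_card/subsetP => v /imsetP[i]; rewrite !inE => iq ->.
  have := sdec i (Ordinal qn) _; rewrite -(dE i) -(term_tnth s (Ordinal qn)) /= prednK // => le.
  have {}le : term s q <= dg (p i) by apply: le; move: iq; clear; lia.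
  by move: hD le cE nE; rewrite -/nu -/q; clear; lia.
have [num|num] := leqP nu (m - 1).
  apply: (@packing_high _ nu c k dg G0 H0) => //; first by move: cE; clear; lia.
  by apply: leq_trans cB; rewrite /q (minn_idPl num).
have mn : (m <= n)%N by move: num nE; rewrite /nu; clear; lia.
apply: (@packing_low _ nu c m k dg G0 H0) => //.
- by move: cE; clear; lia.
- by move: num; clear; lia.
- by move: cB; rewrite /q (minn_idPr (ltnW num)); clear; lia.
rewrite -[X in (_ <= X)%N](card_ltn_ord mn) -[X in (_ <= X)%N](card_imset _ (inv_inj pinv)).
apply/subset_leq_card/subsetP => v; rewrite inE => mv; apply/imsetP; exists (p v); rewrite ?pinv //.
(* A vertex of degree at least m beyond the first m positions would force the term at m + 1 to be at
   least m, and so a larger Durfee number. *)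
rewrite inE ltnNge; apply/negP => mp.
have mn' : (m < n)%N by apply: leq_ltn_trans mp (ltn_ord _).
have : (m.+1 <= m)%N; last by rewrite ltnn.
apply: durfee_ge; first by rewrite mn'.
have := sdec (Ordinal mn') (p v) mp; rewrite -(dE (p v)) pinv -(term_tnth s (Ordinal mn')) /=.
by move: mv; clear; lia.
Qed.

Lemma tnth_complement_Dk n k (d : n.-tuple int) (i : 'I_n) :
  tnth (complement (Dk k d)) i = n%:Z - 1 - (tnth d (rev_ord i) - k%:Z).
Proof.
rewrite (tnth_nth 0) /= nth_rev ?size_map ?size_tuple //.
have lt : (n - i.+1 < n)%N by have := ltn_ord i; clear; lia.
by rewrite (nth_map 0) ?size_map ?size_tuple // (nth_map 0) ?size_tuple // (tnth_nth 0).
Qed.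

Theorem theorem1p9 (n k : nat) (d : n.-tuple int)
  (n_even : ~~ odd n) (k_pos : (0 < k)%N)
  (d_noninc : nonincreasing d) (d_pos : positive d)
  (d_graphic : graphic d) (Dk_graphic : graphic (Dk k d))
  (hd : Num.ceil ((n%:R + 3 * k%:R - 8) / 2 : rat)
          < term d (minn n./2 (durfee d - 1))
     \/ term d (maxn (n./2 + 1) (n + 2 - durfee (complement (Dk k d))))
          < Num.ceil ((n%:R + 5 - k%:R) / 2 : rat)) :
  exists2 e : rel 'I_n, realization d e &
    exists F : 'I_k -> rel 'I_n,
      (forall i, one_factor e (F i)) /\
      (forall i j, i != j -> edge_disjoint (F i) (F j)).
Proof.
have [G0 [gG0 dG0]] := d_graphic; have [H0 [gH0 dH0]] := Dk_graphic.
pose dg v := deg G0 v.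
have dgE i : (dg i)%:Z = tnth d i by rewrite -dG0 degreeE.
have dgH i : (deg H0 i + k = dg i)%N.
  have := dH0 i; rewrite degreeE tnth_map -dgE; clear; lia.
suff [G [F [gG dG [inv FG dis] pF]]] : packing k dg.
  exists G; first by split=> // i; rewrite degreeE dG dgE.
  exists (fun i v w => w == F i v); split=> [i|i j ij x y].
    split=> [|v w /eqP->|v]; last by rewrite /degree (eq_card (fun w => in_set _ _)) ?card1.
      split=> [v w|v]; last by rewrite eq_sym; apply/negbTE.
      by apply/eqP/eqP => ->; rewrite inv.
    exact: FG.
  apply/negP => /andP[/eqP-> /eqP e]; case/eqP: ij.
  by apply: dis e _; exact: pF.
have cV : #|'I_n| = n by rewrite card_ord.
have [k3|k2] := ltnP 2 k; last first.
  case: k k_pos k2 dgH {Dk_graphic hd dH0} => // -[|[|//]] _ _ dgH; first exact: (packing1 gG0 _ gH0 dgH).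
  by apply: (packing2 _ gG0 _ gH0 dgH); rewrite ?cV.
have [n0|n0] := posnP n.
  (* With no vertices any [c] will do; 3k satisfies the arithmetic condition. *)
  apply: (@packing_high _ 0 (3 * k) k dg G0 H0) => //; first by rewrite cV n0.
  by clear; lia.
have d1 i : 1 <= tnth d i by move/all_tnthP: d_pos.
have nE : n = (2 * n./2)%N by rewrite mul2n even_halfK.
case: hd => hd.
  apply: (@packing_durfee n k d dg id G0 H0) => // [i j|].
    exact: nonincreasing_tnth.
  move: hd; have -> : n%:R + 3 * k%:R - 8 = (n%:Z + 3 * k%:Z - 8)%:~R :> rat.
    by rewrite rmorphB rmorphD rmorphM /= !pmulrn.
  set D := term d _ => lt; have : Num.ceil ((n%:Z + 3 * k%:Z - 8)%:~R / 2 : rat) <= D - 1.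
    by rewrite lerBrDr lezD1.
  by rewrite ceil_half; clear; lia.
(* These are the degrees of the complement of [H0]. *)
pose dg' v := (n + k - dg v - 1)%N.
have dlt v : (dg v < n)%N by have := compl_deg v gG0; rewrite cV -/(dg v); clear; lia.
apply: (@packing_dual _ _ _ dg'); first by move=> v; have := dlt v; rewrite /dg' cV; clear; lia.
set s := complement (Dk k d) in hd.
have sE i : tnth s i = n%:Z - 1 - ((dg (rev_ord i))%:Z - k%:Z).
  by rewrite tnth_complement_Dk dgE.
apply: (@packing_durfee n k s dg' (@rev_ord n) (compl H0) (compl G0)) => //.
- exact: rev_ordK.
- by move=> i; rewrite sE /dg'; have := dlt (rev_ord i); clear; lia.
- move=> i j ij; rewrite !sE !dgE.
  have := @nonincreasing_tnth n d (rev_ord j) (rev_ord i) d_noninc; rewrite /= => h.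
  have {}h := h (leq_sub2l n (ij : (i.+1 <= j.+1)%N)); move: h; clear; lia.
- by move=> i; rewrite sE; have := dlt (rev_ord i); move: k_pos; clear; lia.
- move: hd; have -> : n%:R + 5 - k%:R = (n%:Z + 5 - k%:Z)%:~R :> rat.
    by rewrite rmorphB rmorphD /= !pmulrn.
  rewrite ltNge ceil_half -ltNge.
  have n1 : (1 < n)%N by move: n0 nE; clear; lia.
  have m2 : (2 <= durfee s)%N.
    apply: durfee_ge; first by rewrite n1.
    rewrite (term_tnth s (Ordinal n1)) sE; have := dlt (rev_ord (Ordinal n1)).
    by move: k_pos; clear; lia.
  (* Position q of the complement is position r = n + 1 - q of [d], and the term there is n - 1 -
     d_r + k; substituting it turns the second condition into the first one for [s]. *)
  set q := minn _ _; set r := maxn _ _.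
  have qn : (q.-1 < n)%N by rewrite /q; move: n0; clear; lia.
  have q0 : (0 < q)%N by rewrite /q; move: n1 m2 nE; clear; lia.
  have := term_tnth s (Ordinal qn); rewrite sE dgE -(term_tnth d) /= prednK // => ->.
  have -> : (n - q).+1 = r by rewrite /q /r; move: n1 m2 nE; clear; lia.
  by clear; lia.
- exact: compl_simple.
- by move=> v; have := compl_deg v gH0; have := dgH v; have := dlt v; rewrite cV /dg'; clear; lia.
- exact: compl_simple.
- by move=> v; have := compl_deg v gG0; have := dlt v; rewrite cV /dg' -/(dg v); clear; lia.
Qed.
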